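(* Suppose that $X$ has a countable base of open sets and that $G$ is perfect (consistent and strictly positive definite) and satisfies the maximum principle. Consider a set $A\subset X$ with $c^*(A)<+\infty$ and a quasiclosure $A^*$ of $A$. Then $c^*(A)=c(A^* )$. The equilibrium measure $\mu_{A^*}$ on $A^*$, also called the outer equilibrium measure on $A$ and denoted $\mu_A^*$, is carried by $A^*$ and is characterized within $\mathcal E^+(A^* )$ by the property (a$^*$) $G\mu_A^*=1$ q.e. on $A^*$ (hence q.e. on $A$). Furthermore: (b$^*$) $G\mu_A^*\le1$ everywhere on $X$; (c$^*$) $\mu_A^*(X)=\|\mu_A^*\|^2=c^*(A)^2$; (d$^*$) $c^*(A)=\min\{\|\lambda\|:\lambda\in\mathcal E^+,\ G\lambda\ge1\text{ q.e. on }A\}$.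
   Context: $X$ is a nonempty locally compact Hausdorff space, $\mathcal M^+$ the set of positive Radon measures on $X$ with the vague topology (coarsest topology making $\mu\mapsto\int\varphi\,d\mu$ continuous for every continuous compactly supported $\varphi$). $G:X\times X\to[0,+\infty]$ is a kernel: lower semicontinuous (l.s.c.), symmetric, and $G(x,x)>0$ for all $x$. For $\mu\in\mathcal M^+$: $G\mu(x)=\int G(x,y)\,d\mu(y)$, $\|\mu\|=(\int G\mu\,d\mu)^{1/2}$; $\mathcal E^+=\{\mu\in\mathcal M^+:\|\mu\|<+\infty\}$, $\mathcal E^+_1=\{\mu\in\mathcal M^+:\|\mu\|\le1\}$. $\mathcal E^+(A)$: measures $\mu\in\mathcal E^+$ carried by $A$, i.e. with $X\setminus A$ locally $\mu$-negligible. $\mathcal F^+$: all functions $X\to[0,+\infty]$. $\mathcal G$: l.s.c. functions in $\mathcal F^+$. $\mathcal H_0$: finite-valued upper semicontinuous (u.s.c.) functions $X\to[0,+\infty[$ of compact support. $\mathcal C_0^+=\mathcal G\cap\mathcal H_0$. Energy capacity: $c(\varphi)=\max\{\int\varphi\,d\mu:\mu\in\mathcal E_1^+\}$ for $\varphi\in\mathcal C_0^+$; $c(h)=\inf\{c(\varphi):\varphi\in\mathcal C_0^+,\varphi\ge h\}$ for $h\in\mathcal H_0$; $c(g)=\sup\{c(\varphi):\varphi\in\mathcal C_0^+,\varphi\le g\}$ for $g\in\mathcal G$. For $f\in\mathcal F^+$: $c_*(f)=\sup\{c(h):h\in\mathcal H_0,h\le f\}$, $c^*(f)=\inf\{c(g):g\in\mathcal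 G,g\ge f\}$. For $E\subset X$: $c^*(E)=c^*(1_E)$, $c_*(E)=c_*(1_E)$, and $c(E)$ is the common value when they coincide. q.e. (on $A$): except on a set (subset of $A$) $E$ with $c^*(E)=0$. $f\in\mathcal F^+$ is quasi u.s.c. if for every $\varepsilon>0$ there is $V\subset X$ with $c^*(V)<\varepsilon$ and $f|_{X\setminus V}$ u.s.c.; $A\subset X$ is quasiclosed if $1_A$ is quasi u.s.c. A set $B$ quasicontains $A$ if $c^*(A\setminus B)=0$. A quasiclosure of $A$ is a quasiclosed set $A^*$ quasicontaining $A$ such that every quasiclosed set quasicontaining $A$ also quasicontains $A^*$. $G$ is consistent if for every $\lambda\in\mathcal E^+$ the function $\mu\mapsto\int G\lambda\,d\mu$ on $\mathcal E^+_1$ is finite and vaguely continuous. $G$ is strictly positive definite if $\int G\mu\,d\nu\le\|\mu\|\,\|\nu\|$ for all $\mu,\nu\in\mathcal E^+$, and $\|\mu\|^2+\|\nu\|^2-2\int G\mu\,d\nu=0$ with $\mu,\nu\in\mathcal E^+$ implies $\mu=\nu$. $G$ satisfies the (Frostman) maximum principle if every $\mu\in\mathcal M^+$ of compact support with $G\mu\le1$ $\mu$-a.e. satisfies $G\mu\le1$ everywhere on $X$. For a quasiclosed set $B$ with $c^*(B)<+\infty$, the equilibrium measure $\mu_B$ on $B$ is the unique measure maximizing $\mu\mapsto2\mu(X)-\|\mu\|^2$ over $\mathcal E^+(B)$. *)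

(* Defs.v *)
From HB Require Import structures.
From mathcomp Require Import all_boot all_order all_algebra.
From mathcomp Require Import all_classical all_reals all_analysis.

Set Implicit Arguments.
Unset Strict Implicit.
Unset Printing Implicit Defensive.
Import Order.TTheory GRing.Theory Num.Theory.
Import numFieldNormedType.Exports.

Local Open Scope classical_set_scope.
Local Open Scope ring_scope.
Local Open Scope ereal_scope.

(* MathComp-Analysis only builds measurable spaces on pointed types, so the
   nonempty space X is a ptopologicalType throughout. *)
Definition borel (X : ptopologicalType) := g_sigma_algebraType (@open X).

Record radon (R : realType) (X : ptopologicalType) := Radon {
  radon_measure :> {measure set (borel X) -> \bar R} ;
  radon_compact_fin : forall K : set X, compact K -> radon_measure K < +oo ;
  radon_inner_regular : forall B : set (borel X), measurable B ->
    radon_measure B =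
      ereal_sup [set radon_measure K | K in [set K : set X | compact K /\ K `<=` B]]
}.

HB.instance Definition _ (R : realType) (X : ptopologicalType) :=
  gen_eqMixin (radon R X).
HB.instance Definition _ (R : realType) (X : ptopologicalType) :=
  gen_choiceMixin (radon R X).

(* The values of a {measure set _ -> _} on non-Borel sets are unconstrained, so
   equality of measures is equality on the Borel sets. *)
Definition radon_eq (R : realType) (X : ptopologicalType) (mu nu : radon R X) :=
  forall B : set (borel X), measurable B -> mu B = nu B.

Definition test_fun (R : realType) (X : ptopologicalType) :=
  {phi : X -> R | continuous phi /\ compact (closure [set x | phi x != 0%R])}.

Definition test_eval (R : realType) (X : ptopologicalType) (mu : radon R X) :
    {ptws test_fun R X -> R} :=
  fun phi => (\int[mu]_x (sval phi x))%R.

(* The vague topology: a topology makes [test_eval] continuous into the product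
   topology iff it makes all the maps mu |-> \int phi dmu continuous. *)
HB.instance Definition _ (R : realType) (X : ptopologicalType) :=
  Topological.copy (radon R X) (initial_topology (@test_eval R X)).

Section semicontinuous_classes.
Context {R : realType}.

Definition upper_semicontinuous {X : topologicalType} (f : X -> \bar R) :=
  forall x (a : R), f x < a%:E ->
    exists2 V, nbhs x V & forall y, V y -> f y < a%:E.

Context {X : ptopologicalType}.
Implicit Types f : X -> \bar R.

Definition class_F f := forall x, 0 <= f x.

Definition class_G f := class_F f /\ lower_semicontinuous f.

Definition class_H0 f := [/\ class_F f, forall x, f x < +oo,
  upper_semicontinuous f & compact (closure [set x | f x != 0])].

Definition class_C0 f := class_G f /\ class_H0 f.

End semicontinuous_classes.

Section energy.
Context {R : realType} {X : ptopologicalType} (G : X * X -> \bar R).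
Implicit Types (mu nu lam : radon R X) (A B E : set X) (f g h phi : X -> \bar R).

Definition kernel_on := [/\ forall z, 0 <= G z, lower_semicontinuous G,
  forall x y, G (x, y) = G (y, x) & forall x, 0 < G (x, x)].

Definition potential mu (x : X) : \bar R := \int[mu]_y G (x, y).

Definition mutual_energy mu nu : \bar R := \int[nu]_x potential mu x.

Definition energy_norm mu : \bar R := sqrte (mutual_energy mu mu).

Definition finite_energy : set (radon R X) := [set mu | energy_norm mu < +oo].

Definition energy_ball : set (radon R X) := [set mu | energy_norm mu <= 1].

(* ~` A is locally mu-negligible. *)
Definition carried_by A mu :=
  forall K : set X, compact K -> mu.-negligible (K `&` ~` A).

Definition finite_energy_on A : set (radon R X) :=
  [set mu | finite_energy mu /\ carried_by A mu].

Definition cap_C0 phi : \bar R :=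
  ereal_sup [set \int[mu]_x phi x | mu in energy_ball].

Definition cap_H0 h : \bar R := ereal_inf
  [set cap_C0 phi | phi in [set phi | class_C0 phi /\ forall x, h x <= phi x]].

Definition cap_G g : \bar R := ereal_sup
  [set cap_C0 phi | phi in [set phi | class_C0 phi /\ forall x, phi x <= g x]].

Definition inner_cap_fun f : \bar R := ereal_sup
  [set cap_H0 h | h in [set h | class_H0 h /\ forall x, h x <= f x]].

Definition outer_cap_fun f : \bar R := ereal_inf
  [set cap_G g | g in [set g | class_G g /\ forall x, f x <= g x]].

Definition inner_cap E : \bar R := inner_cap_fun (fun x => (\1_E x)%:E).

Definition outer_cap E : \bar R := outer_cap_fun (fun x => (\1_E x)%:E).

(* "c(E) is defined and equal to v" *)
Definition has_capacity E (v : \bar R) := inner_cap E = v /\ outer_cap E = v.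

Definition quasi_everywhere_on A (P : X -> Prop) :=
  exists E : set X, [/\ E `<=` A, outer_cap E = 0 & forall x, (A `\` E) x -> P x].

Definition quasi_usc f := forall e : R, (0 < e)%R -> exists V : set X,
  outer_cap V < e%:E /\ upper_semicontinuous (f : subspace (~` V) -> \bar R).

Definition quasiclosed A := quasi_usc (fun x => (\1_A x)%:E).

Definition quasicontains B A := outer_cap (A `\` B) = 0.

Definition is_quasiclosure A Astar := [/\ quasiclosed Astar, quasicontains Astar A &
  forall B, quasiclosed B -> quasicontains B A -> quasicontains B Astar].

Definition consistent := forall lam, finite_energy lam ->
  (forall mu, energy_ball mu -> mutual_energy lam mu \is a fin_num) /\
  {within energy_ball, continuous (mutual_energy lam)}.

Definition strictly_positive_definite :=
  (forall mu nu, finite_energy mu -> finite_energy nu ->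
     mutual_energy mu nu <= energy_norm mu * energy_norm nu) /\
  (forall mu nu, finite_energy mu -> finite_energy nu ->
     energy_norm mu ^+ 2 + energy_norm nu ^+ 2 - 2%:E * mutual_energy mu nu = 0 ->
     radon_eq mu nu).

Definition perfect := consistent /\ strictly_positive_definite.

Definition measure_support mu : set X :=
  [set x | forall U : set X, open U -> U x -> 0 < mu U].

Definition maximum_principle := forall mu, compact (measure_support mu) ->
  {ae mu, forall x, potential mu x <= 1} -> forall x, potential mu x <= 1.

Definition gauss_functional mu : \bar R :=
  2%:E * mu [set: X] - energy_norm mu ^+ 2.

Definition maximizes_gauss_on B mu := finite_energy_on B mu /\
  forall nu, finite_energy_on B nu -> gauss_functional nu <= gauss_functional mu.

Definition is_equilibrium_measure B mu := maximizes_gauss_on B mu /\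
  forall nu, maximizes_gauss_on B nu -> radon_eq nu mu.

End energy.

(* Main.v *)
(* Let gam = c*(A). For an l.s.c. g majorizing the indicator of A, maximizing \int g over
   the unit ball of the energy yields a measure lam_g with ||lam_g|| <= c(g) and
   \int g dnu <= \int G lam_g dnu for all nu, hence G lam_g >= 1 q.e. on A; a convexity
   argument then produces lam with ||lam|| = gam and G lam >= 1 q.e. on A. The level set
   {G lam >= 1} is quasiclosed, so it quasicontains the quasiclosure Q of A, and c*(Q) = gam.
   Compact sets filling Q up to small capacity carry measures of norm at most gam and mass almost
   gam^2, whose limit must be lam; so lam is carried by Q and lam(X) = gam^2 = ||lam||^2.
   As G lam >= 1 lam-a.e., equality holds lam-a.e., and the maximum principle gives
   G lam <= 1 everywhere. All compactness comes from limits of measures along a free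
   ultrafilter on nat. *)
From HB Require Import structures.
From mathcomp Require Import all_boot all_order all_algebra finmap.
From mathcomp Require Import all_classical all_reals all_analysis.
From mathcomp Require Import measurable_realfun ring lra.
Require Import Defs.
Set Implicit Arguments.
Unset Strict Implicit.
Unset Printing Implicit Defensive.
Import Order.TTheory GRing.Theory Num.Theory.
Import numFieldNormedType.Exports.
Local Open Scope classical_set_scope.
Local Open Scope ring_scope.
Local Open Scope ereal_scope.

(** An energy bound controls mass only on compact sets, through a positive lower bound of [G] near
    the diagonal, so limits are vague and mass may escape to infinity. Two facts compensate.
    Consistency makes (lam, nu) continuous in nu on the energy ball, even though G lam need be
    neither continuous nor compactly supported; by a Dini argument G lam is then approximated by
    test functions uniformly against the whole ball, and Chebyshev's inequality turns this into
    pointwise bounds off sets of small capacity. And a measure of the unit ball gives a Borel set at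
    most its outer capacity, which bounds the mass outside the compact sets filling Q, uniformly
    along the sequence. Limits are first described by inequalities on compact and open sets, which
    suit total mass and carriers; vague convergence is derived because consistency is stated in it.
    The countable base makes l.s.c. functions limits of increasing sequences of test functions,
    makes [G] measurable for the product sigma-algebra, as Tonelli's theorem requires, and makes
    every Borel measure finite on compact sets Radon. *)

(** * Locally compact Hausdorff spaces with a countable base *)

Lemma compact_sub_increasing_open (T : ptopologicalType) (K : set T)
    (O : nat -> set T) : compact K -> (forall n, open (O n)) ->
  {homo O : m n / (m <= n)%N >-> m `<=` n} ->
  K `<=` \bigcup_n O n -> exists n, K `<=` O n.
Proof.
move=> cK oO homO KO; move: cK; rewrite (@compact_cover T) => cK.
have [D _ KD] := cK nat setT O (fun i _ => oO i) KO.
exists (\max_(i <- D) i)%N => x /KD [i /= iD Oix].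
by apply: homO Oix; rewrite (big_rem i)//= leq_max leqnn.
Qed.

Section potential_theory.
Context {R : realType} {X : ptopologicalType}.
Hypothesis X_hausdorff : hausdorff_space X.
Hypothesis X_lc : locally_compact [set: X].

Lemma nbhs_compact_nbhs (x : X) (V : set X) : nbhs x V ->
  exists2 K, compact K & nbhs x K /\ K `<=` V.
Proof.
have [B xB [cB _]] := @X_lc x I.
have {}xB : nbhs x B by move: xB; rewrite /within/=; apply: filterS => y; exact.
move=> xV; have rx := compact_regular X_hausdorff cB xB.
have [W xW WV] : filter_from (nbhs x) closure (V `&` B).
  exact: (rx (V `&` B) (filterI xV xB)).
exists (closure W).
  by apply: (subclosed_compact _ cB); [exact: closed_closure|move=> y /WV[]].
by split; [apply: filterS xW; exact: subset_closure|move=> y /WV[]].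
Qed.

Hypothesis X_sc : @second_countable X.

Lemma countable_base : exists b : nat -> set X, (forall n, open (b n)) /\
  forall x V, nbhs x V -> exists2 n, b n x & b n `<=` V.
Proof.
have [B cB [Bo Bnbhs]] := X_sc.
have [e eB] : exists e : nat -> set X, B `<=` range e /\ (forall n, open (e n)).
  have := elimT pfcard_geP cB.
  case=> [B0|]; first by exists (fun=> set0); split=> [A|_]; [rewrite B0|exact: open0].
  case=> f; exists (fun n => if `[< open (f n) >] then f n else set0).
  split=> [A BA|n]; last by case: asboolP => // _; exact: open0.
  have [n _ fn] := @surj _ _ _ _ f _ BA; exists n => //.
  by rewrite /= fn; case: asboolP => // nA; case: nA; exact: Bo.
exists e; split=> [|x V /Bnbhs [U [BU Ux] UV]]; first exact: eB.2.
by have [n _ enU] := eB.1 _ BU; exists n; rewrite enU.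
Qed.

(** Finite unions of the compact closures of base sets that lie in [U]. By local compactness the
    base sets with this property cover [U], so the interiors of these unions swallow every compact
    subset. *)
Lemma open_exhaustion (U : set X) : open U -> exists K : nat -> set X,
  [/\ forall n, compact (K n), forall n, K n `<=` (K n.+1)°,
      forall n, K n `<=` U &
      forall L, compact L -> L `<=` U -> exists n, L `<=` (K n)°].
Proof.
move=> oU; have [b [bo bnbhs]] := countable_base.
pose c i := if `[< precompact (b i) /\ closure (b i) `<=` U >]
  then closure (b i) else set0.
have cc i : compact (c i).
  rewrite /c; case: asboolP => [[+ _]|_]; last exact: compact0.
  by rewrite precompactE.
have cU i : c i `<=` U by rewrite /c; case: asboolP => [[_ ?]|_ x].
pose D n := \bigcup_(i < n) c i.
have cD n : compact (D n).
  rewrite /D bigcup_mkord.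
  by apply: bigsetU_compact => // i _.
have DU n : D n `<=` U by move=> x [i _] /cU.
have DS m n : (m <= n)%N -> D m `<=` D n.
  by move=> mn x [i /= im Hi]; exists i => //=; exact: leq_trans im mn.
have Dint L : compact L -> L `<=` U -> exists n, L `<=` (D n)°.
  move=> cL LU; apply: (@compact_sub_increasing_open X L (fun n => (D n)°)) => //.
  - by move=> n; exact: open_interior.
  - by move=> m n mn; apply: interiorS; exact: DS.
  - move=> x /LU Ux.
    have [K cK [xK KU]] := nbhs_compact_nbhs (open_nbhs_nbhs (conj oU Ux)).
    have [i bix biK] := bnbhs _ _ xK.
    have clK : closed K by exact: compact_closed.
    have clbK : closure (b i) `<=` K by rewrite [K](closure_id _).1//; exact: closureS.
    exists i.+1 => //; apply: (@filterS _ _ _ (b i)); last exact: open_nbhs_nbhs.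
    move=> y biy; exists i => //=; rewrite /c; case: asboolP => [_|[]].
      exact: subset_closure.
    split; first by rewrite precompactE; exact: (subclosed_compact (@closed_closure _ _) cK clbK).
    exact: subset_trans KU.
have /choice[f fP] n : exists m, D n `<=` (D m)° by exact: Dint.
(* A subsequence of [D]: [f] puts each term in the interior of the next, and the maximum with [m.+1]
   keeps the indices unbounded. *)
pose g := fix g n := if n is m.+1 then maxn (f (g m)) m.+1 else 0%N.
have gn n : (n <= g n)%N by case: n => //= n; rewrite leq_maxr.
exists (D \o g); split => //.
- by move=> n; exact: cD.
- by move=> n; apply: (subset_trans (fP _)); apply: interiorS; apply: DS; rewrite /= leq_maxl.
- by move=> n; exact: DU.
- move=> L cL LU; have [n Ln] := Dint L cL LU; exists n.
  by apply: (subset_trans Ln); apply: interiorS; exact: DS.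
Qed.

(** Complete regularity separates each point of [K] from the complement of the interior of one
    compact [E n] inside [U]; compactness leaves finitely many of these functions, all vanishing off
    the same [E n]. *)
Lemma compact_urysohn (K U : set X) : compact K -> open U -> K `<=` U ->
  exists f : X -> R, [/\ continuous f, forall x, (0 <= f x <= 1)%R,
    forall x, K x -> f x = 1%R &
    exists2 L, compact L & L `<=` U /\ forall x, f x != 0%R -> L x].
Proof.
move=> cK oU KU.
have [E [cE _ EU EL]] := open_exhaustion oU.
have [n Kn] := EL K cK KU.
have H x : K x -> exists f : X -> R, [/\ continuous f, forall x, (0 <= f x)%R,
    f x = 1%R & forall x, f x != 0%R -> E n x].
  move=> Kx.
  have crs := @locally_compact_completely_regular X R X_lc X_hausdorff.
  have /(uniform_separatorP (R:=R))[f [cf f01 fx0 fU1]] :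
      uniform_separator [set x] (~` (E n)°).
    apply: crs; first by apply: open_closedC; exact: open_interior.
    by apply; exact: Kn.
  have f1 y : (f y <= 1)%R by have := f01 (f y); rewrite /= in_itv/= => /(_ _)/andP[]//; exists y.
  exists (fun y => 1 - f y)%R; split.
  - by move=> y; apply: cvgB; [exact: cvg_cst|exact: cf].
  - by move=> y; rewrite subr_ge0.
  - by rewrite (fx0 (f x)) ?subr0//; exists x.
  - move=> y; apply: contra_neqP => nEy; rewrite (fU1 (f y)) ?subrr//; exists y => //.
    by move=> /interior_subset.
have /choice[F FP] x : exists f : X -> R, [/\ continuous f, forall x, (0 <= f x)%R,
    K x -> f x = 1%R & forall x, f x != 0%R -> E n x].
  have [Kx|nKx] := pselect (K x).
    by have [f [? ? ? ?]] := H x Kx; exists f; split.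
  exists (fun=> 0%R); split => //; first by move=> y; exact: cvg_cst.
  by move=> y; rewrite eqxx.
have : finite_subset_cover K (fun x => F x @^-1` [set r | 2^-1 < r]%R) K.
  move: cK; rewrite compact_cover; apply.
    by move=> x Kx; apply: open_comp; [move=> y _; have [+ _ _ _] := FP x; exact|exact: open_gt].
  move=> x Kx; exists x => //=; have [_ _ -> // _] := FP x.
  by rewrite invf_lt1// ltr1n.
move=> [D _ KD].
pose g x := (\sum_(i <- enum_fset D) F i x)%R.
have gc : continuous g.
  rewrite /g; elim: (enum_fset D) => [|i s IH] x.
    by under eq_fun do rewrite big_nil; exact: cvg_cst.
  under eq_fun do rewrite big_cons.
  apply: cvgD; last exact: IH.
  by have [+ _ _ _] := FP i; exact.
have g0 x : (0 <= g x)%R by apply: sumr_ge0 => i _; have [_ + _ _] := FP i; exact.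
(* On [K] some summand of [g] exceeds 1/2, so [2 * g] exceeds 1 there and the truncation gives the
   exact value 1. *)
exists (fun x => Num.min 1 (2 * g x))%R; split.
- move=> x; apply: (@continuous_min _ _ (fun=> 1%R) (fun x => 2 * g x)%R); first exact: cvg_cst.
  by apply: cvgM; [exact: cvg_cst|exact: gc].
- by move=> x; rewrite le_min ler01 mulr_ge0//= ge_min lexx.
- move=> x /KD[i /= iD iF]; apply/min_idPl.
  rewrite -ler_pdivrMl// mulr1; apply: (le_trans (ltW iF)).
  rewrite /g (big_rem i)//= lerDl; apply: sumr_ge0 => j _.
  by have [_ + _ _] := FP j; exact.
- exists (E n) => //; split => // x; apply: contra_neqP => nEx.
  have -> : g x = 0%R.
    rewrite /g big1// => i _; have [_ _ _ /(_ x) h] := FP i.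
    by apply/eqP; apply: contraPT nEx => /h ? [].
  by rewrite mulr0 min_r.
Qed.

(** * Compactly supported continuous functions and approximation from below *)

Definition cc_fun (f : X -> R) :=
  continuous f /\ compact (closure [set x | f x != 0%R]).

(** Makes a countable family monotone; the start at 0 makes it nonnegative as well. *)
Fixpoint running_max (f : nat -> X -> R) n x : R :=
  if n is m.+1 then Num.max (running_max f m x) (f m x) else 0%R.

Lemma running_max_ge0 f n x : (0 <= running_max f n x)%R.
Proof. by elim: n => //= n IH; rewrite le_max IH. Qed.

Lemma running_max_le f m n x : (m <= n)%N -> (running_max f m x <= running_max f n x)%R.
Proof.
elim: n => [|n IH]; first by rewrite leqn0 => /eqP ->.
rewrite leq_eqVlt => /predU1P[->//|]; rewrite ltnS => /IH h.
by rewrite /= le_max h.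
Qed.

Lemma running_max_ge f n x : (f n x <= running_max f n.+1 x)%R.
Proof. by rewrite /= le_max lexx orbT. Qed.

Lemma cc_fun0 : cc_fun (fun=> 0%R).
Proof.
split; first by move=> x; exact: cvg_cst.
rewrite (_ : [set _ | _] = set0) ?closure0; first exact: compact0.
by apply/seteqP; split => x //=; rewrite eqxx.
Qed.

Lemma cc_funP (f : X -> R) (L : set X) : continuous f -> compact L ->
  (forall x, f x != 0%R -> L x) -> cc_fun f.
Proof.
move=> cf cL fL; split => //; apply: (subclosed_compact _ cL) => //.
  exact: closed_closure.
have cLL : closed L by exact: compact_closed.
by rewrite [L](closure_id _).1//; exact: closureS.
Qed.

Lemma cc_fun_max f g : cc_fun f -> cc_fun g -> cc_fun (fun x => Num.max (f x) (g x)).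
Proof.
move=> [cf Kf] [cg Kg].
pose L := closure [set x | f x != 0%R] `|` closure [set x | g x != 0%R].
apply: (cc_funP (L := L)).
- by move=> x; apply: continuous_max; [exact: cf|exact: cg].
- exact: compactU.
- move=> x h; have [f0|f0] := eqVneq (f x) 0%R; last by left; exact: subset_closure.
  right; apply: subset_closure => /=; apply: contra_neq h => ->.
  by rewrite f0 maxxx.
Qed.

Lemma cc_funM (r : R) f : cc_fun f -> cc_fun (fun x => r * f x)%R.
Proof.
move=> [cf Kf]; apply: (cc_funP (L := closure [set x | f x != 0%R])) => //.
  by move=> x; apply: cvgM; [exact: cvg_cst|exact: cf].
by move=> x h; apply: subset_closure => /=; apply: contra_neq h => ->; rewrite mulr0.
Qed.

Lemma running_max_cc f n : (forall n, cc_fun (f n)) -> cc_fun (running_max f n).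
Proof.
by move=> ccf; elim: n => [|n IH]; [exact: cc_fun0|exact: cc_fun_max].
Qed.

(** For base sets with the compact closure of [b i] inside [b j] and a rational q >= 0 with q <= g
    on [b j], q times a Urysohn function lies below [g] and equals q on [b i]. There are countably
    many such triples, and by lower semicontinuity their supremum is [g]. *)
Lemma lsc_approx (g : X -> \bar R) : class_G g ->
  exists phi : nat -> X -> R, [/\ forall n, cc_fun (phi n),
    forall n x, (0 <= phi n x)%R, forall n x, (phi n x)%:E <= g x,
    forall m n x, (m <= n)%N -> (phi m x <= phi n x)%R &
    forall x (a : R), a%:E < g x -> exists n, (a < phi n x)%R].
Proof.
move=> [g0 gl]; have [b [bo bnbhs]] := countable_base.
have H (p : nat * nat * rat) : exists f : X -> R, [/\ cc_fun f,
    forall x, (f x)%:E <= g x &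
    compact (closure (b p.1.1)) -> closure (b p.1.1) `<=` b p.1.2 ->
    (0 <= ratr p.2 :> R)%R -> (forall y, b p.1.2 y -> (ratr p.2)%:E <= g y) ->
    forall x, b p.1.1 x -> f x = ratr p.2].
  have [[c1 c2 c3 c4]|nP] := pselect [/\ compact (closure (b p.1.1)),
      closure (b p.1.1) `<=` b p.1.2, (0 <= ratr p.2 :> R)%R &
      forall y, b p.1.2 y -> (ratr p.2)%:E <= g y].
    have [u [cu u01 u1 [L cL [Lb uL]]]] := compact_urysohn c1 (bo _) c2.
    exists (fun x => ratr p.2 * u x)%R; split.
    - by apply: cc_funM; exact: (cc_funP cu cL).
    - move=> x; have [ux|/uL/Lb/c4] := eqVneq (u x) 0%R; first by rewrite ux mulr0.
      by apply: le_trans; rewrite lee_fin ler_piMr//; case/andP: (u01 x).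
    - by move=> _ _ _ _ x bx; rewrite u1 ?mulr1//; exact: subset_closure.
  exists (fun=> 0%R); split => //; first exact: cc_fun0.
  by move=> ? ? ? ?; case: nP.
have [F FP] := choice H.
(* Enumerates the triples (i, j, q); a number that codes no triple gives the zero function. *)
pose f n := if choice.unpickle n is Some p then F p else fun=> 0%R.
have fcc n : cc_fun (f n).
  by rewrite /f; case: choice.unpickle => [p|]; [have [] := FP p|exact: cc_fun0].
have fg n x : (f n x)%:E <= g x.
  by rewrite /f; case: choice.unpickle => [p|//]; have [_ + _] := FP p; exact.
exists (running_max f); split.
- by move=> n; exact: running_max_cc.
- by move=> n x; exact: running_max_ge0.
- by elim=> [|n IH] x //=; rewrite EFin_max ge_max IH fg.
- by move=> m n x; exact: running_max_le.
- move=> x a ag.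
  have [a0|a0] := ltP a 0%R; first by exists 0%N.
  have [q aq qg] : exists2 q : rat, (a < ratr q)%R & (ratr q)%:E < g x.
    case: (g x) ag (g0 x) => [r| |] //.
      rewrite lte_fin => /rat_in_itvoo[q]; rewrite in_itv/= => /andP[aq qr] _.
      by exists q.
    move=> _ _; have /rat_in_itvoo[q] : (a < a + 1)%R by rewrite ltrDl.
    by rewrite in_itv/= => /andP[aq _]; exists q => //; rewrite ltry.
  have [V xV Vg] := gl x _ qg.
  have [j bjx bjV] := bnbhs x V xV.
  have [K cK [xK Kb]] := nbhs_compact_nbhs (open_nbhs_nbhs (conj (bo j) bjx)).
  have [i bix biK] := bnbhs x K xK.
  have clK : closed K by exact: compact_closed.
  have clbK : closure (b i) `<=` K by rewrite [K](closure_id _).1//; exact: closureS.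
  exists (choice.pickle (i, j, q)).+1; apply: lt_le_trans (running_max_ge _ _ _).
  rewrite /f choice.pickleK; have [_ _ -> //] := FP (i, j, q).
  + exact: (subclosed_compact (@closed_closure _ _) cK clbK).
  + exact: subset_trans Kb.
  + by rewrite ltW// (le_lt_trans a0).
  + by move=> y /bjV /Vg /ltW.
Qed.

(** * Radon measures *)

Lemma open_borel (U : set X) : open U -> measurable (U : set (borel X)).
Proof. by move=> oU; exact: sub_sigma_algebra. Qed.

Lemma closed_borel (U : set X) : closed U -> measurable (U : set (borel X)).
Proof.
by move=> cU; rewrite -[U]setCK; apply: measurableC; apply: open_borel; exact: closed_openC.
Qed.

Lemma compact_borel (K : set X) : compact K -> measurable (K : set (borel X)).
Proof. by move=> cK; apply: closed_borel; exact: compact_closed. Qed.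

Local Notation bmeas g := (@measurable_fun _ _ (borel X) (\bar R) setT g).

Lemma lsc_borel (g : X -> \bar R) : lower_semicontinuous g ->
  bmeas g.
Proof.
move=> gl; apply: (measurability _ (ErealGenOInfty.measurableE R)).
move=> /= _ [_ [a ->]] <-; apply: measurableI => //; apply: open_borel.
by rewrite preimage_itvoy; move/lower_semicontinuousP : gl; exact.
Qed.

Lemma continuous_lsc (f : X -> R) : continuous f -> lower_semicontinuous (EFin \o f).
Proof.
move=> cf; apply/lower_semicontinuousP => a /=.
rewrite (_ : [set _ | _] = f @^-1` [set r | a < r]%R); last first.
  by apply/seteqP; split => x /=; rewrite lte_fin.
by apply: open_comp; [move=> x _; exact: cf|exact: open_gt].
Qed.

Lemma continuous_borel (f : X -> R) : continuous f ->
  bmeas (EFin \o f).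
Proof. by move=> /continuous_lsc/lsc_borel. Qed.

Definition compact_finite (mu : {measure set (borel X) -> \bar R}) :=
  forall K : set X, compact K -> mu K < +oo.

Section inner_regularity.
Variables (mu : {measure set (borel X) -> \bar R}) (mu_fin : compact_finite mu).

(* Intersecting with a compact set E makes the measure finite; the sets that can be
   approximated in E from inside and outside then form a sigma-algebra. *)
Let approx (E B : set (borel X)) := forall e : R, (0 < e)%R -> exists C U : set X,
  [/\ compact C, open U, C `<=` B `&` E, B `<=` U & mu ((E `&` U) `\` C) < e%:E].

Let approx_sigma_algebra (E : set X) : compact E -> sigma_algebra setT (approx E).
Proof.
move=> cE; have clE : closed E by exact: compact_closed.
have mE : measurable (E : set (borel X)) by exact: compact_borel.
split.
- move=> e e0; exists set0, set0; split => //; [exact: compact0|exact: open0|].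
  by rewrite setI0 set0D measure0 lte_fin.
- move=> B aB e e0; have [C [U [cC oU CB BU muE]]] := aB e e0.
  exists (E `\` U), (~` C); split.
  + apply: (subclosed_compact _ cE) => [|x []//].
    by rewrite setDE; apply: closedI => //; exact: open_closedC.
  + by apply: closed_openC; exact: compact_closed.
  + move=> x [Ex nUx]; split => //; rewrite setTD => Bx; exact: nUx (BU _ Bx).
  + by rewrite setTD; apply: subsetC => x /CB[].
  + rewrite (_ : (E `&` ~` C) `\` (E `\` U) = (E `&` U) `\` C)//.
    apply/seteqP; split => x /=; first by move=> [[Ex Cx] /not_andP[//|/contrapT]].
    by move=> [[Ex Ux] Cx]; split => //; case.
- move=> A aA e e0.
  have e20 n : (0 < e / 2 / (2 ^ n.+1)%:R)%R by rewrite !divr_gt0// ltr0n expn_gt0.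
  have /choice[C CP] n := aA n _ (e20 n).
  have /choice[U UP] := CP.
  (* The union of all [C k] need not be compact. [D n] is the error left by the first n of them; it
     decreases to a set of measure at most e/2, and finiteness of [mu] on [E] allows stopping at a
     finite n. *)
  pose D n := (E `&` \bigcup_k U k) `\` \bigcup_(k < n) C k.
  have mU n : measurable (U n : set (borel X)) by apply: open_borel; have [] := UP n.
  have mC n : measurable (C n : set (borel X)) by apply: compact_borel; have [] := UP n.
  have mEU : measurable (E `&` \bigcup_k U k : set (borel X)).
    by apply: measurableI => //; exact: bigcup_measurable.
  have mD n : measurable (D n : set (borel X)).
    by apply: measurableD => //; apply: bigcup_measurable => k _.
  have capD : \bigcap_n D n = (E `&` \bigcup_k U k) `\` \bigcup_k C k.
    apply/seteqP; split => x.
      move=> h; have [] := h 0%N I; move=> EUx _; split => // -[k _ Ckx].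
      by have [_] := h k.+1 I; apply; exists k => //=.
    by move=> [EUx nC] n _; split => // -[k _ Ckx]; apply: nC; exists k.
  have mcapD : measurable (\bigcap_n D n : set (borel X)) by exact: bigcap_measurable.
  have cvD : mu (D n) @[n --> \oo] --> mu (\bigcap_n D n).
    apply: nonincreasing_cvg_mu => //.
      apply: le_lt_trans (mu_fin cE); apply: le_measure; rewrite ?inE//.
      by move=> x [[]].
    move=> m n mn; apply/subsetPset => x [EUx nC]; split => // -[k /= km Ckx].
    by apply: nC; exists k => //=; exact: leq_trans mn.
  have cap2 : mu (\bigcap_n D n) < e%:E.
    have mUC n : measurable ((E `&` U n) `\` C n : set (borel X)).
      by apply: measurableD => //; exact: measurableI.
    apply: (@le_lt_trans _ _ (\sum_(0 <= n <oo) mu ((E `&` U n) `\` C n))).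
      apply: measure_sigma_subadditive => //.
      rewrite capD => x [[Ex [k _ Ukx]] nC]; exists k => //; split => // Ckx.
      by apply: nC; exists k.
    apply: (@le_lt_trans _ _ (e / 2)%:E); last by rewrite lte_fin ltr_pdivrMr// ltr_pMr// ltr1n.
    apply: le_trans (epsilon_trick0 xpredT (ltW _)); last by rewrite divr_gt0.
    by apply: lee_nneseries => // n _; have [_ _ _ _ /ltW] := UP n.
  have finD n : mu (D n) \is a fin_num.
    rewrite ge0_fin_numE//; apply: le_lt_trans (mu_fin cE).
    by apply: le_measure; rewrite ?inE//; move=> x [[]].
  have [n Dn] : exists n, mu (D n) < e%:E.
    have := cvD [set y | y < e%:E] (open_ereal_lt' cap2).
    by case=> n _ /(_ n (leqnn n)) h; exists n.
  exists (\bigcup_(k < n) C k), (\bigcup_k U k); split => //.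
  + rewrite bigcup_mkord; apply: bigsetU_compact => // i _.
    by have [] := UP i.
  + by apply: bigcup_open => k _; have [] := UP k.
  + move=> x [k _ Ckx]; have [_ _ CA _ _] := UP k.
    by have [Ax Ex] := CA _ Ckx; split => //; exists k.
  + by move=> x [k _ Akx]; exists k => //; have [_ _ _ + _] := UP k; exact.
Qed.

(** Open sets are countable unions of compact sets, so finiteness on compact sets already places
    them in the sigma-algebra of [approx]. As a result sums, multiples and restrictions of Radon
    measures are Radon. *)
Lemma borel_inner_regular (B : set (borel X)) : measurable B ->
  mu B = ereal_sup [set mu K | K in [set K : set X | compact K /\ K `<=` B]].
Proof.
move=> mB; apply/eqP; rewrite eq_le; apply/andP; split; last first.
  apply: ub_ereal_sup => _ [K [cK KB] <-].
  by apply: le_measure; rewrite ?inE//; exact: compact_borel.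
have [E [cE ES _ EL]] := open_exhaustion openT.
have mE n : measurable (E n : set (borel X)) by exact: compact_borel.
have approxB n : approx (E n) B.
  move: B mB; apply: smallest_sub; first exact: approx_sigma_algebra.
  move=> U oU e e0.
  have [K [cK KS KU KL]] := open_exhaustion oU.
  have mK m : measurable (K m : set (borel X)) by exact: compact_borel.
  have mU : measurable (U : set (borel X)) by exact: open_borel.
  pose D m := (E n `&` U) `\` K m.
  have mD m : measurable (D m : set (borel X)).
    by apply: measurableD => //; exact: measurableI.
  have D0 : \bigcap_m D m = set0.
    apply/seteqP; split => x // h; have [[_ Ux] _] := h 0%N I.
    have [m /(_ x erefl) /interior_subset Km] :=
      KL [set x] (@compact_set1 _ x) (fun y => fun e => eq_ind_r U Ux e).
    by have [_] := h m I; apply.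
  have cvD : mu (D m) @[m --> \oo] --> mu (\bigcap_m D m).
    apply: nonincreasing_cvg_mu => //.
    - apply: le_lt_trans (mu_fin (cE n)); apply: le_measure; rewrite ?inE//.
      by move=> x [[]].
    - by rewrite D0.
    - apply/nonincreasing_seqP => m; apply/subsetPset => x [EUx nK]; split => //.
      by move=> Kx; apply: nK; exact: interior_subset (KS _ _ Kx).
  have [m Dm] : exists m, mu (D m) < e%:E.
    rewrite D0 measure0 in cvD.
    have e0' : (0 : \bar R) < e%:E by rewrite lte_fin.
    have := cvD [set y | y < e%:E] (open_ereal_lt' e0').
    by case=> m _ /(_ m (leqnn m)) h; exists m.
  exists (K m `&` E n), U; split => //.
  - apply: (subclosed_compact _ (cE n)) => [|x []//].
    by apply: closedI; exact: compact_closed.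
  - by move=> x [/KU].
  - rewrite (_ : _ `\` _ = D m)//; apply/seteqP; split => x /= -[[Ex Ux]].
      by move=> /not_andP[nK|//]; split.
    by move=> nK; split => // -[].
have Binc : mu (B `&` E n) @[n --> \oo] --> mu B.
  rewrite [X in _ --> mu X](_ : B = \bigcup_n (B `&` E n)); last first.
    rewrite -setI_bigcupr (_ : \bigcup_i E i = setT) ?setIT//.
    apply/seteqP; split => x // _.
    have [m /(_ x erefl) /interior_subset Em] := EL [set x] (@compact_set1 _ x) (fun _ _ => I).
    by exists m.
  apply: nondecreasing_cvg_mu.
  - by move=> n; exact: measurableI.
  - by apply: bigcup_measurable => n _; exact: measurableI.
  - apply/nondecreasing_seqP => n; apply/subsetPset; apply: setIS.
    by move=> x /ES /interior_subset.
rewrite -(cvg_lim _ Binc)//; apply: lime_le; first by apply/cvg_ex; eexists; exact: Binc.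
apply: nearW => n; apply/lee_addgt0Pr => e e0.
have [C [U [cC oU CB BU muE]]] := approxB n e e0.
have mC : measurable (C : set (borel X)) by exact: compact_borel.
have mU : measurable (U : set (borel X)) by exact: open_borel.
apply: (@le_trans _ _ (mu C + mu ((E n `&` U) `\` C))).
  apply: (@le_trans _ _ (mu (C `|` ((E n `&` U) `\` C)))); last first.
    by apply: measureU2 => //; apply: measurableD => //; exact: measurableI.
  apply: le_measure; rewrite ?inE.
  - exact: measurableI.
  - by apply: measurableU => //; apply: measurableD => //; exact: measurableI.
  - move=> x [Bx Ex]; have [Cx|Cx] := pselect (C x); [by left|right].
    by split => //; split => //; exact: BU.
apply: leeD; last exact: ltW.
by apply: ereal_sup_ubound; exists C => //; split => // x /CB[].
Qed.

End inner_regularity.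

Definition to_radon (mu : {measure set (borel X) -> \bar R}) (mu_fin : compact_finite mu) :
  radon R X := Radon mu_fin (borel_inner_regular mu_fin).

(** * Radon measures from contents on compact sets *)

Section compact_content.
Variable m : set X -> R.
Hypothesis m_ge0 : forall K, compact K -> (0 <= m K)%R.
Hypothesis m_le : forall K L, compact K -> compact L -> K `<=` L -> (m K <= m L)%R.
Hypothesis m_U : forall K L, compact K -> compact L -> (m (K `|` L) <= m K + m L)%R.
Hypothesis m_disjU : forall K L, compact K -> compact L -> K `&` L = set0 ->
  m (K `|` L) = (m K + m L)%R.

(** The classical construction: inner values on open sets, extended to all sets from outside through
    open sets, then restricted to Borel sets by Caratheodory's criterion. *)
Let inner (O : set X) : \bar R :=
  ereal_sup [set (m K)%:E | K in [set K | compact K /\ K `<=` O]].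

Let outer (E : set X) : \bar R :=
  ereal_inf [set inner O | O in [set O | open O /\ E `<=` O]].

Let le_inner O P : O `<=` P -> inner O <= inner P.
Proof.
move=> OP; apply: ub_ereal_sup => _ [K [cK KO] <-]; apply: ereal_sup_ubound.
by exists K => //; split => //; exact: subset_trans OP.
Qed.

Let inner_ub O K : compact K -> K `<=` O -> (m K)%:E <= inner O.
Proof. by move=> cK KO; apply: ereal_sup_ubound; exists K. Qed.

Let inner_ge0 O : 0 <= inner O.
Proof.
apply: le_trans (inner_ub (@compact0 _) (sub0set _)).
by rewrite lee_fin m_ge0//; exact: compact0.
Qed.

Let outer_open O : open O -> outer O = inner O.
Proof.
move=> oO; apply/eqP; rewrite eq_le; apply/andP; split.
  by apply: ereal_inf_lbound; exists O => //; split.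
by apply: le_ereal_inf_tmp => _ [P [oP OP] <-]; exact: le_inner.
Qed.

Let outer_le_inner E O : open O -> E `<=` O -> outer E <= inner O.
Proof. by move=> oO EO; apply: ereal_inf_lbound; exists O. Qed.

Let m0 : m set0 = 0%R.
Proof.
have := m_disjU (@compact0 X) (@compact0 X) (set0I _).
by rewrite setU0 => /eqP; rewrite -subr_eq0 opprD addrA subrr sub0r oppr_eq0 => /eqP.
Qed.

Let outer0 : outer set0 = 0.
Proof.
rewrite outer_open; last exact: open0.
apply/eqP; rewrite eq_le inner_ge0 andbT; apply: ub_ereal_sup => _ [K [cK K0] <-].
by move: K0; rewrite subset0 => ->; rewrite m0.
Qed.

Let outer_ge0 E : 0 <= outer E.
Proof. by apply: le_ereal_inf_tmp => _ [W _ <-]; exact: inner_ge0. Qed.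

Let le_outer : {homo outer : A B / A `<=` B >-> A <= B}.
Proof.
move=> A B AB; apply: le_ereal_inf_tmp => _ [W [oW BW] <-].
by apply: outer_le_inner => //; exact: subset_trans BW.
Qed.

Let m_bigU (L : nat -> set X) n : (forall i, compact (L i)) ->
  (m (\bigcup_(i < n) L i) <= \sum_(i < n) m (L i))%R.
Proof.
move=> cL; rewrite bigcup_mkord; elim: n => [|n IH]; first by rewrite !big_ord0 m0.
rewrite !big_ord_recr /=; apply: le_trans (m_U _ (cL n)) _; last by rewrite lerD2r.
by apply: bigsetU_compact => // i _.
Qed.

(** A compact set in the union must be split into compact pieces of the single [O i]. Compact
    exhaustions of the [O i] do this: in [D n] the index n bounds both the number of sets and the
    level of their exhaustions, so that one increasing sequence covers [K]. *)
Let inner_sigma_subadditive (O : nat -> set X) : (forall i, open (O i)) ->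
  inner (\bigcup_i O i) <= \sum_(i <oo) inner (O i).
Proof.
move=> oO; apply: ub_ereal_sup => _ [K [cK KO] <-].
have /choice[E EP] i := open_exhaustion (oO i).
pose D n := \bigcup_(i < n) (E i n)°.
have ES i n p : (n <= p)%N -> E i n `<=` E i p.
  elim: p => [|p IH]; first by rewrite leqn0 => /eqP ->.
  rewrite leq_eqVlt => /predU1P[->//|]; rewrite ltnS => /IH h.
  apply: (subset_trans h); have [_ /(_ p)/subset_trans ESp _ _] := EP i.
  by apply: ESp; exact: interior_subset.
have [n Kn] : exists n, K `<=` D n.
  apply: compact_sub_increasing_open => //.
  - by move=> n; apply: bigcup_open => i _; exact: open_interior.
  - move=> n p np x [i /= ni Ex]; exists i => /=; first exact: leq_trans np.
    by apply: interiorS Ex; exact: ES.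
  - move=> x /KO [i _ Oix]; have [_ _ _ EL] := EP i.
    have [p /(_ x erefl) px] := EL [set x] (@compact_set1 _ x) (fun y e => eq_ind_r (O i) Oix e).
    exists (maxn i.+1 p) => //; exists i => /=; first exact: leq_maxl.
    by apply: interiorS px; apply: ES; exact: leq_maxr.
apply: (@le_trans _ _ (\sum_(i < n) (m (E i n))%:E)).
  rewrite sumEFin lee_fin.
  have cEn i : compact (E i n) by have [+ _ _ _] := EP i; exact.
  apply: le_trans (m_bigU n cEn); apply: m_le => //.
    by rewrite bigcup_mkord; apply: bigsetU_compact => // i _.
  by move=> x /Kn [i ni /interior_subset Ex]; exists i.
apply: (@le_trans _ _ (\sum_(0 <= i < n) inner (O i))).
  rewrite big_mkord; apply: lee_sum => i _; apply: inner_ub.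
    by have [+ _ _ _] := EP i; exact.
  by have [_ _ + _] := EP i; exact.
by apply: nneseries_lim_ge => i _ _; exact: inner_ge0.
Qed.

Let outer_sigma_subadditive : sigma_subadditive outer.
Proof.
move=> F; have [->|fS] := eqVneq (\sum_(i <oo) outer (F i)) +oo; first exact: leey.
have foF i : outer (F i) \is a fin_num.
  rewrite ge0_fin_numE//; apply: (@le_lt_trans _ _ (\sum_(i <oo) outer (F i))); last first.
    by rewrite ltey.
  apply: (@le_trans _ _ (\sum_(0 <= k < i.+1) outer (F k))).
    by rewrite big_nat_recr//= leeDr//; exact: sume_ge0.
  exact: nneseries_lim_ge.
apply/lee_addgt0Pr => e e0.
have H i : exists O, [/\ open O, F i `<=` O & inner O <= outer (F i) + (e / (2 ^ i.+1)%:R)%:E].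
  have ei0 : (0 < e / (2 ^ i.+1)%:R)%R by rewrite divr_gt0// ltr0n expn_gt0.
  have [_ [W [oW FW] <-] /ltW h] := lb_ereal_inf_adherent ei0 (foF i).
  by exists W.
have [ O OP] := choice H.
apply: (@le_trans _ _ (inner (\bigcup_i O i))).
  apply: outer_le_inner; first by apply: bigcup_open => i _; have [] := OP i.
  by move=> x [i _ Fix]; exists i => //; have [_ + _] := OP i; exact.
apply: (le_trans (inner_sigma_subadditive _)); first by move=> i; have [] := OP i.
apply: le_trans (epsilon_trick xpredT _ (ltW e0)); last by move=> n; exact: outer_ge0.
apply: lee_nneseries => [i _ _|i _]; first exact: inner_ge0.
by have [] := OP i.
Qed.

Let om : {outer_measure set X -> \bar R} :=
  HB.pack outer (isOuterMeasure.Build R X outer outer0 outer_ge0 le_outer outer_sigma_subadditive).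

(* A compact set K inside O `&` V and a compact set inside O `\` K are disjoint, so m
   is additive on them. *)
Let open_caratheodory V : open V -> om.-caratheodory V.
Proof.
move=> oV; apply: le_caratheodory_measurable => Y /=.
apply: le_ereal_inf_tmp => _ [W [oW YW] <-]; move: W oW YW => O oO YO.
have [->|fO] := eqVneq (inner O) +oo; first exact: leey.
have finO : inner O \is a fin_num by rewrite ge0_fin_numE// ltey.
have H K : compact K -> K `<=` O `&` V -> (m K)%:E + outer (Y `&` ~` V) <= inner O.
  move=> cK KOV; have clK := compact_closed X_hausdorff cK.
  apply: (@le_trans _ _ ((m K)%:E + inner (O `\` K))).
    apply: leeD2l; apply: outer_le_inner.
      by rewrite setDE; apply: openI => //; exact: closed_openC.
    by move=> x [Yx nVx]; split; [exact: YO|move=> /KOV[]].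
  rewrite addeC -leeBrDr//; apply: ub_ereal_sup => _ [L [cL LO] <-].
  rewrite leeBrDr// -EFinD addrC -m_disjU//; last first.
    by apply/seteqP; split => x // [Kx /LO[]].
  apply: inner_ub; first exact: compactU.
  by move=> x [/KOV[]//|/LO[]].
have fY : outer (Y `&` ~` V) \is a fin_num.
  rewrite ge0_fin_numE//; apply: (@le_lt_trans _ _ (inner O)); last by rewrite ltey.
  by apply: outer_le_inner => // x [/YO].
apply: (@le_trans _ _ (inner (O `&` V) + outer (Y `&` ~` V))).
  apply: leeD2r; apply: outer_le_inner; first exact: openI.
  by move=> x [/YO].
rewrite -leeBrDr//; apply: ub_ereal_sup => _ [K [cK KO] <-].
by rewrite leeBrDr//; exact: H.
Qed.

Let borel_caratheodory (B : set (borel X)) : measurable B -> om.-caratheodory B.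
Proof.
move: B; apply: smallest_sub => [|V]; last exact: open_caratheodory.
split.
- exact: caratheodory_measurable_set0.
- by move=> A mA; rewrite setTD; exact: caratheodory_measurable_setC.
- by move=> A mA; exact: caratheodory_measurable_bigcup.
Qed.

Let outer_semi_sigma_additive : semi_sigma_additive (outer : set (borel X) -> \bar R).
Proof.
move=> F mF tF mUF.
by apply: (@caratheodory_measure_sigma_additive R X om F) => // *; exact: borel_caratheodory.
Qed.

Let nu : {measure set (borel X) -> \bar R} :=
  HB.pack (outer : set (borel X) -> \bar R) (isMeasure.Build _ (borel X) R
    (outer : set (borel X) -> \bar R) outer0 outer_ge0 outer_semi_sigma_additive).

Let nu_fin : compact_finite nu.
Proof.
move=> K cK /=; have [E [cE _ _ EL]] := open_exhaustion openT.
have [n Kn] := EL K cK (@subsetT _ _).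
apply: (@le_lt_trans _ _ (inner (E n)°)).
  by apply: outer_le_inner => //; exact: open_interior.
apply: (@le_lt_trans _ _ (m (E n))%:E); last exact: ltry.
apply: ub_ereal_sup => _ [L [cL LE] <-]; rewrite lee_fin; apply: m_le => //.
exact: subset_trans (@interior_subset _ _).
Qed.

(** No continuity of [m] along decreasing compact sets is assumed, so on compact sets only an
    inequality is left. *)
Lemma radon_of_content : exists mu : radon R X,
  (forall O, open O -> mu O =
    ereal_sup [set (m K)%:E | K in [set K | compact K /\ K `<=` O]]) /\
  (forall K, compact K -> (m K)%:E <= mu K).
Proof.
exists (to_radon nu_fin); split=> [V oV|K cK]; first exact: outer_open.
by apply: le_ereal_inf_tmp => _ [W [oW KW] <-]; exact: inner_ub.
Qed.

End compact_content.

(** * Limits along an ultrafilter *)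

Lemma ultra_bounded_cvg (F : set_system nat) (u : nat -> R) (a b : R) :
  UltraFilter F -> (forall n, (a <= u n <= b)%R) ->
  exists l : R, u @ F --> l.
Proof.
move=> UF uab; have cab : compact `[a, b]%classic by exact: segment_compact.
have PF : ProperFilter F by exact: ultra_proper.
have [|l [_ ul]] := cab (u @ F) _.
  by apply: (@filterS _ F _ setT) => [n _|]; [rewrite /= in_itv/=; exact: uab|exact: filterT].
exists l => V lV; have [//|FnV] := in_ultra_setVsetC (u @^-1` V) UF.
by have [x [nVx Vx]] := ul (~` V) V FnV lV.
Qed.

(* The limits m K of [mu n K] along F form a content on the compact sets. The measure
   it induces need not agree with m; only the two portmanteau inequalities survive,
   and they imply vague convergence. *)
Lemma radon_ultralimit (F : set_system nat) (mu : nat -> radon R X) :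
  UltraFilter F ->
  (forall K, compact K -> exists M : R, forall n, mu n K <= M%:E) ->
  exists nu : radon R X,
    (forall K (r : R), compact K -> (\forall n \near F, r%:E <= mu n K) -> r%:E <= nu K) /\
    (forall O (r : R), open O -> (\forall n \near F, mu n O <= r%:E) -> nu O <= r%:E).
Proof.
move=> UF bmu.
have mfin n K : compact K -> mu n K \is a fin_num.
  by move=> cK; rewrite ge0_fin_numE//; exact: radon_compact_fin.
have [m mP] : exists m : set X -> R, forall K, compact K -> fine (mu n K) @[n --> F] --> m K.
  suff /choice[m mP] K : exists l : R, compact K -> fine (mu n K) @[n --> F] --> l by exists m.
  have [cK|nK] := pselect (compact K); last by exists 0%R.
  have [M MP] := bmu K cK.
  have [|l lP] := @ultra_bounded_cvg F (fun n => fine (mu n K)) 0 M UF.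
    by move=> n; rewrite fine_ge0//= -lee_fin fineK// mfin.
  by exists l.
have PF : ProperFilter F by exact: ultra_proper.
have mU K L : compact K -> compact L -> (m (K `|` L) <= m K + m L)%R.
  move=> cK cL; have cKL := compactU cK cL.
  have h := @cvgD _ _ _ F _ _ _ _ _ (mP K cK) (mP L cL).
  rewrite -subr_ge0; apply: (cvgr_to_ge (cvgB (h _) (mP _ cKL))).
  apply: nearW => n /=; rewrite subr_ge0 -lee_fin EFinD !fineK ?mfin//.
  by apply: measureU2; exact: compact_borel.
have [||||nu [nuO nuK]] := @radon_of_content m.
- move=> K cK; apply: (cvgr_to_ge (mP K cK)).
  by apply: nearW => n; rewrite fine_ge0.
- move=> K L cK cL KL; rewrite -subr_ge0; apply: (cvgr_to_ge (cvgB (mP L cL) (mP K cK))).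
  apply: nearW => n /=; rewrite subr_ge0 -lee_fin !fineK ?mfin//.
  by apply: le_measure; rewrite ?inE//; exact: compact_borel.
- exact: mU.
- move=> K L cK cL KL0; have cKL := compactU cK cL.
  apply: (cvg_unique _ (mP _ cKL)) => /=; first exact: norm_hausdorff.
  have -> : (fun n => fine (mu n (K `|` L))) = (fun n => fine (mu n K) + fine (mu n L))%R.
    apply/funext => n; rewrite measureU ?fineD ?mfin//; exact: compact_borel.
  exact: cvgD (mP K cK) (mP L cL).
exists nu; split=> [K r cK rK|W r oW rW].
- apply: le_trans (nuK K cK); rewrite lee_fin; apply: (cvgr_to_ge (mP K cK)).
  by apply: filterS rK => n; rewrite -[mu n K]fineK ?mfin.
- rewrite nuO//; apply: ub_ereal_sup => _ [K [cK KW] <-]; rewrite lee_fin.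
  apply: (cvgr_to_le (mP K cK)); apply: filterS rW => n; apply: contraTT => h.
  rewrite -!ltNge in h *; rewrite -lte_fin fineK ?mfin// in h.
  apply: (lt_le_trans h); apply: le_measure; rewrite ?inE//.
    exact: compact_borel.
  exact: open_borel.
Qed.

Lemma le_ereal_real (x y : \bar R) : (forall r : R, r%:E < x -> r%:E <= y) -> x <= y.
Proof.
case: x => [x| |] h; last by rewrite leNye.
- apply/lee_subgt0Pr => e e0; rewrite -EFinB; apply: h.
  by rewrite lte_fin ltrBlDr ltrDl.
- case: y h => [y| |] h; last by have := h 0%R (ltry _).
    by have := h (y + 1)%R (ltry _); rewrite lee_fin gerDl ler10.
  exact: leey.
Qed.

(** Reduces a strict inequality to countably many with a positive gap, the form to which Chebyshev's
    inequality applies. *)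
Lemma lt_bigcup_add (T : Type) (f g : T -> \bar R) : (forall x, 0 <= f x) ->
  [set x | f x < g x] `<=` \bigcup_n [set x | f x + (n.+1%:R^-1)%:E < g x].
Proof.
move=> f0 x /=; case E : (f x) (f0 x) => [p| |]// _; last by rewrite ltNge leey.
move=> pg; have [n hn] : exists n : nat, (p + n.+1%:R^-1)%:E < g x.
  case: (g x) pg => [r| |]//; last by move=> _; exists 0%N; rewrite ltry.
  rewrite lte_fin -subr_gt0 => pr; exists (Num.truncn (r - p)^-1); rewrite lte_fin -ltrBrDl.
  by rewrite invf_plt ?posrE// truncnS_gt.
by exists n => //=; rewrite E -EFinD.
Qed.

Lemma limn_einf_le (u : (\bar R)^nat) a : (forall n, u n <= a) -> limn_einf u <= a.
Proof.
move=> ua; rewrite limn_einf_lim; apply: lime_le; first exact: is_cvg_einfs.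
by apply: nearW => n; apply: le_trans (ua n); apply: ereal_inf_lbound; exists n => //=.
Qed.

Lemma limn_einf_ge (u : (\bar R)^nat) l :
  (forall r : R, r%:E < l -> exists N, forall n, (N <= n)%N -> r%:E <= u n) ->
  l <= limn_einf u.
Proof.
move=> h; apply: le_ereal_real => r /h[N hN].
rewrite limn_einf_lim; apply: lime_ge; first exact: is_cvg_einfs.
exists N => // n /= Nn; apply: le_ereal_inf_tmp => _ [k /= nk <-]; apply: hN.
exact: leq_trans nk.
Qed.

(** * Tonelli's theorem and semicontinuity of potentials *)

(** Allows lower semicontinuity to be tested along sequences, where Fatou's lemma applies. [V n] is
    the intersection of those among the first n base sets that contain [x]. *)
Lemma nbhs_sequence (x : X) : exists V : nat -> set X, (forall n, nbhs x (V n)) /\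
  forall W, nbhs x W -> exists N, forall n, (N <= n)%N -> V n `<=` W.
Proof.
have [b [bo bnbhs]] := countable_base.
pose V := fix V n := if n is m.+1 then V m `&` [set y | b m x -> b m y] else setT.
have Vb i n : (i < n)%N -> b i x -> V n `<=` b i.
  elim: n => // n IH; rewrite ltnS leq_eqVlt => /predU1P[-> bx y [_]|/IH h bx y [+ _]].
    exact.
  exact: h.
exists V; split=> [|W /bnbhs[i bix biW]].
  elim=> [|n IH] /=; first exact: filterT.
  apply: filterI => //; have [bx|nbx] := pselect (b n x).
    by apply: filterS (open_nbhs_nbhs (conj (bo n) bx)) => y by_ _.
  by apply: filterS (@filterT _ (nbhs x) _) => y _ /=.
by exists i.+1 => n ni y Vy; apply: biW; exact: Vb Vy.
Qed.

Definition radon_add (mu nu : radon R X) : radon R X.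
Proof.
apply: (@to_radon (measure_add mu nu)) => K cK.
have -> : (measure_add mu nu : {measure set (borel X) -> \bar R}) K = mu K + nu K.
  exact: measure_addE.
by rewrite lte_add_pinfty//; exact: radon_compact_fin.
Defined.

Definition radon_scale (r : {nonneg R}) (mu : radon R X) : radon R X.
Proof.
apply: (@to_radon (mscale r mu)) => K cK.
by rewrite /mscale/= lte_mul_pinfty//; exact: radon_compact_fin.
Defined.

Definition radon_restr (D : set (borel X)) (mD : measurable D) (mu : radon R X) : radon R X.
Proof.
apply: (@to_radon (mrestr mu mD)) => K cK.
apply: le_lt_trans (radon_compact_fin mu cK); rewrite /= /mrestr.
by apply: le_measure; rewrite ?inE//; try apply: measurableI => //; exact: compact_borel.
Defined.

Lemma integral_radon_add mu nu (f : X -> \bar R) : bmeas f -> (forall x, 0 <= f x) ->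
  \int[radon_add mu nu]_x f x = \int[mu]_x f x + \int[nu]_x f x.
Proof.
move=> mf f0.
have := @ge0_integral_measure_add _ (borel X) R mu nu setT measurableT f (fun x _ => f0 x) mf.
by move=> <-; apply: eq_measure_integral.
Qed.

Lemma integral_radon_scale r mu (f : X -> \bar R) : bmeas f -> (forall x, 0 <= f x) ->
  \int[radon_scale r mu]_x f x = r%:num%:E * \int[mu]_x f x.
Proof. by move=> mf f0; rewrite -ge0_integral_mscale. Qed.

Lemma integral_radon_restr D (mD : measurable D) mu (f : X -> \bar R) :
  bmeas f -> (forall x, 0 <= f x) ->
  \int[radon_restr mD mu]_x f x = \int[mu]_(x in D) f x.
Proof.
move=> mf f0; have mDC : measurable (~` D) by exact: measurableC.
have mfD E : @measurable_fun _ _ (borel X) (\bar R) E f by exact: measurable_funTS.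
have split_ (m : {measure set (borel X) -> \bar R}) :
    \int[m]_x f x = \int[m]_(x in D) f x + \int[m]_(x in ~` D) f x.
  by rewrite -ge0_integral_setU ?setUv//; apply/disj_setPS; rewrite setICr.
rewrite split_ [X in _ + X]null_set_integral ?adde0//; last first.
  by rewrite /= /mrestr setICl measure0.
apply: eq_measure_integral => B mB BD.
by rewrite /= /mrestr setIidl.
Qed.

Lemma radon_sigma_finite (mu : radon R X) : @sigma_finite _ (borel X) R setT mu.
Proof.
have [E [cE _ _ EL]] := open_exhaustion openT.
exists E => [|n]; last by split; [exact: compact_borel|exact: radon_compact_fin].
apply/seteqP; split => x // _.
have [n /(_ x erefl) /interior_subset Ex] := EL [set x] (@compact_set1 _ x) (fun _ _ => I).
by exists n.
Qed.

(** The countable base writes an open set of the product as a countable union of open rectangles;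
    this links the topology of the product to the product sigma-algebra. *)
Lemma open_product_borel (W : set (X * X)) : open W ->
  measurable (W : set (borel X * borel X)).
Proof.
move=> oW; have [b [bo bnbhs]] := countable_base.
have -> : W = \bigcup_i \bigcup_(j in [set j | b i `*` b j `<=` W]) (b i `*` b j).
  apply/seteqP; split => [[x y] Wxy|[x y] [i _ [j ijW bij]]]; last exact: ijW.
  have [[V1 V2] [/= xV1 yV2] V12] : nbhs (x, y) W by exact: open_nbhs_nbhs.
  have [i bix bi] := bnbhs _ _ xV1; have [j bjx bj] := bnbhs _ _ yV2.
  exists i => //; exists j => // -[u v] [/= /bi ? /bj ?]; exact: V12.
apply: bigcup_measurable => i _; apply: bigcup_measurable => j _.
by apply: measurableX; exact: open_borel.
Qed.

Lemma lsc_product_borel (g : X * X -> \bar R) : lower_semicontinuous g ->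
  @measurable_fun _ _ (borel X * borel X)%type (\bar R) setT g.
Proof.
move=> gl; apply: (measurability _ (ErealGenOInfty.measurableE R)).
move=> /= _ [_ [a ->]] <-; apply: measurableI => //; apply: open_product_borel.
by rewrite preimage_itvoy; move/lower_semicontinuousP : gl; exact.
Qed.

Lemma radon_tonelli (g : X * X -> \bar R) (mu nu : radon R X) :
  lower_semicontinuous g -> (forall z, 0 <= g z) ->
  \int[mu]_x \int[nu]_y g (x, y) = \int[nu]_y \int[mu]_x g (x, y).
Proof.
move=> gl g0.
(* Tonelli's theorem is stated for bundled sigma-finite measures; [sf] repackages a Radon measure
   without changing its values. *)
have sf (m : radon R X) : exists m' : {sigma_finite_measure set (borel X) -> \bar R},
    m = m' :> (set (borel X) -> \bar R).
  pose H1 := isSFinite.Build _ _ _ _ (sfinite_measure_sigma_finite (radon_sigma_finite m)).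
  pose H2 := isSigmaFinite.Build _ _ _ _ (radon_sigma_finite m).
  by exists (HB.pack_for (SigmaFiniteMeasure.type (borel X) R) (Measure.sort m) H1 H2).
have [m1 e1] := sf mu; have [m2 e2] := sf nu.
have i1 f : \int[mu]_x f x = \int[m1]_x f x by apply: eq_measure_integral => A _ _; rewrite e1.
have i2 f : \int[nu]_x f x = \int[m2]_x f x by apply: eq_measure_integral => A _ _; rewrite e2.
rewrite i1 i2; under eq_integral do rewrite i2; under [RHS]eq_integral do rewrite i1.
apply: (@fubini_tonelli _ _ _ _ _ m1 m2 g) => //; exact: lsc_product_borel.
Qed.

Lemma lsc_section (g : X * X -> \bar R) x : lower_semicontinuous g ->
  lower_semicontinuous (fun y => g (x, y)).
Proof.
move=> gl y a /gl[V [[V1 V2] [/= xV1 yV2] V12] Vg]; exists V2 => // z V2z.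
by apply: Vg; apply: V12; split => //=; exact: nbhs_singleton.
Qed.

(** Were the integral at most a at points arbitrarily close to [x], Fatou's lemma along a sequence
    of such points would give the value at most a at [x] itself. *)
Lemma lsc_integral (g : X * X -> \bar R) (mu : radon R X) :
  lower_semicontinuous g -> (forall z, 0 <= g z) ->
  lower_semicontinuous (fun x => \int[mu]_y g (x, y)).
Proof.
move=> gl g0 x a ax; apply: contrapT => H.
have [V [xV VW]] := nbhs_sequence x.
have /choice[u uP] n : exists y, V n y /\ \int[mu]_z g (y, z) <= a%:E.
  apply: contrapT => /forallNP h; apply: H; exists (V n) => // y Vy.
  by rewrite ltNge; apply/negP => ?; apply: (h y).
move: ax; apply/negP; rewrite -leNgt.
apply: (@le_trans _ _ (limn_einf (fun n => \int[mu]_z g (u n, z)))); last first.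
  by apply: limn_einf_le => n; have [] := uP n.
apply: le_trans (fatou _ _ _ _) => //.
- apply: ge0_le_integral => //.
  + by apply: lsc_borel; exact: lsc_section.
  + rewrite /limn_einf; apply: measurableT_comp => //.
    apply: (@measurable_fun_limn_esup _ (borel X) R setT (fun n y => - g (u n, y))) => n.
    by apply: measurableT_comp => //; apply: lsc_borel; exact: lsc_section.
  + move=> z _; apply: limn_einf_ge => r /gl[W [[V1 V2] [/= xV1 zV2] V12] Wg].
    have [N hN] := VW _ xV1; exists N => n Nn; apply/ltW/Wg/V12; split => /=.
      by apply: hN Nn _ _; have [] := uP n.
    exact: nbhs_singleton.
- by move=> n; apply: lsc_borel; exact: lsc_section.
Qed.

(** * Layer-cake sums and vague convergence *)

Lemma cvg_sum_ord (F : set_system nat) (N : nat) (f : nat -> nat -> R) (l : nat -> R) :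
  Filter F -> (forall k, f k @ F --> l k) ->
  (\sum_(k < N) f k n)%R @[n --> F] --> (\sum_(k < N) l k)%R.
Proof.
move=> FF fl; elim: N => [|N IH].
  by under eq_fun do rewrite big_ord0; rewrite big_ord0; exact: cvg_cst.
under eq_fun do rewrite big_ord_recr/=; rewrite big_ord_recr/=.
exact: (cvgD IH (fl N)).
Qed.

(* Riemann sums of the layer-cake formula: strict inequalities produce open level
   sets and large ones produce compact level sets, matching the two halves of
   [set_cvg]. *)
Section layers.
Variables (e t : R).
Hypotheses (e_gt0 : (0 < e)%R) (t_ge0 : (0 <= t)%R).

Let step (b : bool) : (e * b%:R = if b then e else 0)%R.
Proof. by case: b; rewrite ?mulr1 ?mulr0. Qed.

Let F k : R := (e * (k%:R * e < t)%R%:R)%R.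
Let G k : R := (e * (k.+1%:R * e <= t)%R%:R)%R.

(** The second alternative occurs when [t] reaches the truncation height N e; where N e bounds the
    function, both alternatives give the same upper bound. *)
Lemma layers_ge N : (t <= \sum_(k < N) F k \/ N%:R * e <= \sum_(k < N) F k)%R.
Proof.
elim: N => [|N IH]; first by right; rewrite big_ord0 mul0r.
have -> : (\sum_(k < N.+1) F k = \sum_(k < N) F k + F N)%R by rewrite big_ord_recr.
rewrite {2 4}/F step -natr1 mulrDl mul1r.
move: IH; generalize (\sum_(k < N) F k)%R => S IH; move: (e_gt0) => e0.
by case: ltP => h; case: IH => IH; [left|right|left|left]; lra.
Qed.

(** The overshoot [e] is charged only where [t] is nonzero, so after integration it costs [e] times
    the measure of a compact set. *)
Lemma layers_le N : (\sum_(k < N) F k <= N%:R * e /\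
  \sum_(k < N) F k <= t + e * (t != 0)%:R)%R.
Proof.
elim: N => [|N IH].
  by rewrite big_ord0 mul0r; split => //; rewrite addr_ge0// mulr_ge0// ltW.
have -> : (\sum_(k < N.+1) F k = \sum_(k < N) F k + F N)%R by rewrite big_ord_recr.
rewrite {2 4}/F (step (_ < _)%R) -natr1 mulrDl mul1r.
move: IH; generalize (\sum_(k < N) F k)%R => S [IH1 IH2]; move: (e_gt0) => e0.
case: ltP => h; last by split; lra.
have t0 : (t != 0)%R.
  by rewrite gt_eqF//; apply: le_lt_trans h; rewrite mulr_ge0// ltW.
by rewrite t0 mulr1 in IH2 *; split; lra.
Qed.

Lemma closed_layers_le N : (\sum_(k < N) G k <= N%:R * e /\ \sum_(k < N) G k <= t)%R.
Proof.
elim: N => [|N IH]; first by rewrite big_ord0 mul0r.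
have -> : (\sum_(k < N.+1) G k = \sum_(k < N) G k + G N)%R by rewrite big_ord_recr.
rewrite {2 4}/G (step (_ <= _)%R) -natr1 mulrDl mul1r.
move: IH; generalize (\sum_(k < N) G k)%R => S [IH1 IH2].
by case: (leP (N%:R * e + e)%R t) => h; split; lra.
Qed.

Lemma closed_layers_ge N : (t <= \sum_(k < N) G k + e * (t != 0)%:R \/
  N%:R * e <= \sum_(k < N) G k)%R.
Proof.
have [t0|t0] := eqVneq t 0%R.
  left; rewrite mulr0 addr0 {1}t0; apply: sumr_ge0 => i _; rewrite mulr_ge0// ltW//.
rewrite mulr1; elim: N => [|N IH]; first by right; rewrite big_ord0 mul0r.
have -> : (\sum_(k < N.+1) G k = \sum_(k < N) G k + G N)%R by rewrite big_ord_recr.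
rewrite {2 4}/G (step (_ <= _)%R) -natr1 mulrDl mul1r.
move: IH; generalize (\sum_(k < N) G k)%R => S IH; move: (e_gt0) => e0.
by case: (leP (N%:R * e + e)%R t) => h; case: IH => IH; [left|right|left|left]; lra.
Qed.

End layers.

Local Notation mint mu f := ((radon_measure mu).-integrable (@setT (borel X)) (EFin \o f)).
Local Notation I mu f := (\int[mu]_x f x)%R.

Section compactly_supported.
Variables (mu : radon R X) (K : set X).
Hypothesis cK : compact K.

Lemma mint_indic (P : set X) : P `<=` K -> measurable (P : set (borel X)) ->
  mint mu (\1_P : X -> R) /\ I mu (\1_P : X -> R) = fine (mu P).
Proof.
move=> PK mP; split; last by rewrite /Rintegral integral_indic// setIT.
apply/integrableP; split; first by apply/measurable_EFinP; exact: measurable_indic.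
rewrite (eq_integral (fun x : borel X => (\1_P x)%:E)); last first.
  by move=> t _; rewrite gee0_abs// lee_fin.
rewrite integral_indic// setIT; apply: le_lt_trans (radon_compact_fin mu cK).
by apply: le_measure; rewrite ?inE//; exact: compact_borel.
Qed.

Lemma mint_layers (P : nat -> set X) (e : R) N : (forall k, P k `<=` K) ->
  (forall k, measurable (P k : set (borel X))) ->
  mint mu (fun x => \sum_(k < N) e * \1_(P k) x)%R /\
  I mu (fun x => \sum_(k < N) e * \1_(P k) x)%R = (\sum_(k < N) e * fine (mu (P k)))%R.
Proof.
move=> PK mP; elim: N => [|N [IH1 IH2]].
  under eq_Rintegral do rewrite big_ord0.
  rewrite big_ord0 (_ : (fun _ => _) = cst 0%R); last by apply/funext => x; rewrite big_ord0.
  by split; [exact: integrable0|rewrite /Rintegral integral0].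
have [h1 h2] := mint_indic (PK N) (mP N).
have h3 : mint mu (fun x => e * \1_(P N) x)%R.
  by apply: (@integrableZl _ (borel X) R mu setT measurableT e (EFin \o \1_(P N))).
rewrite (_ : (fun _ => _) = (fun x => \sum_(k < N) e * \1_(P k) x + e * \1_(P N) x)%R); last first.
  by apply/funext => x; rewrite big_ord_recr.
rewrite big_ord_recr/=; split.
  exact: (@integrableD _ (borel X) R mu setT measurableT (EFin \o _) (EFin \o _)).
by rewrite RintegralD// RintegralZl// IH2 h2.
Qed.

Lemma mint_bounded (f : X -> R) (M : R) : bmeas (EFin \o f) ->
  (forall x, `|f x| <= M * \1_K x)%R -> mint mu f.
Proof.
move=> mf fM; have [h1 h2] := mint_indic (@subset_refl _ K) (compact_borel cK).
have h3 : mint mu (fun x => M * \1_K x)%R.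
  by apply: (@integrableZl _ (borel X) R mu setT measurableT M (EFin \o \1_K)).
apply: (@le_integrable _ (borel X) R mu setT measurableT _ (EFin \o (fun x => M * \1_K x)%R)) => //.
move=> x _ /=; rewrite lee_fin; apply: (le_trans (fM x)); exact: ler_norm.
Qed.

End compactly_supported.

(** The portmanteau inequalities, in the form in which [radon_ultralimit] delivers them. *)
Definition set_cvg (F : set_system nat) (mu : nat -> radon R X) (nu : radon R X) :=
  (forall K (r : R), compact K -> (\forall n \near F, r%:E <= mu n K) -> r%:E <= nu K) /\
  (forall O (r : R), open O -> (\forall n \near F, mu n O <= r%:E) -> nu O <= r%:E).

Definition compact_bounded_seq (mu : nat -> radon R X) :=
  forall K, compact K -> exists M : R, forall n, mu n K <= M%:E.

Lemma cc_fun_bounded (f : X -> R) : cc_fun f -> exists2 K, compact K &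
  exists2 M, (0 < M)%R & forall x, (`|f x| <= M * \1_K x)%R.
Proof.
move=> [cf cK]; set K := closure _ in cK; exists K => //.
have : bounded_set (f @` K).
  by apply: compact_bounded; apply: continuous_compact => //; exact: continuous_subspaceT.
move=> [M [Mr HM]]; exists (`|M| + 1)%R; first by rewrite ltr_wpDl.
move=> x; have [Kx|nKx] := pselect (K x).
  rewrite indicE mem_set// mulr1; apply: (HM (`|M| + 1)%R); last by exists x.
  by apply: (le_lt_trans (ler_norm _)); rewrite ltrDl.
rewrite indicE memNset// mulr0 (_ : f x = 0%R) ?normr0//.
by apply: contrapT => /eqP fx; apply: nKx; exact: subset_closure.
Qed.

Lemma mint_cc mu f : cc_fun f -> mint mu f.
Proof.
move=> ccf; have [K cK [M M0 fM]] := cc_fun_bounded ccf.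
by apply: (mint_bounded mu cK _ fM); apply: continuous_borel; case: ccf.
Qed.

(** Up to [e] times the measure of [K], the integral is the sum over the open layers [A k] and also
    the sum over the compact layers [B k]. The measures of all layers converge along [F]; their
    limits bound those of [nu] from above on the [A k] and from below on the [B k], which squeezes
    the integral for [nu]. *)
Lemma set_cvg_ge0_cc (F : set_system nat) mu nu (f : X -> R) : UltraFilter F ->
  compact_bounded_seq mu -> set_cvg F mu nu -> cc_fun f -> (forall x, (0 <= f x)%R) ->
  (fun n => I (mu n) f) @ F --> I nu f.
Proof.
move=> UF bmu [nuK nuO] ccf f0; have PF : ProperFilter F by exact: ultra_proper.
have [K cK [M M0 fM]] := cc_fun_bounded ccf.
have {}fM x : (f x <= M * \1_K x)%R by apply: le_trans (fM x); exact: ler_norm.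
have cf : continuous f by case: ccf.
have mK : measurable (K : set (borel X)) by exact: compact_borel.
have [C HC] := bmu K cK.
have fin_ (m : radon R X) P : P `<=` K -> measurable (P : set (borel X)) -> m P \is a fin_num.
  move=> PK mP; rewrite ge0_fin_numE//; apply: le_lt_trans (radon_compact_fin m cK).
  by apply: le_measure; rewrite ?inE.
have {}HC n : (fine (mu n K) <= C)%R by rewrite -lee_fin fineK// fin_.
have C0 : (0 <= C)%R by apply: le_trans (HC 0%N); rewrite fine_ge0.
have HCP n P : P `<=` K -> measurable (P : set (borel X)) -> (0 <= fine (mu n P) <= C)%R.
  move=> PK mP; rewrite fine_ge0//=; apply: le_trans (HC n).
  by apply: fine_le; rewrite ?fin_//; apply: le_measure; rewrite ?inE.
have [iK IK] : (forall m : radon R X, mint m (\1_K : X -> R)) /\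
    forall m : radon R X, I m (\1_K : X -> R) = fine (m K).
  by split=> m; have [] := mint_indic m cK (@subset_refl _ K) mK.
have ieK e (m : radon R X) : mint m (fun x => e * \1_K x)%R.
  by apply: (@integrableZl _ (borel X) R m setT measurableT e (EFin \o \1_K)).
have mf (m : radon R X) : mint m f by exact: mint_cc.
have IM n : (0 <= I (mu n) f <= M * C)%R.
  rewrite Rintegral_ge0//=; apply: (@le_trans _ _ (M * fine (mu n K))%R); last by rewrite ler_pM2l.
  by rewrite -IK -RintegralZl//; apply: le_Rintegral.
have [l ll] : exists l : R, (fun n => I (mu n) f) @ F --> l.
  by apply: (@ultra_bounded_cvg F _ 0%R (M * C)%R) => n; exact: IM.
suff -> : I nu f = l by [].
pose D := (C + fine (nu K) + 1)%R.
have D0 : (0 < D)%R by rewrite ltr_wpDl// addr_ge0// fine_ge0.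
have fK x : f x != 0%R -> K x.
  move=> fx; apply: contrapT => nKx; move/eqP: fx; apply; apply/eqP.
  by rewrite eq_le f0 andbT; apply: le_trans (fM x) _; rewrite indicE memNset// mulr0.
suff H e : (0 < e)%R -> (I nu f <= l + e * D)%R /\ (l <= I nu f + e * D)%R.
  apply/eqP; rewrite eq_le; apply/andP; split; apply/ler_addgt0Pr => e e0.
    by have [] := H (e / D)%R (divr_gt0 e0 D0); rewrite divfK ?gt_eqF.
  by have [_] := H (e / D)%R (divr_gt0 e0 D0); rewrite divfK ?gt_eqF.
move=> e0.
have [N HN] : exists N, (M <= N%:R * e)%R.
  exists (Num.truncn (M / e)).+1; rewrite -ler_pdivrMr//.
  by apply: ltW; exact: truncnS_gt.
have fN x : (f x <= N%:R * e)%R.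
  apply: (le_trans (fM x)); apply: le_trans HN.
  by rewrite ler_piMr// ?ltW// indicE; case: (_ \in _).
pose A k := [set x | (k%:R * e < f x)%R]; pose B k := [set x | (k.+1%:R * e <= f x)%R].
have ke k : (0 <= k%:R * e)%R by rewrite mulr_ge0// ltW.
have AK k : A k `<=` K by move=> x /= h; apply: fK; rewrite gt_eqF//; apply: le_lt_trans h.
have BK k : B k `<=` K.
  by move=> x /= h; apply: fK; rewrite gt_eqF//; apply: lt_le_trans h; rewrite mulr_gt0.
have oA k : open (A k).
  apply: (@open_comp _ _ f [set r | (k%:R * e < r)%R]); last exact: open_gt.
  by move=> x _; exact: cf.
have clB k : closed (B k).
  apply: (@closed_comp _ _ f [set r | (k.+1%:R * e <= r)%R]); last exact: closed_ge.
  by move=> x _; exact: cf.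
have cB k : compact (B k) by exact: subclosed_compact (clB k) cK (BK k).
have mA k : measurable (A k : set (borel X)) by exact: open_borel.
have mB k : measurable (B k : set (borel X)) by exact: compact_borel.
have lev (P : nat -> set X) (k : nat) x b : (P k x <-> b = true) -> \1_(P k) x = b%:R :> R.
  move=> Pb; rewrite indicE; congr ((nat_of_bool _)%:R); apply/idP/idP.
    by move/set_mem/Pb ->.
  by move=> hb; apply: mem_set; apply/Pb.
have EA x : (\sum_(k < N) e * \1_(A k) x = \sum_(k < N) e * (k%:R * e < f x)%R%:R)%R.
  by apply: eq_bigr => k _; rewrite (lev A k x (k%:R * e < f x)%R).
have EB x : (\sum_(k < N) e * \1_(B k) x = \sum_(k < N) e * (k.+1%:R * e <= f x)%R%:R)%R.
  by apply: eq_bigr => k _; rewrite (lev B k x (k.+1%:R * e <= f x)%R).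
have f0K x : (e * (f x != 0%R)%:R <= e * \1_K x :> R)%R.
  apply: ler_wpM2l; first exact: ltW.
  by rewrite indicE; case: eqVneq => [_|/fK Kx]; [case: (_ \in _)|rewrite mem_set].
have [mSA ISA] : (forall m : radon R X, mint m (fun x => \sum_(k < N) e * \1_(A k) x)%R) /\
    forall m : radon R X, I m (fun x => \sum_(k < N) e * \1_(A k) x)%R =
      (\sum_(k < N) e * fine (m (A k)))%R.
  by split=> m; have [] := mint_layers m cK e N AK mA.
have [mSB ISB] : (forall m : radon R X, mint m (fun x => \sum_(k < N) e * \1_(B k) x)%R) /\
    forall m : radon R X, I m (fun x => \sum_(k < N) e * \1_(B k) x)%R =
      (\sum_(k < N) e * fine (m (B k)))%R.
  by split=> m; have [] := mint_layers m cK e N BK mB.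
have mDD (m : radon R X) g h : mint m g -> mint m h -> mint m (fun x => g x + h x)%R.
  by move=> mg mh; exact: (@integrableD _ (borel X) R m setT measurableT (EFin \o _) (EFin \o _)).
have A1 (m : radon R X) : (I m f <= \sum_(k < N) e * fine (m (A k)))%R.
  rewrite -ISA; apply: le_Rintegral => // x _; rewrite EA.
  by have [//|h] := @layers_ge e (f x) e0 N; exact: le_trans (fN x) h.
have A2 (m : radon R X) : (\sum_(k < N) e * fine (m (A k)) <= I m f + e * fine (m K))%R.
  rewrite -ISA -IK -RintegralZl// -RintegralD//; apply: le_Rintegral => //; first exact: mDD.
  move=> x _; rewrite EA; have [_ h] := layers_le e0 (f0 x) N; apply: (le_trans h).
  by rewrite lerD2l.
have B1 (m : radon R X) : (\sum_(k < N) e * fine (m (B k)) <= I m f)%R.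
  rewrite -ISB; apply: le_Rintegral => // x _; rewrite EB.
  by have [_ h] := closed_layers_le e (f0 x) N.
have B2 (m : radon R X) : (I m f <= \sum_(k < N) e * fine (m (B k)) + e * fine (m K))%R.
  rewrite -ISB -IK -RintegralZl// -RintegralD//; apply: le_Rintegral => //; first exact: mDD.
  move=> x _; rewrite EB; have [h|h] := @closed_layers_ge e (f x) e0 N.
    by apply: (le_trans h); rewrite lerD2l.
  apply: le_trans (fN x) (le_trans h _); rewrite lerDl mulr_ge0// ltW//.
have /choice[a aP] k : exists l : R, (fun n => fine (mu n (A k))) @ F --> l.
  by apply: (@ultra_bounded_cvg F _ 0%R C) => n; exact: HCP.
have /choice[b bP] k : exists l : R, (fun n => fine (mu n (B k))) @ F --> l.
  by apply: (@ultra_bounded_cvg F _ 0%R C) => n; exact: HCP.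
have nuA k : (fine (nu (A k)) <= a k)%R.
  apply/ler_addgt0Pr => d d0; rewrite -lee_fin fineK ?fin_//.
  apply: nuO => //; have h : (a k < a k + d)%R by rewrite ltrDl.
  have : \forall n \near F, (fine (mu n (A k)) <= a k + d)%R by exact: cvgr_le _ (aP k) _ h.
  by apply: filterS => n; rewrite -lee_fin fineK ?fin_.
have nuB k : (b k <= fine (nu (B k)))%R.
  apply/ler_addgt0Pr => d d0; rewrite -lerBlDr -lee_fin fineK ?fin_//.
  apply: nuK => //; have h : (b k - d < b k)%R by rewrite ltrBlDr ltrDl.
  have : \forall n \near F, (b k - d <= fine (mu n (B k)))%R by exact: cvgr_ge _ (bP k) _ h.
  by apply: filterS => n; rewrite -lee_fin fineK ?fin_.
have cvS (P : nat -> set X) c : (forall k, (fun n => fine (mu n (P k))) @ F --> (c k : R)) ->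
    (fun n => \sum_(k < N) e * fine (mu n (P k)))%R @ F --> (\sum_(k < N) e * c k)%R.
  move=> h.
  apply: (@cvg_sum_ord F N (fun k n => e * fine (mu n (P k)))%R (fun k => e * c k)%R) => k.
  by apply: cvgM; [exact: cvg_cst|exact: h].
have nuK0 : (0 <= fine (nu K))%R by rewrite fine_ge0.
have eC : (e * C <= e * D)%R by rewrite ler_pM2l// /D; lra.
split.
- apply: (le_trans (A1 nu)); apply: (@le_trans _ _ (\sum_(k < N) e * a k)%R).
    by apply: ler_sum => k _; rewrite ler_pM2l.
  rewrite -lerBlDl; apply: (cvgr_to_le (cvgB (cvS A a aP) ll)); apply: nearW => n /=.
  rewrite lerBlDl; apply: (le_trans (A2 _)); rewrite lerD2l.
  by apply: le_trans eC; rewrite ler_pM2l.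
- have h : (l - \sum_(k < N) e * b k <= e * D)%R.
    apply: (cvgr_to_le (cvgB ll (cvS B b bP))); apply: nearW => n /=.
    rewrite lerBlDl; apply: (le_trans (B2 _)); rewrite lerD2l.
    by apply: le_trans eC; rewrite ler_pM2l.
  move: h; rewrite lerBlDr addrC => /le_trans; apply; rewrite lerD2r; apply: le_trans (B1 nu).
  by apply: ler_sum => k _; rewrite ler_pM2l.
Qed.

Lemma set_cvg_cc (F : set_system nat) mu nu (f : X -> R) : UltraFilter F ->
  compact_bounded_seq mu -> set_cvg F mu nu -> cc_fun f ->
  (fun n => I (mu n) f) @ F --> I nu f.
Proof.
move=> UF bmu munu ccf; have PF : ProperFilter F by exact: ultra_proper.
pose f1 x := Num.max (f x) 0%R; pose f2 x := Num.max (- f x)%R 0%R.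
have cc1 : cc_fun f1 by apply: cc_fun_max => //; exact: cc_fun0.
have cc2 : cc_fun f2.
  apply: cc_fun_max; last exact: cc_fun0.
  rewrite (_ : (fun _ => _) = (fun x => -1 * f x)%R); first exact: cc_funM.
  by apply/funext => x; rewrite mulN1r.
have E (m : radon R X) : I m f = (I m f1 - I m f2)%R.
  rewrite -RintegralB//; [|exact: mint_cc..].
  apply: eq_Rintegral => x _; rewrite /f1 /f2.
  by case: (leP (f x) 0%R) => h; case: (leP (- f x)%R 0%R) => h'; lra.
rewrite E; under eq_fun do rewrite E.
by apply: cvgB; apply: set_cvg_ge0_cc => // x; rewrite /f1 /f2 le_max lexx orbT.
Qed.

(** The bridge to consistency, which speaks of the topology of [radon R X]. That topology is initial
    for [test_eval] into a product, so test functions can be treated one at a time. *)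
Lemma set_cvg_vague (F : set_system nat) (mu : nat -> radon R X) nu : UltraFilter F ->
  compact_bounded_seq mu -> set_cvg F mu nu -> mu @ F --> nu.
Proof.
move=> UF bmu munu; have PF : ProperFilter F by exact: ultra_proper.
have cv : (fun n => test_eval (mu n)) @ F --> test_eval nu.
  apply/cvg_sup => phi W; rewrite nbhsE => -[V [[A oA <-] Anu] VW].
  have := set_cvg_cc UF bmu munu (proj2_sig phi); move/(_ A (open_nbhs_nbhs (conj oA Anu))).
  by rewrite /= /nbhs/=; apply: filterS => n An; exact: VW.
move=> W; rewrite nbhsE => -[V [[A oA <-] Anu] VW].
suff : F (mu @^-1` W) by [].
have : F ((fun n => test_eval (mu n)) @^-1` A).
  by have := cv A (open_nbhs_nbhs (conj oA Anu)).
by apply: filterS => n An; exact: VW.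
Qed.

(** Monotone convergence, with one sequence serving all measures at once; the compactness arguments
    over the energy ball rely on this uniformity. *)
Lemma lsc_approx_integral (g : X -> \bar R) : class_G g ->
  exists phi : nat -> X -> R, [/\ forall n, cc_fun (phi n),
    forall n x, (0 <= phi n x)%R, forall n x, (phi n x)%:E <= g x,
    forall m n x, (m <= n)%N -> (phi m x <= phi n x)%R &
    forall (mu : radon R X) y, (forall n, \int[mu]_x (phi n x)%:E <= y) ->
      \int[mu]_x g x <= y].
Proof.
move=> gG; have [phi [cphi phi0 phig phile phigt]] := lsc_approx gG.
exists phi; split => // mu y muy.
have mphi n : bmeas (EFin \o phi n) by apply: continuous_borel; have [] := cphi n.
have Eg x : g x = limn (fun n => (phi n x)%:E).
  apply/esym/cvg_lim => //.
  rewrite [X in _ --> X](_ : g x = ereal_sup (range (fun n => (phi n x)%:E))).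
    by apply: ereal_nondecreasing_cvgn => m n mn; rewrite lee_fin; exact: phile.
  apply/eqP; rewrite eq_le; apply/andP; split; last first.
    by apply: ub_ereal_sup => _ [n _ <-].
  apply: le_ereal_real => a /phigt[n an]; apply: le_ereal_sup_tmp.
  by exists (phi n x)%:E; [exists n|rewrite lee_fin ltW].
under eq_integral do rewrite Eg.
rewrite monotone_convergence//; last 2 first.
- by move=> n x _; rewrite lee_fin.
- by move=> x _ m n mn; rewrite lee_fin; exact: phile.
apply: lime_le; last exact: nearW.
apply: ereal_nondecreasing_is_cvgn => m n mn; apply: ge0_le_integral => //.
- by move=> x _; rewrite lee_fin.
- exact: mphi.
- exact: mphi.
- by move=> x _; rewrite lee_fin; exact: phile.
Qed.

(** The integral of [g] is a supremum of vaguely continuous functionals. *)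
Lemma set_cvg_lsc (F : set_system nat) mu nu (g : X -> \bar R) (r : R) : UltraFilter F ->
  compact_bounded_seq mu -> set_cvg F mu nu -> class_G g ->
  (\forall n \near F, \int[mu n]_x g x <= r%:E) -> \int[nu]_x g x <= r%:E.
Proof.
move=> UF bmu munu gG mur; have PF : ProperFilter F by exact: ultra_proper.
have [phi [cphi phi0 phig phile phigt]] := lsc_approx_integral gG.
have mphi n : bmeas (EFin \o phi n) by apply: continuous_borel; have [] := cphi n.
apply: phigt => k.
have fink (m : radon R X) : \int[m]_x (phi k x)%:E \is a fin_num.
  exact: integrable_fin_num (mint_cc m (cphi k)).
rewrite -[leLHS]fineK// lee_fin.
apply: (cvgr_to_le (set_cvg_cc UF bmu munu (cphi k))); apply: filterS mur => n h.
rewrite -lee_fin fineK//; apply: le_trans h; apply: ge0_le_integral => //.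
- by move=> x _; rewrite lee_fin.
- exact: mphi.
- by apply: lsc_borel; case: gG.
Qed.

(** * Energy *)

Section kernel.
Variable G : X * X -> \bar R.
Hypotheses (G_kernel : kernel_on G) (G_perfect : perfect G).

Local Notation pot := (potential G).
Local Notation en := (mutual_energy G).
(** [fine] sends [+oo] to 0, so this represents the mutual energy only where that is finite;
    [energyE] ensures it for measures of finite energy. *)
Definition ip mu nu : R := fine (mutual_energy G mu nu).

Let G_ge0 z : 0 <= G z. Proof. by case: G_kernel. Qed.
Let G_lsc : lower_semicontinuous G. Proof. by case: G_kernel. Qed.
Let G_sym x y : G (x, y) = G (y, x). Proof. by case: G_kernel. Qed.

Lemma potential_ge0 mu x : 0 <= pot mu x.
Proof. exact: integral_ge0. Qed.

Lemma potential_lsc mu : lower_semicontinuous (pot mu).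
Proof. exact: lsc_integral. Qed.

Lemma potential_class_G mu : class_G (pot mu).
Proof. by split; [exact: potential_ge0|exact: potential_lsc]. Qed.

Lemma potential_borel mu : bmeas (pot mu).
Proof. by apply: lsc_borel; exact: potential_lsc. Qed.

Let kernel_borel x : bmeas (fun y => G (x, y)).
Proof. by apply: lsc_borel; exact: lsc_section. Qed.

Hint Resolve potential_ge0 potential_borel : core.

Lemma energy_ge0 mu nu : 0 <= en mu nu.
Proof. by apply: integral_ge0 => x _. Qed.

Lemma energyC mu nu : en mu nu = en nu mu.
Proof.
rewrite /mutual_energy /potential radon_tonelli//.
by apply: eq_integral => y _; apply: eq_integral => x _; rewrite G_sym.
Qed.

Lemma energyDr mu nu1 nu2 : en mu (radon_add nu1 nu2) = en mu nu1 + en mu nu2.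
Proof. exact: integral_radon_add. Qed.

Lemma energyZr mu r nu : en mu (radon_scale r nu) = r%:num%:E * en mu nu.
Proof. exact: integral_radon_scale. Qed.

Lemma energyDl mu nu1 nu2 : en (radon_add nu1 nu2) mu = en nu1 mu + en nu2 mu.
Proof. by rewrite energyC energyDr !(energyC mu). Qed.

Lemma energyZl mu r nu : en (radon_scale r nu) mu = r%:num%:E * en nu mu.
Proof. by rewrite energyC energyZr energyC. Qed.

Lemma energy_restr mu D (mD : measurable D) nu :
  en mu (radon_restr mD nu) = \int[nu]_(x in D) pot mu x.
Proof. exact: integral_radon_restr. Qed.

Lemma energy_restr_le mu D (mD : measurable D) nu : en mu (radon_restr mD nu) <= en mu nu.
Proof.
by rewrite energy_restr; apply: ge0_subset_integral => //; exact: potential_borel.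
Qed.

Definition fe mu := en mu mu < +oo.

Lemma feP mu : finite_energy G mu <-> fe mu.
Proof.
rewrite /finite_energy/= /energy_norm /fe.
by rewrite -!ge0_fin_numE ?sqrte_ge0 ?energy_ge0// sqrte_fin_num// energy_ge0.
Qed.

Lemma energy_ballP mu : energy_ball G mu <-> en mu mu <= 1.
Proof.
rewrite /energy_ball/= /energy_norm.
by rewrite -[X in _ <= X <-> _](_ : sqrte 1 = 1) ?lee_sqrt//= sqrtr1.
Qed.

Lemma energy_ball_fe mu : energy_ball G mu -> fe mu.
Proof. by move/energy_ballP => h; apply: le_lt_trans h _; exact: ltry. Qed.

Lemma energy_norm_sqr mu : energy_norm G mu ^+ 2 = en mu mu.
Proof. by rewrite sqr_sqrte// energy_ge0. Qed.

Lemma ip_ge0 mu nu : (0 <= ip mu nu)%R.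
Proof. by rewrite /ip fine_ge0// energy_ge0. Qed.

Lemma energy_fin mu nu : fe mu -> fe nu -> en mu nu \is a fin_num.
Proof.
move=> /feP fmu /feP fnu; rewrite ge0_fin_numE; last exact: energy_ge0.
have [_ [h _]] := G_perfect; apply: le_lt_trans (h _ _ fmu fnu) _.
by apply: lte_mul_pinfty => //; [exact: sqrte_ge0|rewrite ge0_fin_numE// sqrte_ge0].
Qed.
Hint Resolve energy_fin : core.

Lemma energyE mu nu : fe mu -> fe nu -> en mu nu = (ip mu nu)%:E.
Proof. by move=> fmu fnu; rewrite /ip fineK//; exact: energy_fin. Qed.

Lemma ipC mu nu : ip mu nu = ip nu mu.
Proof. by rewrite /ip energyC. Qed.

Lemma ipDr mu nu1 nu2 : fe mu -> fe nu1 -> fe nu2 ->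
  ip mu (radon_add nu1 nu2) = (ip mu nu1 + ip mu nu2)%R.
Proof. by move=> *; rewrite /ip energyDr fineD//; exact: energy_fin. Qed.

Lemma ipDl mu nu1 nu2 : fe mu -> fe nu1 -> fe nu2 ->
  ip (radon_add nu1 nu2) mu = (ip nu1 mu + ip nu2 mu)%R.
Proof. by move=> *; rewrite /ip energyDl fineD//; exact: energy_fin. Qed.

Lemma ipZr mu r nu : fe mu -> fe nu ->
  ip mu (radon_scale r nu) = (r%:num * ip mu nu)%R.
Proof. by move=> *; rewrite /ip energyZr fineM//; exact: energy_fin. Qed.

Lemma ipZl mu r nu : fe mu -> fe nu ->
  ip (radon_scale r nu) mu = (r%:num * ip nu mu)%R.
Proof. by move=> *; rewrite /ip energyZl fineM//; exact: energy_fin. Qed.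

Lemma feD mu nu : fe mu -> fe nu -> fe (radon_add mu nu).
Proof.
move=> fmu fnu; rewrite /fe energyDr !energyDl.
rewrite !energyE// -!EFinD; exact: ltry.
Qed.

Lemma feZ r mu : fe mu -> fe (radon_scale r mu).
Proof.
move=> fmu; rewrite /fe energyZr energyZl muleA.
by apply: lte_mul_pinfty => //; rewrite ?lee_fin// mulr_ge0.
Qed.

Lemma energy_restr_restr_le D (mD : measurable D) mu :
  en (radon_restr mD mu) (radon_restr mD mu) <= en mu mu.
Proof.
apply: le_trans (energy_restr_le _ _ _) _.
by rewrite energyC energy_restr_le.
Qed.

Lemma fe_restr D (mD : measurable D) mu : fe mu -> fe (radon_restr mD mu).
Proof. exact: le_lt_trans (energy_restr_restr_le _ _). Qed.

Lemma energy_ball_restr D (mD : measurable D) mu :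
  energy_ball G mu -> energy_ball G (radon_restr mD mu).
Proof.
move=> /energy_ballP h; apply/energy_ballP.
exact: le_trans (energy_restr_restr_le _ _) h.
Qed.

Lemma ip_le_norm mu nu : fe mu -> fe nu ->
  (ip mu nu <= Num.sqrt (ip mu mu) * Num.sqrt (ip nu nu))%R.
Proof.
move=> fmu fnu; have [_ [h _]] := G_perfect.
have := h _ _ (proj2 (feP mu) fmu) (proj2 (feP nu) fnu).
by rewrite /energy_norm !energyE.
Qed.

(** Measures are not subtracted here; this is the form taken by ||mu - nu||^2 >= 0. *)
Lemma ip_AMGM mu nu : fe mu -> fe nu -> (2 * ip mu nu <= ip mu mu + ip nu nu)%R.
Proof.
move=> fmu fnu; have h := ip_le_norm fmu fnu.
have := sqr_ge0 (Num.sqrt (ip mu mu) - Num.sqrt (ip nu nu))%R.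
by rewrite sqrrB !sqr_sqrtr ?ip_ge0//; lra.
Qed.

(** Cauchy-Schwarz for lam1 - lam2 against nu without signed measures: [ip_AMGM] for lam1 and lam2 +
    d nu, then division by d. *)
Lemma ip_diff_le lam1 lam2 nu (d : R) : fe lam1 -> fe lam2 -> fe nu ->
  (ip nu nu <= 1)%R -> (0 < d)%R ->
  (ip lam1 lam1 + ip lam2 lam2 - 2 * ip lam1 lam2 <= d ^+ 2)%R ->
  (ip lam1 nu <= ip lam2 nu + d)%R.
Proof.
move=> f1 f2 fn n1 d0 q.
have d0' : (0 <= d)%R by exact: ltW.
pose t := NngNum d0'; pose b := radon_add lam2 (radon_scale t nu).
have ftn : fe (radon_scale t nu) by exact: feZ.
have fb : fe b by exact: feD.
have := ip_AMGM f1 fb; rewrite /b !ipDr// !ipDl// !ipZr// !ipZl// (ipC nu lam2) /=.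
have n0 := ip_ge0 nu nu; move: q n1 n0.
move: (ip lam1 lam1) (ip lam2 lam2) (ip lam1 lam2) (ip lam1 nu) (ip lam2 nu) (ip nu nu).
move=> a1 a2 a12 a1n a2n n q n1 n0 h.
have hd : (d * (d * n) <= d * d)%R by rewrite ler_pM2l// ler_piMr// ltW.
rewrite expr2 in q.
have : (d * (a1n - a2n) <= d * d)%R by lra.
by rewrite ler_pM2l//; lra.
Qed.

Lemma ip_eq_radon mu nu : fe mu -> fe nu ->
  (ip mu mu + ip nu nu - 2 * ip mu nu <= 0)%R -> radon_eq mu nu.
Proof.
move=> fmu fnu q; have [_ [_ h]] := G_perfect.
apply: h; [exact/feP|exact/feP|].
rewrite !energy_norm_sqr !energyE//.
transitivity ((ip mu mu + ip nu nu - 2 * ip mu nu)%:E) => //; congr (_%:E).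
by have := ip_AMGM fmu fnu; lra.
Qed.

Lemma radon_eq_integral mu nu (f : X -> \bar R) : radon_eq mu nu ->
  \int[mu]_x f x = \int[nu]_x f x.
Proof. by move=> h; apply: eq_measure_integral => A mA _; exact: h. Qed.

(** Since G(x,x) > 0 and [G] is l.s.c., [G] exceeds some d > 0 on [K] x [K] for a compact
    neighbourhood [K] of [x], and the energy is at least d mu(K)^2. *)
Lemma energy_local_bound (M : R) (x : X) : exists2 U, nbhs x U &
  exists C : R, forall mu, en mu mu <= M%:E -> forall B : set X, B `<=` U ->
    measurable (B : set (borel X)) -> mu B <= C%:E.
Proof.
have [d d0 dG] : exists2 d : R, (0 < d)%R & d%:E < G (x, x).
  have [_ _ _ /(_ x)] := G_kernel; case: (G (x, x)) => [r| |]//.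
    by rewrite lte_fin => r0; exists (r / 2)%R; [rewrite divr_gt0|rewrite lte_fin; lra].
  by move=> _; exists 1%R => //; rewrite ltry.
have [V [[V1 V2] [/= xV1 xV2] V12] VG] := G_lsc dG.
have [K cK [xK KV]] := nbhs_compact_nbhs (filterI xV1 xV2).
(* The added 1 forces mu(K) > 1 if the bound fails, and then d mu(K)^2 > d mu(K) > M. *)
exists K => //; exists (Num.max M 0 / d + 1)%R => mu muM B BK mB.
apply: (@le_trans _ _ (mu K)).
  by apply: le_measure; rewrite ?inE//; exact: compact_borel.
have mK : measurable (K : set (borel X)) by exact: compact_borel.
have fK : mu K \is a fin_num by rewrite ge0_fin_numE//; exact: radon_compact_fin.
have HG y z : K y -> K z -> d%:E <= G (y, z).
  by move=> /KV[Vy _] /KV[_ Vz]; apply: ltW; apply: VG; apply: V12.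
pose m := fine (mu K).
have m0 : (0 <= m)%R by rewrite fine_ge0.
have hpot y : K y -> (d * m)%:E <= pot mu y.
  move=> Ky; rewrite EFinM fineK// -integral_cst//.
  apply: (@le_trans _ _ (\int[mu]_(z in K) G (y, z))).
    apply: ge0_le_integral => //.
    - by move=> z _; rewrite lee_fin ltW.
    - by apply: (measurable_funTS (kernel_borel y)).
    - by move=> z Kz; exact: HG.
  by apply: ge0_subset_integral => //; exact: kernel_borel.
have : (d * m * m)%:E <= M%:E.
  apply: le_trans muM; rewrite (EFinM (d * m)) [X in _ * X]fineK// -integral_cst//.
  apply: (@le_trans _ _ (\int[mu]_(z in K) pot mu z)).
    apply: ge0_le_integral => //.
    - by move=> z _; rewrite lee_fin mulr_ge0// ltW.
    - by apply: (measurable_funTS (potential_borel mu)).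
  by apply: ge0_subset_integral => //; exact: potential_borel.
rewrite -[mu K]fineK// !lee_fin -/m => h.
rewrite leNgt; apply/negP => mlt.
have q0 : (0 <= Num.max M 0 / d)%R by rewrite divr_ge0 ?le_max ?lexx ?orbT// ltW.
have : (Num.max M 0 < d * m)%R by rewrite -ltr_pdivrMl// mulrC; lra.
move=> hm.
have hM : (M <= Num.max M 0)%R by rewrite le_max lexx.
have m1 : (1 < m)%R by lra.
have dm0 : (0 < d * m)%R by rewrite mulr_gt0//; lra.
have h2 : (d * m < d * m * m)%R by rewrite ltr_pMr.
by move: (d * m)%R (d * m * m)%R hM hm h2 h => p q; lra.
Qed.

Lemma energy_compact_bound (M : R) (K : set X) : compact K ->
  exists C : R, forall mu, en mu mu <= M%:E -> mu K <= C%:E.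
Proof.
move=> cK; have [b [bo bnbhs]] := countable_base.
pose good i := exists C : R, forall mu, en mu mu <= M%:E -> mu (b i) <= C%:E.
pose O n := \bigcup_(i in [set i | (i < n)%N /\ good i]) b i.
have mb i : measurable (b i : set (borel X)) by exact: open_borel.
have [n Kn] : exists n, K `<=` O n.
  apply: compact_sub_increasing_open => //.
  - by move=> n; apply: bigcup_open => i _.
  - by move=> m n mn x [i [/= im gi] bix]; exists i => //; split => //=; exact: leq_trans mn.
  - move=> x _; have [U xU [C UC]] := energy_local_bound M x.
    have [i bix biU] := bnbhs _ _ xU.
    by exists i.+1 => //; exists i => //; split => //=; exists C => mu muM; exact: UC.
suff [C HC] : exists C : R, forall mu, en mu mu <= M%:E -> mu (O n) <= C%:E.
  exists C => mu muM; apply: le_trans (HC mu muM); apply: le_measure; rewrite ?inE//.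
    exact: compact_borel.
  by apply: open_borel; apply: bigcup_open.
elim: n {Kn} => [|n [C HC]].
  exists 0%R => mu _; rewrite (_ : O 0%N = set0) ?measure0//.
  by apply/seteqP; split => x // [i []].
have [[D HD]|nD] := pselect (good n).
  exists (C + D)%R => mu muM; apply: (@le_trans _ _ (mu (O n `|` b n))).
    apply: le_measure; rewrite ?inE.
    - by apply: open_borel; apply: bigcup_open.
    - by apply: measurableU => //; apply: open_borel; apply: bigcup_open.
    - move=> x [i [/= ]]; rewrite ltnS leq_eqVlt => /predU1P[->|ilt] gi bix; [by right|left].
      by exists i.
  apply: (@le_trans _ _ (mu (O n) + mu (b n))).
    by apply: measureU2 => //; apply: open_borel; apply: bigcup_open.
  by rewrite EFinD; apply: leeD; [exact: HC|exact: HD].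
exists C => mu muM; rewrite (_ : O n.+1 = O n); first exact: HC.
apply/seteqP; split => x [i [/= h gi] bix]; exists i => //; split => //=.
  by move: h; rewrite ltnS leq_eqVlt => /predU1P[h|//]; rewrite h in gi.
exact: ltnW.
Qed.

Lemma energy_compact_bounded (M : R) (mu : nat -> radon R X) :
  (forall n, en (mu n) (mu n) <= M%:E) -> compact_bounded_seq mu.
Proof.
move=> muM K /(energy_compact_bound M)[C HC].
by exists C => n; exact: HC.
Qed.

(* Energy is lower semicontinuous because G m is lower semicontinuous for each measure m:
   (nu, nu) <= lim_m (nu, mu_m) <= lim_m lim_n (mu_m, mu_n). Consistency enters only
   through the convergence of (lam, mu_n). *)
Lemma energy_ball_ultralimit (F : set_system nat) mu : UltraFilter F ->
  (forall n, energy_ball G (mu n)) -> exists nu, [/\ energy_ball G nu, set_cvg F mu nu &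
    forall lam, fe lam -> (fun n => ip lam (mu n)) @ F --> ip lam nu].
Proof.
move=> UF bmu; have PF : ProperFilter F by exact: ultra_proper.
have emu n : en (mu n) (mu n) <= 1 by exact/energy_ballP.
have cbmu : compact_bounded_seq mu by apply: (@energy_compact_bounded 1).
have [nu munu] := radon_ultralimit UF cbmu.
have le1 m n : en (mu m) (mu n) <= 1.
  have fm := energy_ball_fe (bmu m); have fn := energy_ball_fe (bmu n).
  rewrite energyE// lee_fin; have := ip_AMGM fm fn.
  by have := emu m; have := emu n; rewrite !energyE// !lee_fin; lra.
have bnu : energy_ball G nu.
  apply/energy_ballP; apply: (set_cvg_lsc UF cbmu munu (potential_class_G nu)).
  apply: nearW => m; rewrite -[leLHS]/(en nu (mu m)) energyC.
  apply: (set_cvg_lsc UF cbmu munu (potential_class_G (mu m))).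
  by apply: nearW => n; exact: le1.
exists nu; split => // lam flam.
have [/(_ lam (proj2 (feP lam) flam)) [finl cl] _] := G_perfect.
have cv : (fun n => en lam (mu n)) @ F --> en lam nu.
  have /subspace_continuousP /(_ nu bnu) h := cl.
  move=> W /h; rewrite /nbhs/= /within/= => hW.
  have := set_cvg_vague UF cbmu munu hW; rewrite /nbhs/=.
  by apply: filterS => n; apply; exact: bmu.
have := @fine_cvg _ _ F _ (fun n => en lam (mu n)) (ip lam nu).
by apply; rewrite /ip fineK//; exact: finl.
Qed.

(** * Capacity *)

Lemma class_G_borel (g : X -> \bar R) : class_G g -> bmeas g.
Proof. by case=> _; exact: lsc_borel. Qed.

Lemma cc_class_C0 (f : X -> R) : cc_fun f -> (forall x, (0 <= f x)%R) -> class_C0 (EFin \o f).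
Proof.
move=> [cf cK] f0; split; first by split; [move=> x; rewrite lee_fin|exact: continuous_lsc].
split.
- by move=> x; rewrite lee_fin.
- by move=> x; rewrite ltry.
- move=> x a; rewrite lte_fin => fxa.
  exists (f @^-1` [set r | r < a]%R); last by move=> y /=; rewrite lte_fin.
  by apply: cf; apply: open_nbhs_nbhs; split => //; exact: open_lt.
- rewrite (_ : [set x | _] = [set x | f x != 0%R])//.
Qed.

Lemma open_indic_class_G (U : set X) : open U -> class_G (fun x => (\1_U x)%:E : \bar R).
Proof.
move=> oU; split; first by move=> x; rewrite lee_fin.
move=> x a; rewrite lte_fin indicE; case: (boolP (x \in U)) => [/set_mem Ux a1|_ a0].
  by exists U; [exact: open_nbhs_nbhs|move=> y Uy; rewrite lte_fin indicE mem_set].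
by exists setT; [exact: filterT|move=> y _; rewrite lte_fin (lt_le_trans a0)].
Qed.

Lemma cap_C0_ub f mu : energy_ball G mu -> \int[mu]_x f x <= cap_C0 G f.
Proof. by move=> bmu; apply: ereal_sup_ubound; exists mu. Qed.

Lemma cap_C0_le f y : (forall mu, energy_ball G mu -> \int[mu]_x f x <= y) -> cap_C0 G f <= y.
Proof. by move=> h; apply: ub_ereal_sup => _ [mu bmu <-]; exact: h. Qed.

Definition radon0 : radon R X.
Proof.
by apply: (@to_radon mzero) => K cK; rewrite /mzero/= ltry.
Defined.

Lemma energy_ball0 : energy_ball G radon0.
Proof.
apply/energy_ballP; rewrite (_ : en radon0 radon0 = 0) ?lee01//.
by rewrite -[LHS]/(\int[mzero]_x _) integral_measure_zero.
Qed.

Lemma cap_C0_ge0 f : (forall x, 0 <= f x) -> 0 <= cap_C0 G f.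
Proof. by move=> f0; apply: le_trans (cap_C0_ub f energy_ball0); exact: integral_ge0. Qed.

Lemma cap_C0_mono f g : (forall x, 0 <= f x) -> bmeas f -> bmeas g ->
  (forall x, f x <= g x) -> cap_C0 G f <= cap_C0 G g.
Proof.
move=> f0 mf mg fg; apply: cap_C0_le => mu bmu; apply: le_trans (cap_C0_ub g bmu).
by apply: ge0_le_integral.
Qed.

(** Monotone convergence extends the formula for continuous functions to all l.s.c. ones; afterwards
    only [cap_C0], a supremum of integrals, is handled. *)
Lemma cap_GE g : class_G g -> cap_G G g = cap_C0 G g.
Proof.
move=> gG; apply/eqP; rewrite eq_le; apply/andP; split.
  apply: ub_ereal_sup => _ [phi [[phiG _] phig] <-].
  by apply: cap_C0_mono => //; [case: phiG|exact: class_G_borel..].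
apply: cap_C0_le => mu bmu.
have [phi [cphi phi0 phig phile phigt]] := lsc_approx_integral gG.
apply: phigt => n; apply: le_trans (cap_C0_ub _ bmu) _.
apply: ereal_sup_ubound; exists (EFin \o phi n) => //; split; first exact: cc_class_C0.
by move=> x; exact: phig.
Qed.

Local Notation oc := (outer_cap G).

Let indic_leP (E : set X) (g : X -> \bar R) : class_F g ->
  (forall x, (\1_E x)%:E <= g x) <-> (forall x, E x -> 1 <= g x).
Proof.
move=> g0; split=> h x; first by move=> Ex; have := h x; rewrite indicE mem_set.
by rewrite indicE; case: (boolP (x \in E)) => [/set_mem/h//|_]; exact: g0.
Qed.

Lemma outer_cap_le (E : set X) g : class_G g -> (forall x, E x -> 1 <= g x) ->
  oc E <= cap_C0 G g.
Proof.
move=> gG Eg; rewrite -cap_GE//; apply: ereal_inf_lbound; exists g => //; split => //.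
by apply/indic_leP => //; case: gG.
Qed.

Lemma outer_cap_ge (E : set X) y : (forall g, class_G g -> (forall x, E x -> 1 <= g x) ->
  y <= cap_C0 G g) -> y <= oc E.
Proof.
move=> h; apply: le_ereal_inf_tmp => _ [g [gG Eg] <-]; rewrite cap_GE//; apply: h => //.
by apply/indic_leP => //; case: gG.
Qed.

Lemma outer_cap_lt (E : set X) y : oc E < y -> exists g, [/\ class_G g,
  forall x, E x -> 1 <= g x & cap_C0 G g < y].
Proof.
move=> /ereal_inf_lt[_ [g [gG Eg] <-]]; rewrite cap_GE// => gy; exists g; split => //.
by apply/indic_leP => //; case: gG.
Qed.

Lemma outer_cap_ge0 (E : set X) : 0 <= oc E.
Proof. by apply: outer_cap_ge => g [g0 _] _; exact: cap_C0_ge0. Qed.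

Lemma outer_cap_mono (E D : set X) : E `<=` D -> oc E <= oc D.
Proof. by move=> ED; apply: outer_cap_ge => g gG Dg; apply: outer_cap_le => // x /ED/Dg. Qed.

Lemma nneseries_class_G (g : nat -> X -> \bar R) : (forall n, class_G (g n)) ->
  class_G (fun x => \sum_(n <oo) g n x).
Proof.
move=> gG; have g0 n x : 0 <= g n x by have [+ _] := gG n; exact.
split; first by move=> x; exact: nneseries_ge0.
have fin_lsc N : lower_semicontinuous (fun x => \sum_(0 <= n < N) g n x).
  elim: N => [|N IH] x a.
    rewrite big_geq// => a0; exists setT; first exact: filterT.
    by move=> y _; rewrite big_geq.
  rewrite big_nat_recr//= => ax.
  (* A negative level is exceeded everywhere by nonnegativity; it is assigned to one summand when
     the other is infinite and can carry the whole bound. *)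
  have [r [s [rx sx ars]]] : exists r s : R, [/\ r%:E < \sum_(0 <= n < N) g n x \/ (r < 0)%R,
      s%:E < g N x \/ (s < 0)%R & (a <= r + s)%R].
    have S0 : 0 <= \sum_(0 <= n < N) g n x by exact: sume_ge0.
    move: ax; move: S0 (g0 N x).
    case: (\sum_(0 <= n < N) g n x) => [p| |]//; case: (g N x) => [q| |]//.
    - rewrite -EFinD !lee_fin lte_fin => p0 q0 apq.
      pose d := ((p + q - a) / 2)%R; have d0 : (0 < d)%R by rewrite divr_gt0// subr_gt0.
      exists (p - d)%R, (q - d)%R; split; [left|left|].
      + by rewrite lte_fin ltrBlDr ltrDl.
      + by rewrite lte_fin ltrBlDr ltrDl.
      + by rewrite /d; lra.
    - by move=> _ _ _; exists (-1)%R, (a + 1)%R; split; [right; lra|left; exact: ltry|lra].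
    - by move=> _ _ _; exists (a + 1)%R, (-1)%R; split; [left; exact: ltry|right; lra|lra].
    - by move=> _ _ _; exists (-1)%R, (a + 1)%R; split; [right; lra|left; exact: ltry|lra].
  have [V xV Vr] : exists2 V, nbhs x V & forall y, V y -> r%:E < \sum_(0 <= n < N) g n y.
    case: rx => [/IH//|r0]; exists setT; first exact: filterT.
    by move=> y _; apply: (@lt_le_trans _ _ 0); [rewrite lte_fin|exact: sume_ge0].
  have [W xW Ws] : exists2 W, nbhs x W & forall y, W y -> s%:E < g N y.
    case: sx => [|s0]; first by have [_] := gG N; apply.
    exists setT; first exact: filterT.
    by move=> y _; apply: (@lt_le_trans _ _ 0); [rewrite lte_fin|].
  exists (V `&` W); first exact: filterI.
  move=> y [Vy Wy]; rewrite big_nat_recr//=; apply: (@le_lt_trans _ _ (r%:E + s%:E)).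
    by rewrite -EFinD lee_fin.
  by apply: lteD => //; [exact: Vr|exact: Ws].
move=> x a ax.
have [N aN] : exists N, a%:E < \sum_(0 <= n < N) g n x.
  apply: contrapT => /forallNP h; move: ax; apply/negP; rewrite -leNgt.
  apply: lime_le; first by apply: is_cvg_nneseries.
  by apply: nearW => N; rewrite leNgt; apply/negP; exact: h.
have [V xV Va] := fin_lsc N _ _ aN; exists V => // y /Va /lt_le_trans; apply.
exact: nneseries_lim_ge.
Qed.

(** The sum of near-optimal l.s.c. majorants is an l.s.c. majorant for the union, and [cap_C0], as a
    supremum of integrals, is countably subadditive. *)
Lemma outer_cap_sigma_subadditive : sigma_subadditive oc.
Proof.
move=> E; have [->|fS] := eqVneq (\sum_(i <oo) oc (E i)) +oo; first exact: leey.
have foE i : oc (E i) \is a fin_num.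
  rewrite ge0_fin_numE ?outer_cap_ge0//.
  apply: (@le_lt_trans _ _ (\sum_(i <oo) oc (E i))); last by rewrite ltey.
  apply: (@le_trans _ _ (\sum_(0 <= k < i.+1) oc (E k))).
    by rewrite big_nat_recr//= leeDr// sume_ge0// => k _; exact: outer_cap_ge0.
  by apply: nneseries_lim_ge => k _ _; exact: outer_cap_ge0.
apply/lee_addgt0Pr => e e0.
have /choice[g gP] i : exists g, [/\ class_G g, forall x, E i x -> 1 <= g x &
    cap_C0 G g <= oc (E i) + (e / (2 ^ i.+1)%:R)%:E].
  have ei0 : (0 < e / (2 ^ i.+1)%:R)%R by rewrite divr_gt0// ltr0n expn_gt0.
  have : oc (E i) < oc (E i) + (e / (2 ^ i.+1)%:R)%:E.
    by rewrite -[X in X < X + _]fineK// -EFinD lte_fin ltrDl.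
  by move=> /outer_cap_lt[g [gG Eg /ltW h]]; exists g.
have gG i : class_G (g i) by have [] := gP i.
have g0 i x : 0 <= g i x by have [+ _] := gG i; exact.
apply: le_trans (epsilon_trick xpredT _ (ltW e0)); last by move=> n; exact: outer_cap_ge0.
apply: (@le_trans _ _ (\sum_(i <oo) cap_C0 G (g i))); last first.
  by apply: lee_nneseries => [i _ _|i _]; [exact: cap_C0_ge0|have [] := gP i].
apply: (@le_trans _ _ (cap_C0 G (fun x => \sum_(i <oo) g i x))).
  apply: outer_cap_le; first exact: nneseries_class_G.
  move=> x [i _ Eix]; have [_ /(_ x Eix) h _] := gP i; apply: (le_trans h).
  apply: (@le_trans _ _ (\sum_(0 <= k < i.+1) g k x)).
    by rewrite big_nat_recr//= leeDr// sume_ge0.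
  exact: nneseries_lim_ge.
apply: cap_C0_le => mu bmu; rewrite integral_nneseries//; last by move=> n; exact: class_G_borel.
by apply: lee_nneseries => [i _ _|i _]; [exact: integral_ge0|exact: cap_C0_ub].
Qed.

Lemma outer_cap0 : oc set0 = 0.
Proof.
apply/eqP; rewrite eq_le outer_cap_ge0 andbT.
apply: (@le_trans _ _ (cap_C0 G (fun x => (\1_(@set0 X) x)%:E))).
  by apply: outer_cap_le => //; apply: open_indic_class_G; exact: open0.
apply: cap_C0_le => mu _; under eq_integral do rewrite indic0.
by rewrite integral0.
Qed.

Lemma outer_capU (E D : set X) : oc (E `|` D) <= oc E + oc D.
Proof.
rewrite -bigcup2E; apply: le_trans (outer_cap_sigma_subadditive _) _.
rewrite (nneseries_split 0%N 2%N)//; last by move=> k _; exact: outer_cap_ge0.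
rewrite add0n big_mkord 2!big_ord_recl big_ord0 /= adde0 eseries0 ?adde0//.
by move=> [|[|k]] //= _ _; exact: outer_cap0.
Qed.

Lemma outer_capU0 (E D : set X) : oc D = 0 -> oc (E `|` D) <= oc E.
Proof. by move=> D0; apply: le_trans (outer_capU _ _) _; rewrite D0 adde0. Qed.

Lemma outer_cap_bigcup0 (E : nat -> set X) : (forall n, oc (E n) = 0) -> oc (\bigcup_n E n) = 0.
Proof.
move=> E0; apply/eqP; rewrite eq_le outer_cap_ge0 andbT.
by apply: le_trans (outer_cap_sigma_subadditive _) _; rewrite eseries0.
Qed.

Lemma outer_cap_sub0 (E D : set X) : E `<=` D -> oc D = 0 -> oc E = 0.
Proof.
by move=> ED D0; apply/eqP; rewrite eq_le outer_cap_ge0 andbT -D0; exact: outer_cap_mono.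
Qed.

Lemma fe_scale_ball mu : fe mu -> exists2 c : {nonneg R}, (0 < c%:num)%R &
  energy_ball G (radon_scale c mu).
Proof.
(* Adding 1 keeps the divisor positive when the energy is zero. *)
move=> fmu; pose s := Num.sqrt (ip mu mu + 1)%R.
have ip0 := ip_ge0 mu mu.
have s0 : (0 < s)%R by rewrite sqrtr_gt0; lra.
have c0 : (0 <= s^-1)%R by rewrite invr_ge0 ltW.
exists (NngNum c0); first by rewrite /= invr_gt0.
apply/energy_ballP; rewrite energyE; [|exact: feZ|exact: feZ].
rewrite lee_fin ipZr ?ipZl//=; last exact: feZ.
rewrite mulrA -expr2 exprVn sqr_sqrtr; last by lra.
by rewrite ler_pdivrMl; lra.
Qed.

(* nu(E) <= c*(E) ||nu||, applied to l.s.c. majorants of the indicator of E. *)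
Lemma outer_cap0_negligible (E : set X) mu : oc E = 0 -> fe mu ->
  (radon_measure mu).-negligible (E : set (borel X)).
Proof.
move=> E0 fmu; have [c c0 bc] := fe_scale_ball fmu.
have /choice[g gP] n : exists g, [/\ class_G g, forall x, E x -> 1 <= g x &
    cap_C0 G g < (n.+1%:R^-1)%:E].
  by apply: outer_cap_lt; rewrite E0 lte_fin invr_gt0.
have mg n : bmeas (g n) by apply: class_G_borel; have [] := gP n.
pose N := \bigcap_n [set x : borel X | 1 <= g n x].
have mA n : measurable [set x : borel X | 1 <= g n x].
  by rewrite -[X in measurable X]setTI; apply: emeasurable_fun_c_infty.
have mN : measurable N by exact: bigcap_measurable.
exists N; split => //; last by move=> x Ex n _; have [_ + _] := gP n; apply.
have sN : radon_scale c mu N = 0.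
  apply/eqP; rewrite eq_le measure_ge0 andbT; apply/lee_addgt0Pr => e e0; rewrite add0e.
  pose n := Num.truncn e^-1.
  have [gG _ gn] := gP n.
  apply: (@le_trans _ _ (n.+1%:R^-1)%:E); last first.
    by rewrite lee_fin invf_ple ?posrE// ltW// truncnS_gt.
  apply: le_trans (ltW gn); apply: le_trans (cap_C0_ub _ bc).
  rewrite -[leLHS](mul1e) -integral_cst//.
  apply: (@le_trans _ _ (\int[radon_scale c mu]_(x in N) g n x)).
    apply: ge0_le_integral => //; first exact: measurable_funTS.
    by move=> x Nx; exact: Nx.
  by apply: ge0_subset_integral => //; case: gG.
have : c%:num%:E * mu N = 0 by exact: sN.
by move/eqP; rewrite mule_eq0 gt_eqF//= => /eqP.
Qed.

(** * From integral inequalities on the energy ball to pointwise ones *)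

Lemma free_ultrafilter : exists F : set_system nat, UltraFilter F /\
  forall P : set nat, (\forall n \near \oo, P n) -> F P.
Proof. by have [F [UF oF]] := @ultraFilterLemma nat \oo _; exists F; split. Qed.

(* Dini's argument: the functions (lam, nu) - \int phi_n dnu decrease to 0 on the
   vaguely compact energy ball and are vaguely continuous by consistency. *)
Lemma ip_potential_approx lam (d : R) : fe lam -> (0 < d)%R ->
  exists phi : X -> R, [/\ cc_fun phi, forall x, (0 <= phi x)%R,
    forall x, (phi x)%:E <= pot lam x &
    forall nu, energy_ball G nu -> (ip lam nu <= I nu phi + d)%R].
Proof.
move=> flam d0.
have [phi [cphi phi0 phig phile phisup]] := lsc_approx_integral (potential_class_G lam).
suff [n Hn] : exists n, forall nu, energy_ball G nu -> (ip lam nu <= I nu (phi n) + d)%R.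
  by exists (phi n).
apply: contrapT => /forallNP H.
have /choice[nu nuP] n : exists nu, energy_ball G nu /\ (I nu (phi n) + d < ip lam nu)%R.
  apply: contrapT => /forallNP h; apply: (H n) => nu bnu; rewrite leNgt; apply/negP => lt.
  by apply: (h nu).
have [F [UF oF]] := free_ultrafilter; have PF : ProperFilter F by exact: ultra_proper.
have bnu n : energy_ball G (nu n) by have [] := nuP n.
have [nu' [bnu' cvnu cvip]] := energy_ball_ultralimit UF bnu.
have cb : compact_bounded_seq nu by apply: (@energy_compact_bounded 1) => n; exact/energy_ballP.
have fnu' := energy_ball_fe bnu'.
have key m : (I nu' (phi m) <= ip lam nu' - d)%R.
  rewrite lerBrDr -subr_ge0.
  apply: (cvgr_to_ge (cvgB (cvip lam flam) (cvgD (set_cvg_cc UF cb cvnu (cphi m)) (cvg_cst d)))).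
  apply: oF; exists m => // n /= mn; rewrite subr_ge0.
  have [_ /ltW] := nuP n; apply: le_trans; rewrite lerD2r.
  by apply: le_Rintegral => //; [exact: mint_cc..|move=> x _; exact: phile].
have : en lam nu' <= (ip lam nu' - d)%:E.
  apply: phisup => m; rewrite -[leLHS]fineK ?lee_fin; first exact: key.
  exact: integrable_fin_num (mint_cc nu' (cphi m)).
by rewrite energyE// lee_fin; lra.
Qed.

Lemma open_above_cc (g : X -> \bar R) (phi : X -> R) (e : R) : class_G g -> continuous phi ->
  open [set x | (phi x + e)%:E < g x].
Proof.
move=> [g0 gl] cphi; rewrite openE => x /= xg.
have [a pa ag] : exists2 a : R, (phi x + e < a)%R & a%:E < g x.
  case: (g x) xg => [r| |]//.
    by rewrite lte_fin => h; exists ((phi x + e + r) / 2)%R; [lra|rewrite lte_fin; lra].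
  by move=> _; exists (phi x + e + 1)%R; [lra|rewrite ltry].
have [V xV Va] := gl x a ag.
have xW : nbhs x (phi @^-1` [set r | r < a - e]%R).
  by apply: cphi; apply: open_nbhs_nbhs; split; [exact: open_lt|rewrite /=; lra].
apply: filterS (filterI xV xW) => y [Vy /= py]; apply: le_lt_trans (Va y Vy).
by rewrite lee_fin; lra.
Qed.

(* Chebyshev's inequality, obtained by testing the hypothesis on the restriction of nu
   to the set on the left. *)
Lemma outer_cap_above_cc (g : X -> \bar R) (phi : X -> R) (k e : R) :
  class_G g -> cc_fun phi -> (forall x, (0 <= phi x)%R) -> (0 < e)%R ->
  (forall nu, energy_ball G nu -> \int[nu]_x g x <= (I nu phi + k)%:E) ->
  oc [set x | (phi x + e)%:E < g x] <= (k / e)%:E.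
Proof.
move=> gG ccphi phi0 e0 H; set P := [set x | _].
have oP : open P by apply: open_above_cc => //; case: ccphi.
have mP : measurable (P : set (borel X)) by exact: open_borel.
have mphi : bmeas (EFin \o phi) by apply: continuous_borel; case: ccphi.
have mg : bmeas g by exact: class_G_borel.
apply: (@le_trans _ _ (cap_C0 G (fun x => (\1_P x)%:E))).
  apply: outer_cap_le; first exact: open_indic_class_G.
  by move=> x Px; rewrite indicE mem_set.
apply: cap_C0_le => nu bnu; rewrite integral_indic// setIT.
have := H _ (energy_ball_restr mP bnu).
rewrite integral_radon_restr//; last by case: gG.
have -> : I (radon_restr mP nu) phi = fine (\int[nu]_(x in P) (phi x)%:E).
  by rewrite /Rintegral integral_radon_restr// => x; rewrite lee_fin.
have fp : \int[nu]_(x in P) (phi x)%:E \is a fin_num.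
  by apply: integrable_fin_num => //; apply: (integrableS _ _ _ (mint_cc nu ccphi)).
rewrite EFinD fineK// => h.
have : \int[nu]_(x in P) (phi x)%:E + e%:E * nu P <= \int[nu]_(x in P) (phi x)%:E + k%:E.
  apply: le_trans h; rewrite -integral_cst// -ge0_integralD//.
  - apply: ge0_le_integral => //.
    + by move=> x _; rewrite adde_ge0 ?lee_fin// ltW.
    + by apply: emeasurable_funD => //; exact: measurable_funTS.
    + exact: measurable_funTS.
    + by move=> x /ltW; rewrite EFinD.
  - by move=> x _; rewrite lee_fin.
  - exact: measurable_funTS.
  - by move=> x _; rewrite lee_fin ltW.
rewrite leeD2lE// => h2.
have fnP : nu P \is a fin_num.
  rewrite ge0_fin_numE//; move: h2; case: (nu P) => [r _|/=|//]; first exact: ltry.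
  by rewrite gt0_muley ?lte_fin.
move: h2; rewrite -[nu P]fineK// -EFinM !lee_fin => h2.
by rewrite ler_pdivlMr// mulrC.
Qed.

(** A test function below the potential and within d e of it on the energy ball takes its place;
    division by the gap e turns the loss into d, which is arbitrary. *)
Lemma outer_cap_above_potential lam (g : X -> \bar R) (k e : R) :
  fe lam -> class_G g -> (0 < e)%R ->
  (forall nu, energy_ball G nu -> \int[nu]_x g x <= (ip lam nu + k)%:E) ->
  oc [set x | pot lam x + e%:E < g x] <= (k / e)%:E.
Proof.
move=> flam gG e0 H; apply/lee_addgt0Pr => d d0; rewrite -EFinD.
have de0 : (0 < d * e)%R by exact: mulr_gt0.
have [phi [ccphi phi0 phile phiH]] := ip_potential_approx flam de0.
apply: (@le_trans _ _ (oc [set x | (phi x + e)%:E < g x])).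
  apply: outer_cap_mono => x /=; apply: le_lt_trans.
  by rewrite EFinD; apply: leeD.
have -> : (k / e + d = (k + d * e) / e)%R by rewrite mulrDl mulfK// gt_eqF.
apply: outer_cap_above_cc => // nu bnu; apply: le_trans (H nu bnu) _.
by rewrite lee_fin; have := phiH nu bnu; lra.
Qed.

Lemma outer_cap_gt_potential lam (g : X -> \bar R) : fe lam -> class_G g ->
  (forall nu, energy_ball G nu -> \int[nu]_x g x <= (ip lam nu)%:E) ->
  oc [set x | pot lam x < g x] = 0.
Proof.
move=> flam gG H.
apply: (@outer_cap_sub0 _ (\bigcup_n [set x | pot lam x + (n.+1%:R^-1)%:E < g x])).
  by apply: lt_bigcup_add; exact: potential_ge0.
apply: outer_cap_bigcup0 => n; apply/eqP; rewrite eq_le outer_cap_ge0 andbT.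
have n0 : (0 < n.+1%:R^-1 :> R)%R by rewrite invr_gt0.
apply: le_trans (outer_cap_above_potential (k := 0%R) flam gG n0 _) _; last by rewrite mul0r.
by move=> nu bnu; rewrite addr0; exact: H.
Qed.

(** * Measures representing the outer capacity *)

Lemma cap_integral_le (g : X -> \bar R) (C s : R) w : class_G g -> cap_C0 G g <= C%:E ->
  fe w -> (0 < s)%R -> (ip w w <= s ^+ 2)%R -> \int[w]_x g x <= (C * s)%:E.
Proof.
move=> gG gC fw s0 ws; have c0 : (0 <= s^-1)%R by rewrite invr_ge0 ltW.
pose c := NngNum c0.
have b : energy_ball G (radon_scale c w).
  apply/energy_ballP; rewrite energyE; [|exact: feZ|exact: feZ].
  rewrite lee_fin ipZr ?ipZl//=; last exact: feZ.
  by rewrite mulrA -expr2 exprVn ler_pdivrMl ?mulr1// exprn_gt0.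
have := le_trans (cap_C0_ub g b) gC; rewrite integral_radon_scale /=; last 2 first.
- exact: class_G_borel.
- by case: gG.
by rewrite EFinM muleC -lee_pdivrMr// muleC.
Qed.

(** The bound C ||w|| with the norm replaced by its square, so that a first variation can be
    expanded bilinearly. *)
Lemma cap_AMGM (g : X -> \bar R) (C : R) w : class_G g -> cap_C0 G g <= C%:E ->
  (0 <= C)%R -> fe w -> \int[w]_x g x <= ((C ^+ 2 + ip w w) / 2)%:E.
Proof.
move=> gG gC C0 fw; have w0 := ip_ge0 w w.
have [w1|w1] := eqVneq (ip w w) 0%R.
  have [CC|CC] := eqVneq C 0%R.
    apply: le_trans (cap_integral_le gG gC fw ltr01 _) _; first by rewrite w1; lra.
    by rewrite CC w1 lee_fin mul0r; lra.
  (* For zero energy any s > 0 bounds the norm; s = C/2 gives exactly C^2/2. *)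
  have C2 : (0 < C / 2)%R by rewrite divr_gt0// lt0r CC.
  apply: le_trans (cap_integral_le gG gC fw C2 _) _; first by rewrite w1 sqr_ge0.
  by rewrite w1 lee_fin; lra.
have s0 : (0 < Num.sqrt (ip w w))%R by rewrite sqrtr_gt0 lt0r w1.
apply: le_trans (cap_integral_le gG gC fw s0 _) _; first by rewrite sqr_sqrtr.
have := sqr_ge0 (C - Num.sqrt (ip w w))%R.
by rewrite sqrrB sqr_sqrtr// lee_fin; lra.
Qed.

(* lam = C nu', where nu' maximizes \int g over the energy ball; the first variation in
   the direction mu, with nu_n + t mu and t -> 0, gives the last inequality. *)
Lemma cap_potential (g : X -> \bar R) (C : R) : class_G g -> cap_C0 G g = C%:E ->
  exists lam, [/\ fe lam, (ip lam lam <= C ^+ 2)%R &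
    forall nu, fe nu -> \int[nu]_x g x <= (ip lam nu)%:E].
Proof.
move=> gG gC; have g0 x : 0 <= g x by case: gG.
have mg : bmeas g by exact: class_G_borel.
have C0 : (0 <= C)%R by rewrite -lee_fin -gC cap_C0_ge0.
have gC' : cap_C0 G g <= C%:E by rewrite gC.
have fing mu : fe mu -> \int[mu]_x g x \is a fin_num.
  move=> fmu; rewrite ge0_fin_numE; last exact: integral_ge0.
  by apply: le_lt_trans (cap_AMGM gG gC' C0 fmu) _; exact: ltry.
have /choice[nu nuP] n : exists nu, energy_ball G nu /\ (C - n.+1%:R^-1 < fine (\int[nu]_x g x))%R.
  have n0 : (0 < n.+1%:R^-1 :> R)%R by rewrite invr_gt0.
  have := @ub_ereal_sup_adherent R [set \int[mu]_x g x | mu in energy_ball G] _ n0.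
  rewrite -/(cap_C0 G g) gC => /(_ isT)[_ [mu bmu <-] h]; exists mu; split => //.
  by rewrite -lte_fin EFinB fineK//; apply: fing; exact: energy_ball_fe.
have bnu n : energy_ball G (nu n) by have [] := nuP n.
have fnu n : fe (nu n) by exact: energy_ball_fe.
have [F [UF oF]] := free_ultrafilter; have PF : ProperFilter F by exact: ultra_proper.
have [nu' [bnu' _ cvip]] := energy_ball_ultralimit UF bnu.
have fnu' := energy_ball_fe bnu'.
have ip1 mu : energy_ball G mu -> (ip mu mu <= 1)%R.
  by move=> bmu; have := energy_ball_fe bmu; move/energy_ballP: bmu => + h; rewrite energyE.
pose c := NngNum C0.
exists (radon_scale c nu'); split; first exact: feZ.
  rewrite ipZr ?ipZl//=; last exact: feZ.
  by rewrite mulrA -expr2 ler_piMr// ?sqr_ge0// ip1.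
move=> mu fmu; rewrite ipZl//= -[leLHS]fineK ?fing// lee_fin.
set y := fine _; pose N := ip mu mu.
have N0 : (0 <= N)%R by exact: ip_ge0.
suff H t : (0 < t)%R -> (y <= C * ip nu' mu + t * (C + N / 2))%R.
  apply/ler_addgt0Pr => e e0; have D0 : (0 < C + N / 2 + 1)%R by lra.
  have t0 : (0 < e / (C + N / 2 + 1))%R by rewrite divr_gt0.
  apply: (le_trans (H _ t0)); rewrite lerD2l -mulrA ler_piMr ?ltW//.
  by rewrite ltr_pdivrMl//; lra.
move=> t0; have t0' := ltW t0; pose tt := NngNum t0'.
(* The variation is made at the near-maximizers, because the integral of [g] is only lower
   semicontinuous along the limit, whereas the mutual energy with [mu] converges. *)
have step n : (t * y <= C * n.+1%:R^-1 + C * t * ip mu (nu n) + t * t * N / 2)%R.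
  pose w := radon_add (radon_scale c (nu n)) (radon_scale tt mu).
  have f1 : fe (radon_scale c (nu n)) by exact: feZ.
  have f2 : fe (radon_scale tt mu) by exact: feZ.
  have fw : fe w by exact: feD.
  have := cap_AMGM gG gC' C0 fw.
  rewrite integral_radon_add// !integral_radon_scale// -[\int[nu n]_x _]fineK ?fing ?fnu//.
  rewrite -[\int[mu]_x _]fineK ?fing// -/y -!EFinM -EFinD lee_fin.
  have -> : ip w w = (C * C * ip (nu n) (nu n) + 2 * (C * t * ip mu (nu n)) + t * t * N)%R.
    rewrite ipDr// !ipDl// ipZr// ipZl// ipZr// ipZl// ipZr// ipZl// ipZr// ipZl//=.
    by rewrite (ipC (nu n) mu) /N; ring.
  have [_ hz] := nuP n; have h1 := ip1 _ (bnu n).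
  have h2 : (C * C * ip (nu n) (nu n) <= C * C)%R by rewrite ler_piMr// mulr_ge0.
  have h3 : (C * (C - n.+1%:R^-1) <= C * fine (\int[nu n]_x g x))%R by rewrite ler_wpM2l// ltW.
  rewrite (_ : c%:num = C)// (_ : tt%:num = t)// expr2; move: h2 h3.
  move: (fine _) (n.+1%:R^-1)%R (ip (nu n) (nu n)) (ip mu (nu n)) => z q p1 p2 h2 h3 h4.
  rewrite mulrBr in h3; move: h2 h3 h4.
  move: (C * C * p1)%R (C * t * p2)%R (C * q)%R (C * z)%R (C * C)%R (t * t * N)%R.
  by move=> *; lra.
have : (t * y - t * t * (C + N / 2) <= C * t * ip mu nu')%R.
  apply: (cvgr_to_ge (cvgM (cvg_cst (C * t)%R) (cvip mu fmu))); apply: oF.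
  (* Makes the defect 1/(n+1) at most t^2, so that it still vanishes after division by t. *)
  exists (Num.truncn (t * t)^-1) => // n /= nt.
  have tt0 : (0 < t * t)%R by exact: mulr_gt0.
  have h : (n.+1%:R^-1 <= t * t)%R.
    rewrite invf_ple ?posrE//; apply: le_trans (ltW (truncnS_gt _)) _.
    by rewrite ler_nat.
  have := step n; have : (C * n.+1%:R^-1 <= C * (t * t))%R by rewrite ler_wpM2l.
  by move: (C * _^-1)%R (C * t * ip mu (nu n))%R => p q; lra.
rewrite (ipC nu' mu) => h; rewrite -(ler_pM2l t0); lra.
Qed.

(** Reduction to the energy ball by scaling with sqrt(M + 1), which is positive even for M = 0, and
    scaling back. *)
Lemma energy_ultralimit (F : set_system nat) mu (M : R) : UltraFilter F ->
  (forall n, fe (mu n)) -> (forall n, ip (mu n) (mu n) <= M)%R ->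
  exists nu, [/\ fe nu, set_cvg F mu nu,
    forall lam, fe lam -> (fun n => ip lam (mu n)) @ F --> ip lam nu &
    forall r, (\forall n \near F, (ip (mu n) (mu n) <= r)%R) -> (ip nu nu <= r)%R].
Proof.
move=> UF fmu muM; have PF : ProperFilter F by exact: ultra_proper.
have M0 : (0 <= M)%R by apply: le_trans (muM 0%N); exact: ip_ge0.
pose s := Num.sqrt (M + 1); have s0 : (0 < s)%R by rewrite sqrtr_gt0; lra.
have c0 : (0 <= s^-1)%R by rewrite invr_ge0 ltW.
have s0' : (0 <= s)%R by exact: ltW.
pose c := NngNum c0; pose d := NngNum s0'.
have bmu n : energy_ball G (radon_scale c (mu n)).
  apply/energy_ballP; rewrite energyE; [|exact: feZ|exact: feZ].
  rewrite lee_fin ipZr ?ipZl//=; last exact: feZ.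
  rewrite mulrA -expr2 exprVn sqr_sqrtr; last by lra.
  by rewrite ler_pdivrMl ?mulr1; have := muM n; lra.
have [nu' [bnu' [cK cO] cvip]] := energy_ball_ultralimit UF bmu.
have fnu' := energy_ball_fe bnu'.
exists (radon_scale d nu').
have fnu : fe (radon_scale d nu') by exact: feZ.
have cv lam : fe lam -> (fun n => ip lam (mu n)) @ F --> ip lam (radon_scale d nu').
  move=> flam; rewrite ipZr//=.
  have -> : (fun n => ip lam (mu n)) = (fun n => s * ip lam (radon_scale c (mu n)))%R.
    by apply/funext => n; rewrite ipZr//= mulrA divff ?mul1r// gt_eqF.
  by apply: cvgM; [exact: cvg_cst|exact: cvip].
split => //.
- have scaleE (m : radon R X) B : radon_scale c m B = (s^-1)%:E * m B by [].
  have scaleE' B : radon_scale d nu' B = s%:E * nu' B by [].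
  split=> [K r cptK rK|V r oV rV].
  + have := cK K (s^-1 * r)%R cptK; rewrite scaleE' => h.
    rewrite muleC -lee_pdivrMr// muleC -EFinM; apply: h; apply: filterS rK => n rn.
    by rewrite scaleE EFinM lee_pmul2l// lte_fin invr_gt0.
  + have := cO V (s^-1 * r)%R oV; rewrite scaleE' => h.
    rewrite muleC -lee_pdivlMr// muleC -EFinM; apply: h; apply: filterS rV => n rn.
    by rewrite scaleE EFinM lee_pmul2l// lte_fin invr_gt0.
(* Testing convergence against nu itself: 2 (nu, mu_n) <= ||nu||^2 + r, and the left side tends to 2
   ||nu||^2. *)
- move=> r hr; set nu := radon_scale d nu' in fnu cv *.
  have : (ip nu nu - (ip nu nu + r) / 2 <= 0)%R.
    apply: (cvgr_to_le (cvgB (cv nu fnu) (cvg_cst ((ip nu nu + r) / 2)%R))).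
    apply: filterS hr => n hn /=; rewrite !fctE.
    by have := ip_AMGM fnu (fmu n); lra.
  by lra.
Qed.

(** Off the exceptional set the potential is itself an l.s.c. majorant, and by Cauchy-Schwarz its
    capacity is at most the norm of [lam]. *)
Lemma outer_cap_le_norm (E : set X) lam : fe lam ->
  oc (E `&` [set x | pot lam x < 1]) = 0 -> oc E <= (Num.sqrt (ip lam lam))%:E.
Proof.
move=> flam E0; set N := E `&` _ in E0.
apply: (@le_trans _ _ (oc ((E `\` [set x | pot lam x < 1]) `|` N))).
  by apply: outer_cap_mono => x Ex; have [h|h] := pselect (pot lam x < 1); [right|left].
apply: le_trans (outer_capU0 _ E0) _.
apply: le_trans (outer_cap_le (potential_class_G lam) _) _.
  by move=> x [_ /negP]; rewrite -leNgt.
apply: cap_C0_le => nu bnu; have fnu := energy_ball_fe bnu.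
rewrite -[leLHS]/(en lam nu) energyE// lee_fin; apply: (le_trans (ip_le_norm flam fnu)).
rewrite ler_piMr ?sqrtr_ge0// -[leRHS]sqrtr1 ler_sqrt//.
by move/energy_ballP: bnu; rewrite energyE.
Qed.

Lemma potential_add mu nu x : pot (radon_add mu nu) x = pot mu x + pot nu x.
Proof. exact: integral_radon_add. Qed.

Lemma potential_scale c mu x : pot (radon_scale c mu) x = c%:num%:E * pot mu x.
Proof. exact: integral_radon_scale. Qed.

(* The half-sum of two admissible measures is admissible, so their parallelogram
   identity makes minimizing sequences Cauchy. *)
Lemma outer_cap_minimizer (E : set X) (gam : R) : oc E = gam%:E ->
  exists lam, [/\ fe lam, (ip lam lam = gam ^+ 2)%R & oc (E `&` [set x | pot lam x < 1]) = 0].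
Proof.
move=> Egam; have gam0 : (0 <= gam)%R by rewrite -lee_fin -Egam outer_cap_ge0.
pose a n : R := (n.+1%:R^-1)%R; have a0 n : (0 < a n)%R by rewrite invr_gt0.
have ale m n : (m <= n)%N -> (a n <= a m)%R.
  by move=> mn; rewrite lef_pV2 ?posrE// ler_nat.
have near_a (e : R) : (0 < e)%R -> exists n, (a n <= e)%R.
  move=> e0; exists (Num.truncn e^-1); rewrite invf_ple ?posrE//.
  exact: ltW (truncnS_gt _).
have /choice[lam lamP] n : exists lam, [/\ fe lam, (ip lam lam <= gam ^+ 2 + a n)%R &
    oc (E `&` [set x | pot lam x < 1]) = 0].
  have gs : oc E < (Num.sqrt (gam ^+ 2 + a n))%:E.
    rewrite Egam lte_fin -{1}(ger0_norm gam0) -sqrtr_sqr ltr_sqrt; last first.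
      by rewrite ltr_wpDl ?sqr_ge0.
    by rewrite ltrDl.
  have [g [gG Eg gs']] := outer_cap_lt gs.
  have cg0 : 0 <= cap_C0 G g by apply: cap_C0_ge0; case: gG.
  have fg : cap_C0 G g \is a fin_num by rewrite ge0_fin_numE//; apply: lt_trans gs' (ltry _).
  have [lam [flam lamg Hlam]] := cap_potential gG (esym (fineK fg)).
  exists lam; split => //.
    apply: (le_trans lamg); rewrite -[leRHS]sqr_sqrtr; last by rewrite addr_ge0 ?sqr_ge0// ltW.
    rewrite ler_sqr ?nnegrE ?sqrtr_ge0 ?fine_ge0//.
    by rewrite -lee_fin fineK// ltW.
  apply: (@outer_cap_sub0 _ [set x | pot lam x < g x]).
    by move=> x [Ex /= px]; apply: (lt_le_trans px); exact: Eg.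
  by apply: outer_cap_gt_potential => // nu bnu; apply: Hlam; exact: energy_ball_fe.
have flam n : fe (lam n) by have [] := lamP n.
have lama n : (ip (lam n) (lam n) <= gam ^+ 2 + a n)%R by have [] := lamP n.
have lamE n : oc (E `&` [set x | pot (lam n) x < 1]) = 0 by have [] := lamP n.
have gam_le mu : fe mu -> oc (E `&` [set x | pot mu x < 1]) = 0 -> (gam ^+ 2 <= ip mu mu)%R.
  move=> fmu h; have := outer_cap_le_norm fmu h; rewrite Egam lee_fin => h2.
  by rewrite -[leRHS]sqr_sqrtr ?ip_ge0// ler_sqr ?nnegrE ?sqrtr_ge0.
have cross n m : (gam ^+ 2 - (a n + a m) / 2 <= ip (lam n) (lam m))%R.
  have h0 : (0 <= 2^-1 :> R)%R by rewrite invr_ge0.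
  pose w := radon_scale (NngNum h0) (radon_add (lam n) (lam m)).
  have fs : fe (radon_add (lam n) (lam m)) by exact: feD.
  have : (gam ^+ 2 <= ip w w)%R.
    apply: gam_le; first exact: feZ.
    apply: (@outer_cap_sub0 _ ((E `&` [set x | pot (lam n) x < 1]) `|`
        (E `&` [set x | pot (lam m) x < 1]))).
      move=> x [Ex /=]; rewrite potential_scale potential_add/= => h.
      have [p1|p1] := ltP (pot (lam n) x) 1; first by left.
      have [p2|p2] := ltP (pot (lam m) x) 1; first by right.
      exfalso; move: h; apply/negP; rewrite -leNgt.
      have : 2^-1%:E * (1 + 1) <= 2^-1%:E * (pot (lam n) x + pot (lam m) x).
        by apply: lee_wpmul2l; [rewrite lee_fin|exact: leeD].
      by apply: le_trans; rewrite -EFinD -EFinM lee_fin; lra.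
    apply/eqP; rewrite eq_le outer_cap_ge0 andbT; apply: le_trans (outer_capU0 _ (lamE m)) _.
    by rewrite lamE.
  rewrite ipZr ?ipZl//; last exact: feZ.
  rewrite ipDr// !ipDl// (ipC (lam m) (lam n)) /=.
  by have := lama n; have := lama m; lra.
have [F [UF oF]] := free_ultrafilter; have PF : ProperFilter F by exact: ultra_proper.
have [|mu [fmu _ cvip ipmu]] := @energy_ultralimit F lam (gam ^+ 2 + a 0%N)%R UF flam.
  by move=> n; apply: (le_trans (lama n)); rewrite lerD2l ale.
have mu_le : (ip mu mu <= gam ^+ 2)%R.
  apply/ler_addgt0Pr => e /near_a[n ne]; apply: ipmu; apply: oF; exists n => // m /= nm.
  by apply: (le_trans (lama m)); rewrite lerD2l (le_trans (ale _ _ nm)).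
have cross_mu n : (gam ^+ 2 - a n <= ip (lam n) mu)%R.
  apply: (cvgr_to_ge (cvip (lam n) (flam n))); apply: oF; exists n => // m /= nm.
  by have := cross n m; have := ale _ _ nm; lra.
have mu0 : oc (E `&` [set x | pot mu x < 1]) = 0.
  apply: (@outer_cap_sub0 _ (\bigcup_k (E `&` [set x | pot mu x + (k.+1%:R^-1)%:E < 1]))).
    move=> x [Ex]; move/(@lt_bigcup_add _ (pot mu) (cst 1) (potential_ge0 mu)) => [k _ h].
    by exists k.
  apply: outer_cap_bigcup0 => k; set e : R := (k.+1%:R^-1)%R.
  have e0 : (0 < e)%R by rewrite invr_gt0.
  apply/eqP; rewrite eq_le outer_cap_ge0 andbT; apply/lee_addgt0Pr => d d0; rewrite add0e.
  have de0 : (0 < d * e)%R by exact: mulr_gt0.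
  (* The energy bounds and [cross_mu] give ||lam_n - mu||^2 <= 3 a_n, so (lam_n, nu) exceeds (mu,
     nu) by at most d e on the energy ball, and the set where G lam_n exceeds G mu by more than e
     has capacity at most d. *)
  have [n an] : exists n, (a n <= (d * e) ^+ 2 / 3)%R.
    by apply: near_a; rewrite divr_gt0// exprn_gt0.
  apply: (@le_trans _ _ (oc ([set x | pot mu x + e%:E < pot (lam n) x] `|`
      (E `&` [set x | pot (lam n) x < 1])))).
    apply: outer_cap_mono => x [Ex /= h].
    have [p1|p1] := ltP (pot (lam n) x) 1; [by right|left].
    exact: lt_le_trans p1.
  apply: le_trans (outer_capU0 _ (lamE n)) _.
  have -> : d = (d * e / e)%R by rewrite mulfK// gt_eqF.
  apply: (outer_cap_above_potential fmu (potential_class_G _) e0) => nu bnu.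
  have fnu := energy_ball_fe bnu.
  rewrite -[leLHS]/(en (lam n) nu) energyE// lee_fin; apply: ip_diff_le => //.
    by move/energy_ballP: bnu; rewrite energyE.
  by have := lama n; have := cross_mu n; lra.
exists mu; split => //; apply/eqP; rewrite eq_le mu_le/=; exact: gam_le.
Qed.

(* Off a set of small capacity the potential is a uniform limit of continuous functions. *)
Lemma potential_level_quasiclosed lam : fe lam -> quasiclosed G [set x | 1 <= pot lam x].
Proof.
move=> flam e e0; set B := [set x | _].
pose a n : R := (n.+1%:R^-1)%R; have a0 n : (0 < a n)%R by rewrite invr_gt0.
pose k n : R := (e / 2 / (2 ^ n.+1)%:R)%R.
have k0 n : (0 < k n)%R by rewrite !divr_gt0// ltr0n expn_gt0.
have /choice[phi phiP] n : exists phi : X -> R, [/\ cc_fun phi, forall x, (0 <= phi x)%R,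
    forall x, (phi x)%:E <= pot lam x &
    forall nu, energy_ball G nu -> (ip lam nu <= I nu phi + k n * a n)%R].
  by apply: ip_potential_approx => //; exact: mulr_gt0.
pose V n := [set x | (phi n x + a n)%:E < pot lam x].
have ocV n : oc (V n) <= (k n)%:E.
  rewrite -(mulfK (lt0r_neq0 (a0 n)) (k n)); have [ccphi phi0 _ phiH] := phiP n.
  apply: outer_cap_above_cc => //; first exact: potential_class_G.
  move=> nu bnu; have fnu := energy_ball_fe bnu.
  by rewrite -[leLHS]/(en lam nu) energyE// lee_fin; exact: phiH.
exists (\bigcup_n V n); split.
  apply: (@le_lt_trans _ _ (e / 2)%:E); last by rewrite lte_fin; lra.
  apply: le_trans (outer_cap_sigma_subadditive _) _.
  apply: le_trans (epsilon_trick0 xpredT (ltW _)); last by rewrite divr_gt0.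
  by apply: lee_nneseries => [n _ _|n _]; [exact: outer_cap_ge0|exact: ocV].
(* Points outside the subspace have their singleton as a neighbourhood, so semicontinuity is trivial
   there. *)
move=> x t /=; have [Vx|nVx] := pselect ((~` \bigcup_n V n) x); last first.
  move=> xt; exists [set x]; last by move=> y ->.
  suff : @nbhs_subspace X (~` \bigcup_n V n) x [set x] by [].
  by rewrite -nbhs_subspace_out// => y ->.
have [Bx|nBx] := pselect (B x).
  rewrite indicE mem_set// => t1; exists setT; first exact: filterT.
  move=> y _; apply: le_lt_trans t1; rewrite lee_fin indicE.
  by case: (_ \in _).
rewrite indicE memNset// => t0.
move/negP: nBx; rewrite -ltNge => px.
have [p pE] : exists p, pot lam x = p%:E.
  by exists (fine (pot lam x)); rewrite fineK// ge0_fin_numE// (lt_trans px (ltry _)).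
rewrite pE lte_fin in px.
(* Half of the gap 1 - p absorbs the error a_n, the other half the variation of phi_n near x. *)
have [n an] : exists n, (a n < (1 - p) / 2)%R.
  exists (Num.truncn ((1 - p) / 2)^-1); rewrite invf_plt ?posrE ?truncnS_gt//; lra.
have [[cphi _] _ phile _] := phiP n.
exists (~` (\bigcup_n V n) `&` (phi n @^-1` [set r | r < p + (1 - p) / 2]%R)).
  have : nbhs (x : X) (phi n @^-1` [set r | r < p + (1 - p) / 2]%R); last first.
    move=> h; suff : @nbhs_subspace X (~` \bigcup_n V n) x
        (~` (\bigcup_n V n) `&` (phi n @^-1` [set r | r < p + (1 - p) / 2]%R)) by [].
    by rewrite -nbhs_subspace_in// /within/=; apply: filterS h => y h Vy; split.
  apply: cphi; apply: open_nbhs_nbhs; split; first exact: open_lt.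
  have := phile x; rewrite pE lee_fin /=; lra.
move=> y [nVy /= py]; rewrite indicE memNset//= /B/=.
apply/negP; rewrite -ltNge; apply: (@le_lt_trans _ _ (phi n y + a n)%:E).
  by rewrite leNgt; apply/negP => h; apply: nVy; exists n.
by rewrite lte_fin; lra.
Qed.

Lemma exists_contraction_factor (c y : R) : (0 <= c)%R -> (c < y)%R ->
  exists t, [/\ 0 < t, t < 1 & c < y * t]%R.
Proof.
move=> c0 cy; have y0 : (0 < y)%R by exact: le_lt_trans cy.
exists ((c + y) / (2 * y))%R; split; first by rewrite divr_gt0//; lra.
  by rewrite ltr_pdivrMr; lra.
have -> : (y * ((c + y) / (2 * y)) = (c + y) / 2)%R by field; exact: lt0r_neq0.
by lra.
Qed.

(** For an l.s.c. majorant g and t slightly below 1, the set {g > t} is open, contains [E], and its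
    capacity exceeds that of g by at most the factor 1/t. *)
Lemma outer_cap_open_enlarge (E : set X) (y : R) : oc E < y%:E ->
  exists U, [/\ open U, E `<=` U & oc U < y%:E].
Proof.
move=> /outer_cap_lt[g [gG Eg gy]]; have g0 x : 0 <= g x by case: gG.
have c0 := cap_C0_ge0 g0.
have [c gE] : exists c, cap_C0 G g = c%:E.
  by exists (fine (cap_C0 G g)); rewrite fineK// ge0_fin_numE// (lt_trans gy (ltry _)).
rewrite gE lte_fin in gy; rewrite gE lee_fin in c0.
have [t [t0 t1 cty]] : exists t, [/\ 0 < t, t < 1 & c < y * t]%R.
  exact: exists_contraction_factor.
pose U := [set x | t%:E < g x].
have oU : open U by case: gG => _ /lower_semicontinuousP; exact.
have mU : measurable (U : set (borel X)) by exact: open_borel.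
exists U; split => //; first by move=> x /Eg; apply: lt_le_trans; rewrite lte_fin.
apply: (@le_lt_trans _ _ (t^-1 * c)%:E); last first.
  by rewrite lte_fin mulrC ltr_pdivrMr.
apply: (@le_trans _ _ (cap_C0 G (fun x => (\1_U x)%:E))).
  apply: outer_cap_le; first exact: open_indic_class_G.
  by move=> x Ux; rewrite indicE mem_set.
apply: cap_C0_le => nu bnu; rewrite integral_indic// setIT EFinM lee_pdivlMl//.
rewrite -gE; apply: le_trans (cap_C0_ub g bnu); rewrite -integral_cst//.
have mg : bmeas g by exact: class_G_borel.
apply: (@le_trans _ _ (\int[nu]_(x in U) g x)).
  apply: ge0_le_integral => //; [by move=> x _; rewrite lee_fin ltW|exact: measurable_funTS|].
  by move=> x /ltW.
by apply: ge0_subset_integral.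
Qed.

Lemma measure_le_outer_cap (B : set X) nu : energy_ball G nu ->
  measurable (B : set (borel X)) -> nu B <= oc B.
Proof.
move=> bnu mB; apply: outer_cap_ge => g gG Bg; apply: le_trans (cap_C0_ub g bnu).
have mg : bmeas g by exact: class_G_borel.
have g0 x : 0 <= g x by case: gG.
rewrite -[leLHS]mul1e -integral_cst//; apply: (@le_trans _ _ (\int[nu]_(x in B) g x)).
  by apply: ge0_le_integral => //; exact: measurable_funTS.
by apply: ge0_subset_integral.
Qed.

(** * Equilibrium on quasiclosed sets *)

(** Quasiclosedness makes Q \ U closed for an open U of small capacity; the potential supplies
    compactness. Off the support of a test function phi close to G lam, q.e. point of Q has G lam >=
    1 > phi + 1/2, which happens only on a set of small capacity. *)
Lemma quasiclosed_quasicompact (Q : set X) lam (e : R) : quasiclosed G Q -> fe lam ->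
  oc (Q `&` [set x | pot lam x < 1]) = 0 -> (0 < e)%R ->
  exists K, [/\ compact K, K `<=` Q & oc (Q `\` K) < e%:E].
Proof.
move=> qQ flam Q0 e0.
have e3 : (0 < e / 3)%R by rewrite divr_gt0.
have [V [ocV uV]] := qQ _ e3.
have [U [oU VU ocU]] := outer_cap_open_enlarge ocV.
have clF : closed (Q `\` U).
  rewrite -[_ `\` _]setCK; apply: open_closedC; rewrite openE => x nF.
  have [Ux|nUx] := pselect (U x).
    by apply: filterS (open_nbhs_nbhs (conj oU Ux)) => y Uy [].
  have nQx : ~ Q x by move=> Qx; apply: nF.
  have nVx : (~` V) x by move=> /VU.
  have := uV x 1%R; rewrite indicE memNset// => /(_ _)[|W].
    by rewrite lte_fin.
  rewrite -[nbhs _]/(@nbhs_subspace X (~` V) x) -nbhs_subspace_in// /within/= => xW WQ.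
  apply: filterS xW => y Wy [Qy nUy]; have nVy : (~` V) y by move=> /VU.
  by have := WQ y (Wy nVy); rewrite indicE mem_set// ltxx.
(* Chebyshev's inequality with the gap 1/2 doubles this to e/3. *)
have e6 : (0 < e / 6)%R by rewrite divr_gt0.
have [phi [ccphi phi0 phile phiH]] := ip_potential_approx flam e6.
have [cphi cK] := ccphi; set L := closure _ in cK.
exists ((Q `\` U) `&` L); split.
- by apply: (subclosed_compact _ cK) => [|x []//]; apply: closedI => //; exact: closed_closure.
- by move=> x [[]].
pose P := [set x | (phi x + 2^-1)%:E < pot lam x].
have ocP : oc P <= (e / 3)%:E.
  have -> : (e / 3 = (e / 6) / 2^-1)%R by rewrite invrK; lra.
  apply: outer_cap_above_cc => //; first exact: potential_class_G.
  move=> nu bnu; have fnu := energy_ball_fe bnu.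
  by rewrite -[leLHS]/(en lam nu) energyE// lee_fin; exact: phiH.
apply: (@le_lt_trans _ _ (oc ((U `|` P) `|` (Q `&` [set x | pot lam x < 1])))).
  apply: outer_cap_mono => x [Qx nK].
  have [p1|p1] := ltP (pot lam x) 1; [by right|left].
  have [Ux|nUx] := pselect (U x); [by left|right].
  have nLx : ~ L x by move=> Lx; apply: nK.
  have phix : phi x = 0%R.
    by apply: contrapT => /eqP h; apply: nLx; exact: subset_closure.
  by rewrite /P /= phix add0r; apply: lt_le_trans p1; rewrite lte_fin invf_lt1// ltr1n.
apply: le_lt_trans (outer_capU0 _ Q0) _; apply: le_lt_trans (outer_capU _ _) _.
apply: (@le_lt_trans _ _ ((e / 3)%:E + (e / 3)%:E)); first by apply: leeD => //; exact: ltW.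
by rewrite -EFinD lte_fin; lra.
Qed.

(** Complements of a compact exhaustion of ~K, inside a fixed compact set. Mass is found on the open
    [U n], while limits keep lower bounds only on compact sets, hence the interleaving of [U n] with
    the [L m]. *)
Lemma compact_inner_nbhs (K : set X) : compact K -> exists (O : set X) (L : nat -> set X),
  [/\ open O, K `<=` O, forall n, compact (L n),
   {homo L : m n / (m <= n)%N >-> n `<=` m} & \bigcap_n L n = K /\
   exists U : nat -> set X, forall n, [/\ open (U n), K `<=` U n &
      forall m, (m <= n)%N -> U n `<=` L m]].
Proof.
move=> cK; have clK := compact_closed X_hausdorff cK.
have [T [cT _ _ TL]] := open_exhaustion openT.
have [N KT] := TL K cK (@subsetT _ _).
have [E [cE ES EK EL]] := open_exhaustion (closed_openC clK).
have EH : {homo E : m n / (m <= n)%N >-> m `<=` n}.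
  move=> m n; elim: n => [|n IH]; first by rewrite leqn0 => /eqP ->.
  rewrite leq_eqVlt => /predU1P[->//|]; rewrite ltnS => /IH h.
  by apply: (subset_trans h); apply: subset_trans (ES n) (@interior_subset _ _).
exists (T N)°, (fun n => T N `\` (E n)°); split => //.
- exact: open_interior.
- move=> n; apply: (subclosed_compact _ (cT N)) => [|x []//].
  rewrite setDE; apply: closedI; first exact: compact_closed.
  by apply: open_closedC; exact: open_interior.
- by move=> m n mn x [Tx nEx]; split => // /(interiorS (EH _ _ mn)).
split.
  apply/seteqP; split => x.
    move=> h; apply: contrapT => nKx.
    have [n /(_ x erefl) En] := EL [set x] (@compact_set1 _ x) (fun y e => eq_ind_r (~` K) nKx e).
    by have [_] := h n Logic.I; apply.
  move=> Kx n _; split; first exact: interior_subset (KT _ Kx).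
  by move=> /interior_subset/EK.
exists (fun n => (T N)° `\` E n) => n; split.
- by rewrite setDE; apply: openI; [exact: open_interior|apply: closed_openC; exact: compact_closed].
- by move=> x Kx; split; [exact: KT|move=> /EK].
- move=> m mn x [Tx nEx]; split; first exact: interior_subset Tx.
  by move=> /interior_subset/(EH _ _ mn).
Qed.

(* Open neighbourhoods of K carry measures of the energy ball with mass close to c*(K);
   their limit charges every compact neighbourhood of K, hence K. *)
Lemma compact_capacity_max (K : set X) (k : R) : compact K -> oc K = k%:E ->
  exists2 nu, energy_ball G nu & k%:E <= nu K.
Proof.
move=> cK Kk.
have [W [L [oW KW cL LH [LK [U UP]]]]] := compact_inner_nbhs cK.
have mU n : measurable (U n : set (borel X)) by apply: open_borel; have [] := UP n.
have mL n : measurable (L n : set (borel X)) by exact: compact_borel.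
have /choice[nu nuP] n : exists nu, energy_ball G nu /\ (k - n.+1%:R^-1)%:E < nu (U n).
  have h : (k - n.+1%:R^-1)%:E < cap_C0 G (fun x => (\1_(U n) x)%:E).
    apply: (@lt_le_trans _ _ (oc K)); first by rewrite Kk lte_fin ltrBlDr ltrDl invr_gt0.
    have [oU KU _] := UP n; apply: outer_cap_le; first exact: open_indic_class_G.
    by move=> x /KU Ux; rewrite indicE mem_set.
  have [_ [mu bmu <-] h2] := ereal_sup_gt h; exists mu; split => //.
  by move: h2; rewrite integral_indic// setIT.
have bnu n : energy_ball G (nu n) by have [] := nuP n.
have [F [UF oF]] := free_ultrafilter; have PF : ProperFilter F by exact: ultra_proper.
have [nu' [bnu' [cvK _] _]] := energy_ball_ultralimit UF bnu.
exists nu' => //; rewrite -LK.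
have cv : nu' (L n) @[n --> \oo] --> nu' (\bigcap_n L n).
  apply: nonincreasing_cvg_mu => //.
  - exact: radon_compact_fin.
  - by apply: bigcap_measurable => //; exists 0%N.
  - by move=> m n /LH; rewrite subsetEset.
rewrite -(cvg_lim _ cv)//; apply: lime_ge; first by apply/cvg_ex; eexists; exact: cv.
apply: nearW => m; apply/lee_addgt0Pr => e e0; rewrite -leeBlDr// -EFinB.
apply: cvK => //; apply: oF; exists (maxn m (Num.truncn e^-1)) => // n /=.
rewrite geq_max => /andP[mn en].
have [_ /ltW h] := nuP n; apply: (@le_trans _ _ (nu n (U n))).
  apply: le_trans h; rewrite lee_fin lerD2l lerN2 invf_ple ?posrE//.
  by apply: le_trans (ltW (truncnS_gt _)) _; rewrite ler_nat.
by apply: le_measure; rewrite ?inE//; have [_ _] := UP n; apply.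
Qed.

Lemma qe_integral_ge (E B : set X) lam nu : fe lam -> fe nu ->
  oc (E `&` [set x | pot lam x < 1]) = 0 -> measurable (B : set (borel X)) -> B `<=` E ->
  nu B <= en lam nu.
Proof.
move=> flam fnu E0 mB BE.
have [N [mN N0 EN]] := outer_cap0_negligible E0 fnu.
have mBN : measurable (B `\` N : set (borel X)) by exact: measurableD.
have -> : nu B = nu (B `\` N).
  apply/eqP; rewrite eq_le; apply/andP; split; last first.
    by apply: le_measure; rewrite ?inE//; exact: subDsetl.
  apply: (@le_trans _ _ (nu ((B `\` N) `|` N))).
    apply: le_measure; rewrite ?inE//; first exact: measurableU.
    by move=> x Bx; have [Nx|Nx] := pselect (N x); [right|left].
  apply: le_trans (measureU2 nu mBN mN) _; rewrite -[leRHS]adde0.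
  by apply: leeD => //; rewrite -[leRHS]N0.
rewrite -[leLHS]mul1e -integral_cst//.
apply: (@le_trans _ _ (\int[nu]_(x in B `\` N) pot lam x)).
  apply: ge0_le_integral => //; first by apply: measurable_funTS; exact: potential_borel.
  move=> x [Bx nNx]; rewrite leNgt; apply/negP => h; apply: nNx; apply: EN.
  by split => //; exact: BE.
by apply: ge0_subset_integral => //; exact: potential_borel.
Qed.

Lemma radon_scaleE (c : {nonneg R}) mu B : radon_scale c mu B = c%:num%:E * mu B.
Proof. by []. Qed.

Lemma radon_restrE D (mD : measurable D) mu B : radon_restr mD mu B = mu (B `&` D).
Proof. by []. Qed.

(* Compact subsets C_k of Q with c*(Q \ C_k) -> 0 carry measures nu_k of the unit ball of
   mass close to gam. The limit of gam nu_k has energy at most gam^2 and mutual energy at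
   least gam^2 with lam, so it is lam. *)
Lemma quasiclosed_minimizer (Q : set X) (gam : R) lam : quasiclosed G Q ->
  oc Q = gam%:E -> fe lam -> (ip lam lam = gam ^+ 2)%R ->
  oc (Q `&` [set x | pot lam x < 1]) = 0 ->
  exists D : nat -> set X, [/\ forall k, compact (D k),
    {homo D : m n / (m <= n)%N >-> m `<=` n}, forall k, D k `<=` Q,
    lam (~` \bigcup_k D k) = 0 & lam [set: X] = (gam ^+ 2)%:E].
Proof.
move=> qQ Qgam flam lamgam Q0.
have gam0 : (0 <= gam)%R by rewrite -lee_fin -Qgam outer_cap_ge0.
pose a n : R := (n.+1%:R^-1)%R; have a0 n : (0 < a n)%R by rewrite invr_gt0.
have ale m n : (m <= n)%N -> (a n <= a m)%R.
  by move=> mn; rewrite lef_pV2 ?posrE// ler_nat.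
have near_a (e : R) : (0 < e)%R -> exists n, (a n <= e)%R.
  move=> e0; exists (Num.truncn e^-1); rewrite invf_ple ?posrE//.
  exact: ltW (truncnS_gt _).
(* The factor 2 covers the two losses in [muT]: the mass missing from [C n] and the mass outside
   [C j]. *)
have near_ga (e : R) : (0 < e)%R -> exists n, (2 * (gam * a n) <= e)%R.
  move=> e0; have g1 : (0 < 2 * (gam + 1))%R by rewrite mulr_gt0// ltr_wpDl.
  have [n an] := near_a _ (divr_gt0 e0 g1); exists n; move: an.
  rewrite ler_pdivlMr// => an; have := a0 n; nra.
have /choice[C CP] n : exists C, [/\ compact C, C `<=` Q & oc (Q `\` C) < (a n)%:E].
  exact: (quasiclosed_quasicompact qQ flam Q0).
have cC n : compact (C n) by have [] := CP n.
have CQ n : C n `<=` Q by have [] := CP n.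
have mC n : measurable (C n : set (borel X)) by exact: compact_borel.
have mC' n : measurable (~` C n : set (borel X)) by exact: measurableC.
have /choice[nu nuP] n : exists nu, [/\ energy_ball G nu, nu (~` C n) = 0 &
    (gam - a n)%:E <= nu (C n)].
  have [k Ck] : exists k, oc (C n) = k%:E.
    exists (fine (oc (C n))); rewrite fineK// ge0_fin_numE ?outer_cap_ge0//.
    by apply: le_lt_trans (outer_cap_mono (CQ n)) _; rewrite Qgam ltry.
  have [nu bnu kn] := compact_capacity_max (cC n) Ck.
  exists (radon_restr (mC n) nu); split; first exact: energy_ball_restr.
    by rewrite radon_restrE setICl measure0.
  rewrite radon_restrE setIid; apply: le_trans kn; rewrite lee_fin lerBlDr -lee_fin.
  rewrite -Qgam EFinD -Ck; apply: (@le_trans _ _ (oc (C n `|` (Q `\` C n)))).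
    by apply: outer_cap_mono => x Qx; have [Cx|Cx] := pselect (C n x); [left|right].
  apply: le_trans (outer_capU _ _) _; apply: leeD => //; apply: ltW.
  by have [] := CP n.
have bnu n : energy_ball G (nu n) by have [] := nuP n.
have fnu n : fe (nu n) by exact: energy_ball_fe.
pose lams n := radon_scale (NngNum gam0) (nu n).
have flams n : fe (lams n) by exact: feZ.
have lams_le n : (ip (lams n) (lams n) <= gam ^+ 2)%R.
  rewrite ipZr// ipZl//= mulrA -expr2 ler_piMr ?sqr_ge0//.
  by move/energy_ballP: (bnu n); rewrite energyE.
have lamsC n : (gam * (gam - a n))%:E <= lams n (C n).
  rewrite radon_scaleE EFinM/=; apply: lee_wpmul2l; first by rewrite lee_fin.
  by have [] := nuP n.
(* Uniform in n: [nu n] lives on a subset of [Q], and its mass on Q \ C_j is at most the capacity of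
   that set. This prevents mass from escaping in the limit. *)
have lams_out n j : lams n (~` C j) <= (gam * a j)%:E.
  rewrite radon_scaleE EFinM/=; apply: lee_wpmul2l; first by rewrite lee_fin.
  apply: (@le_trans _ _ (nu n ((C n `\` C j) `|` ~` C n))).
    apply: le_measure; rewrite ?inE//.
      by apply: measurableU => //; exact: measurableD.
    by move=> x nCx; have [Cx|Cx] := pselect (C n x); [left|right].
  have mD : measurable (C n `\` C j : set (borel X)) by exact: measurableD.
  apply: le_trans (measureU2 (nu n) mD (mC' n)) _; rewrite -[leRHS]adde0.
  apply: leeD; last by have [_ h _] := nuP n; rewrite -[leRHS]h.
  apply: le_trans (measure_le_outer_cap (bnu n) mD) _.
  apply: le_trans (outer_cap_mono _) _; last by have [_ _ /ltW] := CP j; exact.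
  by move=> x [/CQ Qx Cx].
have [F [UF oF]] := free_ultrafilter; have PF : ProperFilter F by exact: ultra_proper.
have [mu [fmu [cvK cvO] cvip ipmu]] := energy_ultralimit UF flams lams_le.
have mu_le : (ip mu mu <= gam ^+ 2)%R by apply: ipmu; exact: nearW.
have lam_mu : (gam ^+ 2 <= ip lam mu)%R.
  apply/ler_addgt0Pr => e /near_ga[m me]; rewrite -lerBlDr.
  apply: (cvgr_to_ge (cvip lam flam)); apply: oF; exists m => // n /= mn.
  have : (gam * (gam - a n) <= ip lam (lams n))%R.
    rewrite -lee_fin -energyE//; apply: (le_trans (lamsC n)).
    exact: (qe_integral_ge flam (flams n) Q0 (mC n) (CQ n)).
  have := ale _ _ mn; have := a0 n; move: (ip _ _) => z; nra.
have lam_eq : radon_eq lam mu.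
  by apply: ip_eq_radon => //; rewrite lamgam; lra.
have mu_out j : mu (~` C j) <= (gam * a j)%:E.
  apply: cvO; last by apply: nearW => n; exact: lams_out.
  by apply: closed_openC; exact: compact_closed.
have muT : (gam ^+ 2)%:E <= mu [set: X].
  apply/lee_addgt0Pr => e /near_ga[j je]; rewrite -leeBlDr// -EFinB.
  apply: (@le_trans _ _ (mu (C j))); last by apply: le_measure; rewrite ?inE.
  apply: cvK => //; apply: oF; exists j => // n /= jn.
  have h : lams n (C n) <= lams n (C j) + lams n (~` C j).
    apply: le_trans (measureU2 (lams n) (mC j) (mC' j)); rewrite setUv.
    by apply: le_measure; rewrite ?inE.
  have {h} := le_trans (lamsC n) (le_trans h (leeD2l _ (lams_out n j))).
  rewrite -leeBlDr// -EFinB; apply: le_trans; rewrite lee_fin.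
  by have := ale _ _ jn; have := a0 n; nra.
have mD : measurable (\bigcup_n C n : set (borel X)) by exact: bigcup_measurable.
have mD' : measurable (~` \bigcup_n C n : set (borel X)) by exact: measurableC.
have D0 : mu (~` \bigcup_n C n) = 0.
  apply/eqP; rewrite eq_le measure_ge0 andbT; apply/lee_addgt0Pr => e /near_ga[j je].
  rewrite add0e; apply: (@le_trans _ _ (mu (~` C j))).
    apply: le_measure; rewrite ?inE//.
    by apply: subsetC => x Cx; exists j.
  apply: (le_trans (mu_out j)); rewrite lee_fin.
  by have : (0 <= gam * a j)%R; [exact: mulr_ge0 gam0 (ltW (a0 j))|lra].
exists (fun k => \bigcup_(i in [set i | (i <= k)%N]) C i).
have DE : \bigcup_k \bigcup_(i in [set i | (i <= k)%N]) C i = \bigcup_n C n.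
  apply/seteqP; split => x; first by move=> [k _ [i _ Ci]]; exists i.
  by move=> [i _ Ci]; exists i => //; exists i => /=.
split => //.
- move=> k; elim: k => [|k IH].
    rewrite (_ : [set i | _] = [set 0%N]) ?bigcup_set1//.
    by apply/seteqP; split => i /=; rewrite leqn0 => /eqP.
  rewrite (_ : [set i | _] = [set i | (i <= k)%N] `|` [set k.+1]).
    by rewrite bigcup_setU bigcup_set1; exact: compactU.
  apply/seteqP; split => i /=.
    by rewrite leq_eqVlt => /predU1P[->|]; [right|left].
  by case=> [/leqW|->].
- by move=> m n mn x [i /= im Ci]; exists i => //=; exact: leq_trans mn.
- by move=> k x [i _ /CQ].
- by rewrite DE lam_eq.
(* Conversely, mu is concentrated on the union of the [C n], where G lam >= 1 q.e., so mu(X) <=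
   (lam, mu) <= gam^2. *)
rewrite lam_eq//; apply/eqP; rewrite eq_le muT andbT.
rewrite -(setUv (\bigcup_n C n)); apply: le_trans (measureU2 mu mD mD') _.
rewrite -[leRHS]adde0; apply: leeD; last by rewrite -[leRHS]D0.
apply: le_trans (qe_integral_ge flam fmu Q0 mD _) _; first by move=> x [i _ /CQ].
by rewrite energyE// lee_fin; have := ip_AMGM flam fmu; rewrite lamgam; lra.
Qed.

(** * Inner and outer capacity of quasiclosed sets *)

Lemma class_G_add_cc (g : X -> \bar R) (phi : X -> R) : class_G g -> continuous phi ->
  (forall x, (0 <= phi x)%R) -> class_G (fun x => g x + (phi x)%:E).
Proof.
move=> gG cphi phi0; have [g0 _] := gG; split.
  by move=> x; rewrite adde_ge0 ?lee_fin//; exact: g0.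
apply/lower_semicontinuousP => a.
rewrite (_ : [set x | _] = [set x | (- phi x + a)%:E < g x]).
  by apply: open_above_cc => // x; apply: cvgN; exact: cphi.
apply/seteqP; split => x /=; have := g0 x; case: (g x) => [r| |]// _;
  rewrite -?EFinD ?lte_fin ?ltry//=; lra.
Qed.

(* Compactness of the support of h lets h be dominated by a continuous function below
   g + e chi, with chi = 1 on the support. *)
Lemma cap_H0_le_cap_C0 (h g : X -> \bar R) : class_H0 h -> class_G g ->
  (forall x, h x <= g x) -> cap_H0 G h <= cap_C0 G g.
Proof.
move=> [h0 hfin husc ch] gG hg; have g0 x : 0 <= g x by case: gG.
set K := closure _ in ch.
have [chi [cchi chi01 chiK [L cL [_ chiL]]]] := compact_urysohn ch openT (@subsetT _ _).
have mL : measurable (L : set (borel X)) by exact: compact_borel.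
have chi0 x : (0 <= chi x)%R by have /andP[] := chi01 x.
have [C HC] := energy_compact_bound 1 cL.
have C0 : (0 <= C)%R.
  rewrite -lee_fin; apply: le_trans (HC radon0 _) => //.
  exact/energy_ballP/energy_ball0.
apply/lee_addgt0Pr => d d0.
(* All measures of the energy ball give [L] mass at most C, so the added term e chi has integral at
   most e C <= d. *)
have [e e0 eC] : exists2 e, (0 < e)%R & (e * C <= d)%R.
  exists (d / (C + 1))%R; first by rewrite divr_gt0// ltr_wpDl.
  by rewrite mulrAC ler_pdivrMr ?ltr_wpDl// ler_pM2l// lerDl.
have echi0 x : (0 <= e * chi x)%R by rewrite mulr_ge0// ltW.
have cechi : continuous (fun x => e * chi x)%R.
  by move=> x; apply: cvgM; [exact: cvg_cst|exact: cchi].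
have g'G := class_G_add_cc gG cechi echi0.
have [phi [ccphi phi0 phile phih phia]] := lsc_approx g'G.
have [n Kn] : exists n, K `<=` [set x | h x < (phi n x)%:E].
  apply: compact_sub_increasing_open => //.
  - move=> n; rewrite openE => x /= hx.
    have [p hp] : exists p, h x = p%:E.
      by exists (fine (h x)); rewrite fineK// ge0_fin_numE// hfin.
    rewrite hp lte_fin in hx; pose r := ((p + phi n x) / 2)%R.
    have [V xV HV] : exists2 V, nbhs x V & forall y, V y -> h y < r%:E.
      by apply: husc; rewrite hp lte_fin /r; lra.
    have : nbhs x (phi n @^-1` [set t | r < t]%R).
      apply: (ccphi n).1; apply: open_nbhs_nbhs; split; first exact: open_gt.
      by rewrite /r /=; lra.
    apply: filterS2 xV => y Vy /= ry; apply: lt_trans (HV y Vy) _.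
    by rewrite lte_fin.
  - move=> m n mn x /= hx; apply: (lt_le_trans hx); rewrite lee_fin; exact: phih.
  - move=> x Kx; have [p hp] : exists p, h x = p%:E.
      by exists (fine (h x)); rewrite fineK// ge0_fin_numE// hfin.
    have [|n pn] := phia x p; last by exists n => //=; rewrite hp lte_fin.
    rewrite chiK// mulr1; apply: (@lt_le_trans _ _ (p + e)%:E).
      by rewrite lte_fin ltrDl.
    by rewrite EFinD -hp; apply: leeD.
apply: (@le_trans _ _ (cap_C0 G (EFin \o phi n))).
  apply: ereal_inf_lbound; exists (EFin \o phi n) => //; split; first exact: cc_class_C0.
  move=> x /=; have [Kx|nKx] := pselect (K x); first exact: ltW (Kn x Kx).
  rewrite (_ : h x = 0) ?lee_fin//; apply: contrapT => /eqP hx.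
  by apply: nKx; exact: subset_closure.
apply: cap_C0_le => nu bnu; have mg : bmeas g by exact: class_G_borel.
have mechi : bmeas (EFin \o (fun x => e * chi x)%R) by exact: continuous_borel.
apply: (@le_trans _ _ (\int[nu]_x (g x + (e * chi x)%:E))).
  apply: ge0_le_integral => //.
  - by move=> x _; rewrite lee_fin.
  - by apply: continuous_borel; exact: (ccphi n).1.
  - exact: class_G_borel.
  - by move=> x _; exact: phile.
rewrite ge0_integralD//; last by move=> x _; rewrite lee_fin.
apply: leeD; first exact: cap_C0_ub.
apply: (@le_trans _ _ (\int[nu]_(x in L) e%:E)).
  rewrite [leRHS]integral_mkcond; apply: ge0_le_integral => //.
  - by move=> x _; rewrite lee_fin.
  - by apply/(measurable_restrict _ _ _) => //; exact: measurable_cst.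
  - move=> x _; rewrite patchE; case: ifPn => xL.
      by rewrite lee_fin ler_piMr ?(ltW e0)//; have /andP[] := chi01 x.
    rewrite lee_fin (_ : chi x = 0%R) ?mulr0//; apply: contrapT => /eqP/chiL Lx.
    by move/negP: xL; apply; rewrite inE.
rewrite integral_cst//; apply: (@le_trans _ _ (e%:E * C%:E)).
  by apply: lee_wpmul2l; [rewrite lee_fin ltW|apply: HC; exact/energy_ballP].
by rewrite -EFinM lee_fin.
Qed.

Lemma inner_cap_le_outer_cap (E : set X) : inner_cap G E <= oc E.
Proof.
apply: ub_ereal_sup => _ [h [hH hE] <-]; apply: outer_cap_ge => g gG Eg.
apply: cap_H0_le_cap_C0 => // x; apply: (le_trans (hE x)); rewrite indicE.
have [/set_mem/Eg//|_] := boolP (x \in E); by case: gG.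
Qed.

Lemma outer_cap_compact_le_inner_cap (K E : set X) : compact K -> K `<=` E ->
  oc K <= inner_cap G E.
Proof.
move=> cK KE; have clK := compact_closed X_hausdorff cK.
have K01 (x : X) : (0 <= \1_K x :> R)%R by rewrite indicE ler0n.
have HK : class_H0 (fun x => (\1_K x)%:E : \bar R).
  split; [by move=> x /=; rewrite lee_fin|by move=> x /=; rewrite ltry| |].
    move=> x a; have [Kx|nKx] := pselect (K x).
      move=> xa; exists setT; first exact: filterT.
      move=> y _; apply: le_lt_trans xa; rewrite !indicE (mem_set Kx) lee_fin.
      by case: (y \in K).
    rewrite indicE memNset// => a0; exists (~` K); last first.
      by move=> y Ky; rewrite indicE memNset.
    by apply: open_nbhs_nbhs; split => //; exact: closed_openC.
  rewrite (_ : [set x | _] = K); first by rewrite -(closure_id K).1.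
  apply/seteqP; split => x /=; rewrite indicE; last by move=> Kx; rewrite mem_set// eqe oner_eq0.
  by case: (boolP (x \in K)) => [/set_mem//|]; rewrite eqxx.
apply: (@le_trans _ _ (cap_H0 G (fun x => (\1_K x)%:E))).
  apply: le_ereal_inf_tmp => _ [phi [[phiG _] phiK] <-]; apply: outer_cap_le => // x Kx.
  by have := phiK x; rewrite indicE mem_set.
apply: ereal_sup_ubound; exists (fun x => (\1_K x)%:E) => //; split => // x.
rewrite !indicE lee_fin; case: (boolP (x \in K)) => [/set_mem/KE Ex|_]; last by rewrite ler0n.
by rewrite mem_set.
Qed.

Lemma quasiclosed_has_capacity (Q : set X) (gam : R) lam : quasiclosed G Q ->
  oc Q = gam%:E -> fe lam -> oc (Q `&` [set x | pot lam x < 1]) = 0 ->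
  has_capacity G Q gam%:E.
Proof.
move=> qQ Qgam flam Q0; split => //; apply/eqP; rewrite eq_le.
rewrite -Qgam inner_cap_le_outer_cap/=; apply/lee_addgt0Pr => e e0.
have [K [cK KQ QK]] := quasiclosed_quasicompact qQ flam Q0 e0.
apply: (@le_trans _ _ (oc (K `|` (Q `\` K)))).
  by apply: outer_cap_mono => x Qx; have [Kx|Kx] := pselect (K x); [left|right].
apply: le_trans (outer_capU _ _) _; apply: leeD; last exact: ltW.
exact: outer_cap_compact_le_inner_cap.
Qed.

(** * The maximum principle and equilibrium measures *)

Lemma measure_support_compact (mu : radon R X) (K : set X) : compact K -> mu (~` K) = 0 ->
  compact (measure_support mu).
Proof.
move=> cK mK; apply: (subclosed_compact _ cK).
  rewrite -[measure_support _]setCK; apply: open_closedC; rewrite openE => x.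
  move=> /existsNP[U /not_implyP[oU /not_implyP[Ux mU]]].
  apply: filterS (open_nbhs_nbhs (conj oU Ux)) => y Uy.
  by move=> /(_ U oU Uy).
move=> x /(_ (~` K) (closed_openC (compact_closed X_hausdorff cK))) h.
by apply: contrapT => nKx; have := h nKx; rewrite -mK ltxx.
Qed.

Lemma le_energy_restr (E B : set X) lam : fe lam ->
  measurable (E : set (borel X)) -> measurable (B : set (borel X)) ->
  oc (E `&` [set x | pot lam x < 1]) = 0 -> lam (~` E) = 0 ->
  lam B <= \int[lam]_(x in B) pot lam x.
Proof.
move=> flam mE mB E0 lamE; have mE' : measurable (~` E : set (borel X)) by exact: measurableC.
have mEB : measurable (E `&` B : set (borel X)) by exact: measurableI.
rewrite -(energy_restr _ mB).
apply: le_trans (qe_integral_ge flam (fe_restr mB flam) E0 mE _) => //.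
rewrite radon_restrE; apply: (@le_trans _ _ (lam ((E `&` B) `|` ~` E))).
  apply: le_measure; rewrite ?inE//; first exact: measurableU.
  by move=> x Bx; have [Ex|Ex] := pselect (E x); [left|right].
apply: le_trans (measureU2 lam mEB mE') _; rewrite -[leRHS]adde0.
by apply: leeD => //; rewrite -[leRHS]lamE.
Qed.

(** G lam >= 1 holds lam-a.e. while its integral is at most lam(X). An excess of a on a set of mass
    p adds at least a p to the integral, so p = 0. *)
Lemma potential_gt1_null (E : set X) lam : fe lam -> measurable (E : set (borel X)) ->
  oc (E `&` [set x | pot lam x < 1]) = 0 -> lam (~` E) = 0 ->
  en lam lam <= lam [set: X] ->
  (radon_measure lam).-negligible ([set x | 1 < pot lam x] : set (borel X)).
Proof.
move=> flam mE E0 lamE enT.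
have mass B (mB : measurable (B : set (borel X))) := le_energy_restr flam mE mB E0 lamE.
pose N k := [set x | 1 + (k.+1%:R^-1)%:E < pot lam x].
suff N0 k : (radon_measure lam).-negligible (N k : set (borel X)).
  apply: negligibleS (negligible_bigcup N0) => x; apply: lt_bigcup_add => _.
  exact: lee01.
have oN : open (N k).
  have /lower_semicontinuousP/(_ (1 + k.+1%:R^-1)%R) := @potential_lsc lam.
  by rewrite EFinD.
have mN : measurable (N k : set (borel X)) by exact: open_borel.
have mN' : measurable (~` N k : set (borel X)) by exact: measurableC.
apply/negligibleP => //; set a : R := (k.+1%:R^-1)%R.
have a0 : (0 < a)%R by rewrite invr_gt0.
have Tfin : lam [set: X] < +oo.
  apply: le_lt_trans flam; apply: le_trans (mass setT _) _ => //; exact: measurableT.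
have fin B : measurable (B : set (borel X)) -> exists p, lam B = p%:E.
  move=> mB; exists (fine (lam B)); rewrite fineK// ge0_fin_numE//.
  by apply: le_lt_trans Tfin; apply: le_measure; rewrite ?inE.
have [p pE] := fin _ mN; have [q qE] := fin _ mN'.
have TE : lam [set: X] = (p + q)%:E.
  rewrite EFinD -pE -qE -(setUv (N k)); apply: measureU => //.
  exact: setICr.
have h1 : ((1 + a) * p)%:E <= \int[lam]_(x in N k) pot lam x.
  rewrite EFinM -pE -integral_cst//; apply: ge0_le_integral => //.
  - by move=> x _; rewrite lee_fin addr_ge0// ltW.
  - by apply: measurable_funTS; exact: potential_borel.
  - by move=> x Nx; rewrite ltW.
have h2 : q%:E <= \int[lam]_(x in ~` N k) pot lam x by rewrite -qE; exact: mass.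
have : ((1 + a) * p + q)%:E <= (p + q)%:E.
  rewrite -TE EFinD; apply: le_trans enT; apply: le_trans (leeD h1 h2) _.
  rewrite /mutual_energy -(setUv (N k)) ge0_integral_setU//.
  - by rewrite setUv; exact: potential_borel.
  - exact/disj_setPCl.
have p0 : (0 <= p)%R by rewrite -lee_fin -pE measure_ge0.
rewrite lee_fin => h; have {h} : (a * p <= 0)%R by lra.
rewrite pmulr_rle0// => h; rewrite [LHS]pE; congr EFin.
by apply/eqP; rewrite eq_le h p0.
Qed.

(* G lam = 1 holds lam-a.e. because \int G lam dlam = lam(X) and G lam >= 1 lam-a.e. The
   maximum principle requires a compact support, so it is applied to the restrictions
   of lam to the sets D k. *)
Lemma potential_le1 (D : nat -> set X) lam : maximum_principle G -> fe lam ->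
  (forall k, compact (D k)) -> {homo D : m n / (m <= n)%N >-> m `<=` n} ->
  oc ((\bigcup_k D k) `&` [set x | pot lam x < 1]) = 0 -> lam (~` \bigcup_k D k) = 0 ->
  en lam lam <= lam [set: X] -> forall x, pot lam x <= 1.
Proof.
move=> G_max flam cD homoD D0 lamD enT.
have mD k : measurable (D k : set (borel X)) by exact: compact_borel.
have mUD : measurable (\bigcup_k D k : set (borel X)) by exact: bigcup_measurable.
have [N [mN N0 NP]] := potential_gt1_null flam mUD D0 lamD enT.
have pot_le k x : pot (radon_restr (mD k) lam) x <= pot lam x.
  rewrite /potential integral_radon_restr//.
  by apply: ge0_subset_integral => //; exact: kernel_borel.
have pot1 k x : pot (radon_restr (mD k) lam) x <= 1.
  apply: G_max => {x}.
    apply: (measure_support_compact (cD k)).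
    by rewrite radon_restrE setICl measure0.
  exists N; split => //.
    apply/eqP; rewrite eq_le measure_ge0 andbT -[leRHS]N0 radon_restrE.
    by apply: le_measure; rewrite ?inE//; exact: measurableI.
  move=> x /= /negP; rewrite -ltNge => h; apply: NP; exact: lt_le_trans (pot_le k x).
(* [lam] lives on the union of the [D k], so the bound for the restrictions passes to [lam] by
   monotone convergence. *)
move=> x; have -> : pot lam x = \int[lam]_(y in \bigcup_k D k) G (x, y).
  rewrite integral_mkcond; apply: ae_eq_integral => //.
    by apply/(measurable_restrict _ _ _) => //; apply: measurable_funTS; exact: kernel_borel.
  exists (~` \bigcup_k D k); split => //; first exact: measurableC.
  move=> y /= h Dy; apply: h => _; rewrite patchE mem_set//.
have cv : \int[lam]_(y in D k) G (x, y) @[k --> \oo] --> \int[lam]_(y in \bigcup_k D k) G (x, y).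
  apply: ge0_nondecreasing_set_cvg_integral => //.
  - by move=> m n /homoD; rewrite subsetEset.
  - by move=> k; apply: measurable_funTS; exact: kernel_borel.
rewrite -(cvg_lim _ cv)//; apply: lime_le; first by apply/cvg_ex; eexists; exact: cv.
apply: nearW => k; have := pot1 k x; rewrite /potential integral_radon_restr//.
Qed.

Lemma carried_by_negligible (Q : set X) (nu : radon R X) : carried_by Q nu ->
  (radon_measure nu).-negligible (~` Q : set (borel X)).
Proof.
move=> cQ; have [K [cK _ _ KS]] := open_exhaustion openT.
apply: negligibleS (negligible_bigcup (fun k => cQ (K k) (cK k))) => x nQx.
have [k xk] := KS [set x] (@compact_set1 _ x) (@subsetT _ _).
by exists k => //; split => //; apply: interior_subset; exact: xk.
Qed.

(** Sets of zero outer capacity are nu-null, so G lam = 1 nu-a.e. This turns the linear term of the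
    Gauss functional into a mutual energy. *)
Lemma qe_one_total_mass (Q : set X) lam nu : finite_energy_on G Q nu ->
  quasi_everywhere_on G Q (fun x => pot lam x = 1) -> nu [set: X] = en lam nu.
Proof.
move=> [/feP fnu /carried_by_negligible nuQ] [E [EQ E0 HE]].
rewrite -[LHS]mul1e -integral_cst//.
rewrite /mutual_energy; apply: ae_eq_integral => //.
apply: negligibleS (negligibleU nuQ (outer_cap0_negligible E0 fnu)) => x /= h.
have [Qx|nQx] := pselect (Q x); [right|by left].
by apply: contrapT => nEx; apply: h => _; rewrite HE.
Qed.

Lemma potential_radon_eq mu nu x : radon_eq mu nu -> pot mu x = pot nu x.
Proof. exact: radon_eq_integral. Qed.

Lemma qe_level_outer_cap0 (E : set X) lam :
  quasi_everywhere_on G E (fun x => 1 <= pot lam x) ->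
  oc (E `&` [set x | pot lam x < 1]) = 0.
Proof.
move=> [N [NE N0 HN]]; apply: outer_cap_sub0 N0 => x [Ex /=]; rewrite ltNge => /negP h.
by apply: contrapT => nNx; apply: h; apply: HN.
Qed.

Lemma quasi_everywhere_level (E : set X) lam :
  oc (E `&` [set x | pot lam x < 1]) = 0 ->
  quasi_everywhere_on G E (fun x => 1 <= pot lam x).
Proof.
move=> E0; exists (E `&` [set x | pot lam x < 1]); split => //.
by move=> x [Ex h]; rewrite leNgt; apply/negP => h'; apply: h.
Qed.

(** Completing the square: the Gauss functional of nu is ||lam||^2 - ||lam - nu||^2. If G nu = 1
    q.e. as well, the two total masses give ||nu||^2 = (lam, nu) = ||lam||^2, and strict
    definiteness identifies the measures. *)
Lemma qe_one_equilibrium (Q : set X) lam : finite_energy_on G Q lam ->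
  quasi_everywhere_on G Q (fun x => pot lam x = 1) ->
  is_equilibrium_measure G Q lam /\
  forall nu, finite_energy_on G Q nu -> (radon_eq nu lam <->
    quasi_everywhere_on G Q (fun x => pot nu x = 1)).
Proof.
move=> Qlam lam1; have flam : fe lam by apply/feP; case: Qlam.
have gaussE nu : finite_energy_on G Q nu ->
    gauss_functional G nu = (2 * ip lam nu - ip nu nu)%:E.
  move=> Qnu; have fnu : fe nu by apply/feP; case: Qnu.
  by rewrite /gauss_functional energy_norm_sqr (qe_one_total_mass Qnu lam1) !energyE// -EFinM.
split; first split; first split => //.
- move=> nu Qnu; have fnu : fe nu by apply/feP; case: Qnu.
  by rewrite !gaussE// lee_fin; have := ip_AMGM flam fnu; lra.
- move=> nu [Qnu /(_ lam Qlam)]; have fnu : fe nu by apply/feP; case: Qnu.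
  rewrite !gaussE// lee_fin => h; apply: ip_eq_radon => //.
  by rewrite (ipC nu lam); lra.
- move=> nu Qnu; have fnu : fe nu by apply/feP; case: Qnu.
  split=> [nulam|nu1].
    have [E [EQ E0 HE]] := lam1; exists E; split => // x QEx.
    by rewrite (potential_radon_eq x nulam) HE.
  have h1 : ip nu nu = ip lam nu.
    apply: EFin_inj; rewrite -!energyE//.
    by rewrite -(qe_one_total_mass Qnu nu1) (qe_one_total_mass Qnu lam1).
  have h2 : ip lam lam = ip nu lam.
    apply: EFin_inj; rewrite -!energyE//.
    by rewrite -(qe_one_total_mass Qlam nu1) (qe_one_total_mass Qlam lam1).
  by apply: ip_eq_radon => //; rewrite h1 h2 (ipC nu lam); lra.
Qed.

Lemma quasiclosed_equilibrium (Q : set X) (gam : R) lam : maximum_principle G ->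
  quasiclosed G Q -> oc Q = gam%:E -> fe lam -> (ip lam lam = gam ^+ 2)%R ->
  oc (Q `&` [set x | pot lam x < 1]) = 0 ->
  [/\ carried_by Q lam, lam [set: X] = (gam ^+ 2)%:E & forall x, pot lam x <= 1].
Proof.
move=> G_max qQ Qgam flam lamgam Q0.
have [D [cD homoD DQ lamD lamT]] := quasiclosed_minimizer qQ Qgam flam lamgam Q0.
have UDQ : \bigcup_k D k `<=` Q by move=> x [k _ /DQ].
split => //.
  move=> K cK; exists (~` \bigcup_k D k); split => //.
    by apply: measurableC; apply: bigcup_measurable => k _; exact: compact_borel.
  by move=> x [_ nQx] /UDQ.
apply: (potential_le1 G_max flam cD homoD _ lamD); last by rewrite lamT energyE// lamgam.
by apply: outer_cap_sub0 Q0; exact: setSI.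
Qed.

(** The capacity of [Q] is at most ||lam|| = gam since [lam] is admissible for [Q] too, and at least
    gam since [A] lies in [Q] up to capacity zero. *)
Lemma quasiclosure_outer_cap (A Q : set X) (gam : R) lam : is_quasiclosure G A Q ->
  oc A = gam%:E -> fe lam -> (ip lam lam = gam ^+ 2)%R ->
  oc (A `&` [set x | pot lam x < 1]) = 0 ->
  oc (Q `&` [set x | pot lam x < 1]) = 0 /\ oc Q = gam%:E.
Proof.
move=> [qQ QA minQ] Agam flam lamgam A0.
have levelE E : E `\` [set x | 1 <= pot lam x] = E `&` [set x | pot lam x < 1].
  rewrite setDE; congr (_ `&` _); apply/seteqP.
  by split => x /=; [move/negP; rewrite -ltNge|rewrite ltNge => /negP].
have Q0 : oc (Q `&` [set x | pot lam x < 1]) = 0.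
  rewrite -levelE; apply: minQ; first exact: potential_level_quasiclosed.
  by rewrite /quasicontains levelE.
split => //; apply/eqP; rewrite eq_le; apply/andP; split.
  have gam0 : (0 <= gam)%R by rewrite -lee_fin -Agam outer_cap_ge0.
  by have := outer_cap_le_norm flam Q0; rewrite lamgam sqrtr_sqr ger0_norm.
rewrite -Agam; apply: le_trans (outer_capU0 Q QA).
by apply: outer_cap_mono => x Ax; have [Qx|nQx] := pselect (Q x); [left|right].
Qed.

Lemma energy_normE mu : fe mu -> energy_norm G mu = (Num.sqrt (ip mu mu))%:E.
Proof. by move=> fmu; rewrite /energy_norm energyE. Qed.

End kernel.
End potential_theory.

Theorem corollary4p17 (R : realType) (X : ptopologicalType)
  (X_hausdorff : hausdorff_space X) (X_lc : locally_compact [set: X])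
  (X_sc : @second_countable X)
  (G : X * X -> \bar R) (G_kernel : kernel_on G) (G_perfect : perfect G)
  (G_max : maximum_principle G)
  (A Astar : set X) (A_fin : outer_cap G A < +oo)
  (A_qcl : is_quasiclosure G A Astar) :
  has_capacity G Astar (outer_cap G A) /\
  exists mu : radon R X,
    [/\ is_equilibrium_measure G Astar mu,
        carried_by Astar mu &
        (forall nu : radon R X, finite_energy_on G Astar nu ->
          (radon_eq nu mu <->
           quasi_everywhere_on G Astar (fun x => potential G nu x = 1)))] /\
    [/\ quasi_everywhere_on G Astar (fun x => potential G mu x = 1),
        quasi_everywhere_on G A (fun x => potential G mu x = 1),
        (forall x, potential G mu x <= 1),
        mu [set: X] = energy_norm G mu ^+ 2 /\
        energy_norm G mu ^+ 2 = outer_cap G A ^+ 2 &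
        (exists2 lam : radon R X,
           finite_energy G lam /\
             quasi_everywhere_on G A (fun x => 1 <= potential G lam x) &
           energy_norm G lam = outer_cap G A) /\
        (forall lam : radon R X, finite_energy G lam ->
           quasi_everywhere_on G A (fun x => 1 <= potential G lam x) ->
           outer_cap G A <= energy_norm G lam)].
Proof.
have [gam Agam] : exists gam, outer_cap G A = gam%:E.
  by exists (fine (outer_cap G A)); rewrite fineK// ge0_fin_numE// outer_cap_ge0.
have gam0 : (0 <= gam)%R by rewrite -lee_fin -Agam outer_cap_ge0.
have [mu [fmu mugam A0]] :=
  outer_cap_minimizer X_hausdorff X_lc X_sc G_kernel G_perfect Agam.
have [Q0 Qgam] := quasiclosure_outer_cap X_hausdorff X_lc X_sc G_kernel G_perfect
  A_qcl Agam fmu mugam A0.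
have [qQ _ _] := A_qcl.
have [Qmu muT mu1] := quasiclosed_equilibrium X_hausdorff X_lc X_sc G_kernel G_perfect
  G_max qQ Qgam fmu mugam Q0.
have norm_mu : energy_norm G mu = gam%:E.
  by rewrite energy_normE// mugam sqrtr_sqr ger0_norm.
have eq1 E : quasi_everywhere_on G E (fun x => 1 <= potential G mu x) ->
    quasi_everywhere_on G E (fun x => potential G mu x = 1).
  move=> [N [NE N0 HN]]; exists N; split => // x /HN h.
  by apply/eqP; rewrite eq_le mu1.
have A1 := quasi_everywhere_level A0; have Q1 := quasi_everywhere_level Q0.
have Emu : finite_energy_on G Astar mu by split => //; exact/(feP G_kernel).
have [eq_mu char_mu] := qe_one_equilibrium X_hausdorff X_lc X_sc G_kernel G_perfect
  Emu (eq1 _ Q1).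
split; first by rewrite Agam; apply: quasiclosed_has_capacity Q0.
exists mu; split; first by split => //; exact: char_mu.
split; [exact: eq1|exact: eq1|exact: mu1| |split].
- by rewrite muT norm_mu Agam.
- by exists mu; [split => //; exact/(feP G_kernel)|rewrite Agam].
- move=> lam /(feP G_kernel) flam /qe_level_outer_cap0 lam0.
  by rewrite (energy_normE G_kernel)//; apply: outer_cap_le_norm => //; exact: lam0.
Qed.
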